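(* Let the dimension $d\ge 1$ be a constant, let $\bm{x}_1,\dots,\bm{x}_n$ be fixed (non-random) feature vectors in $[-K,K]^d$, where $K>0$ is a constant, and let $$y_i=f^*(\bm{x}_i)\,\xi_i+\tau_i,\qquad i=1,\dots,n,$$ where $\xi_1,\dots,\xi_n$ are i.i.d. $N(0,1)$, $\tau_1,\dots,\tau_n$ are i.i.d. $N(0,\sigma_\tau^2)$, the two noise sequences are independent, and $\sigma_\tau\ge 0$ is known and at most a constant. Assume $f^*\in\mathcal H(d,l,\mathcal P)$, that the dimension-adjusted smoothness $\gamma^*$ of $\mathcal H(d,l,\mathcal P)$ satisfies $\gamma^*>\tfrac12$, and that $f_{\min}\le f^*(\bm{x})\le f_{\max}$ for all $\bm{x}$ in the domain $[-K,K]^d$, where $0<M^{-1}<f_{\min}<f_{\max}<M$ are constants and $M>0$ is chosen as a large constant. Suppose that, for suitable constants $c_1,\dots,c_6>0$ depending only on $l$ and $\mathcal P$, the network hyperparameters satisfy $$c_1\le L\le c_2,\qquad c_3\log n\le \log B\le c_4\log n,\qquad c_5\Big(\frac{n}{\log n}\Big)^{\frac1{4\gamma^*+2}}\le N\le c_6\Big(\frac{n}{\log n}\Big)^{\frac1{4\gamma^*+2}}.$$ Let $$\hat f\in\operatorname*{argmin}_{f\in\mathcal G(L,d,1,N,M,B)}\ \left\{\frac1n\sum_{i=1}^n\frac{y_i^2}{f(\bm{x}_i)^2+\sigma_\tau^2}+\frac1n\sum_{i=1}^n\log\big(f(\bm{x}_i)^2+\sigma_\tau^2\big)\right\}.$$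 Then there are constants $C',c'>0$ (not depending on $n$) such that, with probability at least $1-n^{-c'}$, $$\|\hat f-f^*\|_n^2\le C'\,(\log n)^{\frac{2\gamma^*}{2\gamma^*+1}}\; n^{-\frac{2\gamma^*}{2\gamma^*+1}}.$$
   Context: ''Constant'' means a quantity not depending on the sample size $n$. Empirical norm: $\|f\|_n^2=\frac1n\sum_{i=1}^n f(\bm{x}_i)^2$. Deep ReLU network class. Let $\bar\sigma(z)=\max\{z,0\}$, applied coordinatewise. A ReLU network with $L$ hidden layers, input dimension $d_{in}$, output dimension $d_{out}$ and width $N$ is a map $g=\mathcal L_{L+1}\circ\bar\sigma\circ\mathcal L_L\circ\bar\sigma\circ\cdots\circ\mathcal L_2\circ\bar\sigma\circ\mathcal L_1$, where $\mathcal L_\ell(\bm{z})=\bm{W}_\ell\bm{z}+\bm{b}_\ell$ with $\bm{W}_\ell\in\mathbb R^{d_\ell\times d_{\ell-1}}$, $\bm{b}_\ell\in\mathbb R^{d_\ell}$, $d_0=d_{in}$, $d_1=\dots=d_L=N$, $d_{L+1}=d_{out}$. The class $\mathcal G(L,d_{in},d_{out},N,M,B)$ is the set of functions $\bm{x}\mapsto \mathrm{Tr}_M(g(\bm{x}))\vee M^{-1}$ (coordinatewise), where $g$ is such a network with all entries of all $\bm{W}_\ell,\bm{b}_\ell$ bounded in absolute value by $B$, and $\mathrm{Tr}_M(z)=\mathrm{sgn}(z)(|z|\wedge M)$ coordinatewise. $(\beta,C)$-smoothness. For $\beta,C>0$ write $\beta=r+s$ with $r\ge0$ an integer and $0<s<1$.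 A $d$-variate function $f$ is $(\beta,C)$-smooth if for every multi-index $\alpha=(\alpha_1,\dots,\alpha_d)$ of non-negative integers with $\sum_j\alpha_j=r$ the partial derivative $\partial^r f/(\partial x_1^{\alpha_1}\cdots\partial x_d^{\alpha_d})$ exists and satisfies $|\partial^\alpha f(\bm{x})-\partial^\alpha f(\bm{z})|\le C\|\bm{x}-\bm{z}\|_2^s$ for all $\bm{x},\bm{z}$. Hierarchical composition class. Fix a constant $C>0$ and a set $\mathcal P\subset[1,\infty)\times\mathbb N^+$ with $\sup_{(\beta,t)\in\mathcal P}(\beta\vee t)<\infty$. $\mathcal H(d,1,\mathcal P)$ is the set of $h:\mathbb R^d\to\mathbb R$ of the form $h(\bm{x})=g(\bm{x}_{\mathcal J})$, where $g:\mathbb R^t\to\mathbb R$ is $(\beta,C)$-smooth for some $(\beta,t)\in\mathcal P$ and $\mathcal J\subseteq\{1,\dots,d\}$, $|\mathcal J|=t$. For $l\ge2$, $\mathcal H(d,l,\mathcal P)$ is the set of $h(\bm{x})=g(f_1(\bm{x}),\dots,f_t(\bm{x}))$, where $g:\mathbb R^t\to\mathbb R$ is $(\beta,C)$-smooth for some $(\beta,t)\in\mathcal P$ and $f_1,\dots,f_t\in\mathcal H(d,l-1,\mathcal P)$. Dimension-adjusted smoothness: $\gamma^*=\beta^*/d^*$ with $(\beta^*,d^* )\in\operatorname{argmin}_{(\beta,t)\in\mathcal P}\beta/t$. *)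

(* Defs.v *)
From HB Require Import structures.
From mathcomp Require Import all_boot all_order all_algebra.
From mathcomp Require Import all_classical all_reals all_analysis.

Set Implicit Arguments.
Unset Strict Implicit.
Unset Printing Implicit Defensive.

Import Order.TTheory GRing.Theory Num.Theory.
Import numFieldNormedType.Exports.

Local Open Scope classical_set_scope.
Local Open Scope ring_scope.

(* Points of R^d are column vectors. *)

Definition argmin (R : realType) (T : Type) (A : set T) (J : T -> R) : set T :=
  [set f | A f /\ forall g, A g -> J f <= J g].

Section Smoothness.
Variable R : realType.

(* The library norm on 'cV_d is the sup norm. *)
Definition enorm (d : nat) (x : 'cV[R]_d) : R :=
  Num.sqrt (\sum_(i < d) x i 0 ^+ 2).

(* [pderivs [:: i1; ...; ir] f] is the iterated partial derivative
   d_i1 (... (d_ir f)); ['D_v] is a junk value where the limit does not exist,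
   so existence is tracked separately by [pderivable]. *)
Fixpoint pderivs (t : nat) (s : seq 'I_t) (f : 'cV[R]_t -> R) : 'cV[R]_t -> R :=
  if s is i :: s' then fun x => 'D_(delta_mx i 0) (pderivs s' f) x else f.

Fixpoint pderivable (t : nat) (s : seq 'I_t) (f : 'cV[R]_t -> R) : Prop :=
  if s is i :: s' then
    pderivable s' f /\ forall x, derivable (pderivs s' f) x (delta_mx i 0)
  else True.

(* 0 repeated alpha_0 times, then 1 repeated alpha_1 times, and so on. *)
Definition mindex_seq (t : nat) (alpha : {ffun 'I_t -> nat}) : seq 'I_t :=
  flatten [seq nseq (alpha i) i | i <- enum 'I_t].

(* With 0 < s < 1, an integer beta has no decomposition r + s, and then no
   function is (beta, C)-smooth. *)
Definition holder_smooth (t : nat) (beta C : R) (f : 'cV[R]_t -> R) : Prop :=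
  exists (r : nat) (s : R), [/\ 0 < s < 1, beta = r%:R + s &
    forall alpha : {ffun 'I_t -> nat}, (\sum_(j < t) alpha j)%N = r ->
      pderivable (mindex_seq alpha) f /\
      forall x z : 'cV[R]_t,
        `|pderivs (mindex_seq alpha) f x - pderivs (mindex_seq alpha) f z|
          <= C * enorm (x - z) `^ s].

End Smoothness.

Section HierarchicalComposition.
Variable R : realType.

Definition admissible (PP : set (R * nat)) : Prop :=
  (forall bt, PP bt -> 1 <= bt.1 /\ (0 < bt.2)%N) /\
  has_ubound [set Num.max bt.1 bt.2%:R | bt in PP].

(* x_J, the coordinates of x in J listed in increasing order. *)
Definition subvec (d : nat) (J : {set 'I_d}) (x : 'cV[R]_d) : 'cV[R]_#|J| :=
  \col_(j < #|J|) x (enum_val j) 0.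

(* The class H(d, l, PP); it is only meant for l >= 1. *)
Fixpoint hclass (C : R) (PP : set (R * nat)) (d l : nat)
    : set ('cV[R]_d -> R) :=
  match l with
  | 0 => set0
  | 1 => [set h | exists (J : {set 'I_d}) (beta : R) (g : 'cV[R]_#|J| -> R),
           [/\ PP (beta, #|J|), holder_smooth beta C g &
               h = fun x => g (subvec J x)]]
  | l'.+1 => [set h | exists (t : nat) (beta : R) (g : 'cV[R]_t -> R)
               (f : 'I_t -> 'cV[R]_d -> R),
           [/\ PP (beta, t), holder_smooth beta C g,
               forall j, hclass C PP l' (f j) &
               h = fun x => g (\col_(j < t) f j x)]]
  end.

Definition is_dim_adj_smoothness (PP : set (R * nat)) (gamma : R) : Prop :=
  exists2 bt, argmin PP (fun bt => bt.1 / bt.2%:R) bt & gamma = bt.1 / bt.2%:R.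

End HierarchicalComposition.

Section ReLUNetworks.
Variable R : realType.

Definition relu (m : nat) (z : 'cV[R]_m) : 'cV[R]_m :=
  \col_i Num.max (z i 0) 0.

Definition mx_bounded (m p : nat) (B : R) (A : 'M[R]_(m, p)) : Prop :=
  forall i j, `|A i j| <= B.

(* Networks with L hidden layers of width N, built from the input side. *)
Fixpoint relu_net (N dout : nat) (B : R) (L din : nat)
    : set ('cV[R]_din -> 'cV[R]_dout) :=
  match L with
  | 0 => [set g | exists (W : 'M[R]_(dout, din)) (b : 'cV[R]_dout),
           [/\ mx_bounded B W, mx_bounded B b & g = fun x => W *m x + b]]
  | L'.+1 => [set g | exists (W : 'M[R]_(N, din)) (b : 'cV[R]_N)
               (h : 'cV[R]_N -> 'cV[R]_dout),
           [/\ mx_bounded B W, mx_bounded B b, @relu_net N dout B L' N h &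
               g = fun x => h (relu (W *m x + b))]]
  end.

Definition trunc (M z : R) : R := Num.sg z * Num.min `|z| M.

Definition relu_class (L din dout N : nat) (M B : R)
    : set ('cV[R]_din -> 'cV[R]_dout) :=
  [set f | exists2 g, @relu_net N dout B L din g &
     f = fun x => \col_i Num.max (trunc M (g x i 0)) M^-1].

(* The real-valued class G(L, d, 1, N, M, B). *)
Definition relu_class1 (L d N : nat) (M B : R) : set ('cV[R]_d -> R) :=
  [set (fun x => f x 0 0) | f in @relu_class L d 1 N M B].

End ReLUNetworks.

Arguments relu_class1 : clear implicits.

Section Regression.
Variable R : realType.

Definition emp_sqnorm (d n : nat) (x : 'I_n -> 'cV[R]_d) (f : 'cV[R]_d -> R)
    : R :=
  n%:R^-1 * \sum_(i < n) f (x i) ^+ 2.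

Definition nll (d n : nat) (x : 'I_n -> 'cV[R]_d) (sigma : R) (y : 'I_n -> R)
    (f : 'cV[R]_d -> R) : R :=
  n%:R^-1 * \sum_(i < n) (y i ^+ 2 / (f (x i) ^+ 2 + sigma ^+ 2)) +
  n%:R^-1 * \sum_(i < n) ln (f (x i) ^+ 2 + sigma ^+ 2).

End Regression.

Section Probability.
Variables (R : realType) (disp : measure_display) (Om : measurableType disp).
Variable Pr : probability Om R.
Local Open Scope ereal_scope.

(* N(0, sigma^2); the library's [normal_prob m 0] is the uniform law on [0, 1],
   not the Dirac mass. *)
Definition centered_gaussian (sigma : R) (X : {RV Pr >-> R}) : Prop :=
  forall A : set R, measurable A ->
    distribution Pr X A =
      (if sigma == 0%R then \d_(0%R : R) A else normal_prob 0%R sigma A).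

Definition mutually_independent (n : nat) (X : 'I_n -> {RV Pr >-> R}) : Prop :=
  forall (J : {set 'I_n}) (A : 'I_n -> set R),
    (forall i, measurable (A i)) ->
    Pr (\bigcap_(i in [set` J]) (X i @^-1` A i)) =
      \prod_(i in J) Pr (X i @^-1` A i).

(* The sigma-algebra on Om generated by a family of random variables. *)
Definition sigma_family (n : nat) (X : 'I_n -> {RV Pr >-> R}) : set (set Om) :=
  <<s [set E | exists i, exists2 A : set R, measurable A & E = X i @^-1` A] >>.

Definition independent_families (n m : nat) (X : 'I_n -> {RV Pr >-> R})
    (Y : 'I_m -> {RV Pr >-> R}) : Prop :=
  forall E F, sigma_family X E -> sigma_family Y F ->
    Pr (E `&` F) = Pr E * Pr F.

End Probability.

(* Main.v *)
Require Import Defs.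
From HB Require Import structures.
From mathcomp Require Import all_boot all_order all_algebra.
From mathcomp Require Import all_classical all_reals all_analysis.
From mathcomp Require Import measurable_realfun.
From mathcomp Require Import ring lra zify.
Set Implicit Arguments.
Unset Strict Implicit.
Unset Printing Implicit Defensive.

Import Order.TTheory GRing.Theory Num.Theory.
Import numFieldNormedType.Exports.
Local Open Scope classical_set_scope.
Local Open Scope ring_scope.

(** The fitted network beats every competitor [u] of the class in the empirical
    objective, which splits the risk into a bias and a fluctuation term.

    Fluctuations: the [y_i] are independent [N(0, f*(x_i)^2 + sigma^2)], so that
    weighted sums of the centered [y_i^2] have explicit exponential moments.  A
    union bound over a grid of network parameters (of log-cardinality
    [N^2 log n], the depth being fixed), combined with the quadratic growth of
    [t - 1 - ln t] around [1], yields
    [|fhat - f*|_n^2 <= C (|u - f*|_n^2 + N^2 log n / n)].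

    Bias: only the values at the [n] data points matter.  Shifting the data keeps
    them away from the grid lines, so steep ReLU ramps compute their base [b] digits
    exactly.  The first two digits of all coordinates index a table of [Y^2] values,
    which width of order [Y] suffices to look up, one digit vector weighting the
    columns and the other one selecting the row; the later digits give the local
    coordinate, in which an interpolation polynomial is evaluated by exact
    digit-by-real products.  The error is [Y^(- 2 gamma)] at width of order [Y];
    compositions follow by Lipschitz continuity, and [Y = (n / log n)^(1/(4 gamma + 2))]
    balances both terms. *)

(** * Exponential moments of Gaussian quadratic forms *)

(** The entropy [N^2 log n] counts every weight of the dense layers, so at width of order [Y] the
    bias has to be that of [Y^2] pieces; one piece per unit would only give [Y^(- gamma)]. This
    forces the table to be stored in the weights between two layers. The depth is constant, but the
    weights may be polynomial in [n]: this pays for ramps of slope about [n b^D], which cannot be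
    exact on the whole cube but are so at [n] points kept away from the jumps. The digits serve
    twice, as exact selectors and as exact factors of products, so that no approximate
    multiplication occurs.

    The fast rate comes without localisation: the exponential moment at a fixed tilt has a variance
    term proportional to the same squared relative error that bounds the excess risk from below, and
    a small enough tilt absorbs it. All random statements concern a finite deterministic grid, so
    [fhat] may depend on the sample in any way, measurable or not.

    In compositions the inner errors pass through the outer function; [beta >= 1] and [s < 1] supply
    the first derivative behind its Lipschitz bound. *)

Section density.
Local Open Scope ereal_scope.
Import HBNNSimple.

(* Integrating against a measure that is only known through its values on sets:
   [c * nu] is the image under [X] of [G] times [P]. *)
Lemma ge0_integral_weighted_image d d' (Om : measurableType d)
    (T : measurableType d') (R : realType) (P : {measure set Om -> \bar R})
    (nu : {measure set T -> \bar R}) (X : Om -> T) (G : Om -> R)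
    (c : R) (h : T -> \bar R) :
  measurable_fun setT X -> measurable_fun setT G -> (forall w, 0 <= G w)%R ->
  (0 <= c)%R ->
  (forall S, measurable S -> \int[P]_w ((\1_(X @^-1` S) w)%:E * (G w)%:E) = c%:E * nu S) ->
  measurable_fun setT h -> (forall x, 0 <= h x) ->
  \int[P]_w (h (X w) * (G w)%:E) = c%:E * \int[nu]_x h x.
Proof.
move=> mX mG G0 c0 XG mh h0.
have mXS S : measurable S -> measurable (X @^-1` S).
  by move=> mS; rewrite -[X in measurable X]setTI; exact: mX.
have nnsfunE (f : {nnsfun T >-> R}) :
    \int[P]_w ((f (X w))%:E * (G w)%:E) = c%:E * \int[nu]_x (f x)%:E.
  rewrite integralT_nnsfun sintegralE ge0_mule_fsumr; last first.
    by move=> r; exact: nnsfun_mulemu_ge0.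
  under eq_integral => w _.
    rewrite (fimfunE f (X w)) -fsumEFin// ge0_mule_fsuml; last first.
      by move=> r; rewrite EFinM nnfun_muleindic_ge0.
    over.
  rewrite ge0_integral_fsum//.
  - apply: eq_fsbigr => r; rewrite inE => -[x _ fxr].
    have r0 : (0 <= r)%R by rewrite -fxr; exact: fun_ge0.
    rewrite muleCA -XG; last by apply: measurable_funPTI; exact: measurable_set1.
    rewrite -ge0_integralZl//.
    + by apply: eq_integral => w _; rewrite EFinM muleA.
    + apply: emeasurable_funM; apply/measurable_EFinP => //.
      apply: measurable_indic; apply: mXS; apply: measurable_funPTI; exact: measurable_set1.
    + by move=> w _; rewrite mule_ge0// lee_fin.
  - move=> r; apply: emeasurable_funM; apply/measurable_EFinP => //.
    apply: measurable_funM => //.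
    by apply: (measurableT_comp _ mX) => //; exact: measurable_indic.
  - by move=> r w _; rewrite mule_ge0 ?lee_fin//= -lee_fin EFinM;
      exact: nnfun_muleindic_ge0.
pose f_ := nnsfun_approx measurableT mh.
transitivity (lim (\int[P]_w ((f_ n (X w))%:E * (G w)%:E) @[n --> \oo])).
  rewrite -monotone_convergence//=.
  - apply: eq_integral => w _; apply/esym/cvg_lim => //=.
    by apply: cvgeZr => //; exact: cvg_nnsfun_approx.
  - move=> n; apply: emeasurable_funM; apply/measurable_EFinP => //.
    exact: measurableT_comp.
  - by move=> n w _; rewrite mule_ge0// lee_fin.
  - move=> w _ a b ab; apply: lee_wpmul2r; rewrite lee_fin//.
    exact/lefP/nd_nnsfun_approx.
have -> : \int[nu]_x h x = lim (\int[nu]_x (f_ n x)%:E @[n --> \oo]).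
  rewrite -monotone_convergence//=.
  - apply: eq_integral => w _; apply/esym/cvg_lim => //=.
    exact: cvg_nnsfun_approx.
  - by move=> n; exact/measurable_EFinP.
  - by move=> n w _; rewrite lee_fin.
  - by move=> w _ a b ab; rewrite lee_fin; exact/lefP/nd_nnsfun_approx.
rewrite -limeMl//.
  by apply: congr_lim; apply/funext => n /=; exact: nnsfunE.
apply/ereal_nondecreasing_is_cvgn => x y xy; apply: ge0_le_integral => //=.
- by move=> ? _; rewrite lee_fin.
- exact/measurable_EFinP.
- exact/measurable_EFinP.
- by move=> ? _; rewrite lee_fin; exact/lefP/nd_nnsfun_approx.
Qed.
End density.

Section gaussian.
Local Open Scope ereal_scope.

Lemma ge0_integral_normal_prob (R : realType) (m s : R) (h : R -> \bar R) :
  measurable_fun setT h -> (forall x, 0 <= h x) ->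
  \int[normal_prob m s]_x h x =
  \int[lebesgue_measure]_x (h x * (normal_pdf m s x)%:E).
Proof.
move=> mh h0; rewrite -[LHS]mul1e.
apply/esym.
have E := @ge0_integral_weighted_image _ _ (measurableTypeR R)
  (measurableTypeR R) R (@lebesgue_measure R)
  (normal_prob m s) idfun (normal_pdf m s) 1%R h.
apply: E => //.
- exact: measurable_id.
- exact: measurable_normal_pdf.
- by move=> x; exact: normal_pdf_ge0.
- move=> S mS; rewrite mul1e /= /normal_prob [in RHS]integral_mkcond.
  apply: eq_integral => x _; rewrite preimage_id patchE /= indicE.
  by case: ifPn => _; rewrite ?mul1e ?mul0e.
Qed.

Lemma measurable_exp_sqr (R : realType) (s a w : R) :
  measurable_fun setT (fun x : R => expR (s * (a * x + w) ^+ 2)%R).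
Proof.
apply: measurableT_comp => //; apply: measurable_funM => //.
by apply: measurable_funX; apply: measurable_funD.
Qed.

(** Completing the square: the tilted density is a constant times the normal density of mean [m] and
    deviation [sig / sqrt k]. The shift [w] stands for the other noise, frozen while this one is
    integrated. *)
Lemma integral_normal_prob_exp_sqr (R : realType) (sig s a w : R) :
  sig != 0%R -> (0 < 1 - 2 * s * a ^+ 2 * sig ^+ 2)%R ->
  \int[normal_prob 0%R sig]_x (expR (s * (a * x + w) ^+ 2)%R)%:E =
  ((Num.sqrt (1 - 2 * s * a ^+ 2 * sig ^+ 2))^-1 *
   expR (s * w ^+ 2 / (1 - 2 * s * a ^+ 2 * sig ^+ 2)))%:E.
Proof.
move=> sig0 k0; set k := (1 - _)%R in k0 *.
have sk0 : (0 < Num.sqrt k)%R by rewrite sqrtr_gt0.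
have mexp := measurable_exp_sqr s a w.
rewrite ge0_integral_normal_prob//; last exact/measurable_EFinP.
set c := (_^-1 * _)%R; pose m := (2 * s * a * w * sig ^+ 2 / k)%R.
transitivity (\int[lebesgue_measure]_x
    (c%:E * (normal_pdf m (sig / Num.sqrt k) x)%:E)).
  apply: eq_integral => x _; rewrite -!EFinM; congr _%:E.
  rewrite !normal_pdfE ?mulf_neq0 ?invr_neq0 ?(gt_eqF sk0)//.
  rewrite /normal_peak /normal_fun /c.
  have -> : (Num.sqrt ((sig / Num.sqrt k) ^+ 2 * pi *+ 2) =
             Num.sqrt (sig ^+ 2 * pi *+ 2) / Num.sqrt k)%R.
    rewrite expr_div_n sqr_sqrtr ?ltW// -sqrtrV ?ltW//.
    rewrite -sqrtrM; last by rewrite mulrn_wge0// mulr_ge0 ?pi_ge0 ?exprn_even_ge0.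
    by congr Num.Def.sqrtr; field; rewrite gt_eqF.
  rewrite invfM invrK.
  have E : (s * (a * x + w) ^+ 2 + - (x - 0) ^+ 2 / (sig ^+ 2 *+ 2) =
     s * w ^+ 2 / k + - (x - m) ^+ 2 / ((sig / Num.sqrt k) ^+ 2 *+ 2))%R.
    rewrite expr_div_n sqr_sqrtr ?ltW// /m.
    have k0' : k != 0%R by rewrite gt_eqF.
    by rewrite /k; field; rewrite -/k k0'.
  transitivity ((Num.sqrt (sig ^+ 2 * pi *+ 2))^-1 *
    expR (s * (a * x + w) ^+ 2 + - (x - 0) ^+ 2 / (sig ^+ 2 *+ 2)))%R.
    by rewrite expRD; ring.
  have p0 : Num.sqrt (sig ^+ 2 * pi *+ 2) != 0%R.
    by have := normal_peak_gt0 sig0; rewrite invr_gt0 => /gt_eqF ->.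
  by rewrite E expRD; field; rewrite p0 gt_eqF.
rewrite ge0_integralZl//.
- by rewrite integral_normal_pdf mule1.
- by apply/measurable_EFinP; exact: measurable_normal_pdf.
- by move=> x _; rewrite lee_fin normal_pdf_ge0.
- by rewrite lee_fin mulr_ge0 ?invr_ge0 ?expR_ge0 ?ltW.
Qed.

Lemma integral_centered_gaussian_exp_sqr (R : realType) d
    (Om : measurableType d) (P : probability Om R) (sig s a w : R)
    (X : {RV P >-> R}) :
  centered_gaussian sig X -> (0 < 1 - 2 * s * a ^+ 2 * sig ^+ 2)%R ->
  \int[P]_o (expR (s * (a * X o + w) ^+ 2)%R)%:E =
  ((Num.sqrt (1 - 2 * s * a ^+ 2 * sig ^+ 2))^-1 *
   expR (s * w ^+ 2 / (1 - 2 * s * a ^+ 2 * sig ^+ 2)))%:E.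
Proof.
move=> gX k0.
have mexp := measurable_exp_sqr s a w.
have E0 x : 0 <= (expR (s * (a * x + w) ^+ 2)%R)%:E by rewrite lee_fin expR_ge0.
have mE : measurable_fun setT (fun x : R => (expR (s * (a * x + w) ^+ 2)%R)%:E).
  exact/measurable_EFinP.
rewrite -(ge0_integral_distribution X mE E0).
(* For [sig = 0] the law is the Dirac mass at 0, and the formula holds with denominator 1. *)
have [sig0|sig0] := eqVneq sig 0%R.
  rewrite (eq_measure_integral \d_(0%R : R)); last first.
    by move=> A mA _; have := gX A mA; rewrite sig0 eqxx.
  rewrite integral_dirac//= diracT mul1e sig0; congr _%:E.
  by rewrite mulr0 add0r expr0n /= mulr0 subr0 sqrtr1 !invr1 mul1r mulr1.
rewrite ge0_integral_distribution// -integral_normal_prob_exp_sqr// -[RHS]mul1e.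
have E := @ge0_integral_weighted_image _ _ Om (measurableTypeR R) R P
  (normal_prob 0%R sig) X (cst 1%R) 1%R
  (fun x => (expR (s * (a * x + w) ^+ 2)%R)%:E).
rewrite -E//; first by apply: eq_integral => o _; rewrite mule1.
- by move=> mT B mB; rewrite setTI; exact: measurable_funPTI.
- move=> S mS; rewrite mul1e; transitivity (P (X @^-1` S)); last first.
    by have := gX S mS; rewrite (negbTE sig0).
  have mXS : measurable (X @^-1` S) by exact: measurable_funPTI.
  rewrite -[in RHS](setIT (X @^-1` S)) -integral_indic//.
  by apply: eq_integral => o _; rewrite mule1.
Qed.

End gaussian.

(** * Integrals of products under independence *)

Section independence.
Local Open Scope ereal_scope.

(** Independence is given for events only, so the factors become general one at a time: in [main k]
    those of index at least [k] are indicators. In the step, the induction hypothesis with [\1_S] in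
    place of the factor [j] computes the image under [X j] of the measure weighted by the other
    factors, and this determines the integral of [h j]. *)
Lemma integral_prod_mutually_independent (R : realType) d
    (Om : measurableType d) (P : probability Om R) (n : nat)
    (X : 'I_n -> {RV P >-> R}) (h : 'I_n -> R -> R) (e : 'I_n -> R) :
  mutually_independent X ->
  (forall i, measurable_fun setT (h i)) -> (forall i x, (0 <= h i x)%R) ->
  (forall i, \int[P]_w (h i (X i w))%:E = (e i)%:E) ->
  \int[P]_w (\prod_i h i (X i w))%:E = (\prod_i e i)%:E.
Proof.
move=> indX mh h0 he.
suff main k : (k <= n)%N -> forall (h : 'I_n -> R -> R) (e : 'I_n -> R),
    (forall i, measurable_fun setT (h i)) -> (forall i x, (0 <= h i x)%R) ->
    (forall i, \int[P]_w (h i (X i w))%:E = (e i)%:E) ->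
    (forall i : 'I_n, (k <= i)%N -> exists2 S, measurable S & h i = \1_S) ->
    \int[P]_w (\prod_i h i (X i w))%:E = (\prod_i e i)%:E.
  by apply: (main n) => // i; rewrite leqNgt ltn_ord.
move=> {h e mh h0 he}; elim: k => [|k IH].
  move=> _ h e mh h0 he hI.
  have /choice[S hS] : forall i, exists S, measurable S /\ h i = \1_S.
    by move=> i; have [//|S] := hI i; exists S.
  have eS i : e i = fine (P (X i @^-1` S i)).
    have [mS hiS] := hS i.
    have mXS : measurable (X i @^-1` S i) by exact: measurable_funPTI.
    apply: EFin_inj; rewrite -he hiS fineK ?fin_num_measure//.
    by rewrite -[in RHS](setIT (X i @^-1` S i)) -integral_indic.
  pose J : {set 'I_n} := [set: 'I_n]%SET.
  pose D : set Om := \bigcap_(i in [set` J]) (X i @^-1` S i).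
  have mD : measurable D.
    apply: fin_bigcap_measurable; first exact: finite_finset.
    by move=> i _; apply: measurable_funPTI; have [] := hS i.
  transitivity (\int[P]_w (\1_D w)%:E).
    apply: eq_integral => w _; congr _%:E.
    transitivity (\prod_i \1_(X i @^-1` S i) w : R)%R.
      by apply: eq_bigr => i _; have [_ ->] := hS i; rewrite !indicE.
    rewrite [RHS]indicE.
    have [wD|] := boolP (w \in D).
      apply: big1 => i _; rewrite indicE mem_set//.
      by move/set_mem : wD => /(_ i); apply; rewrite /= inE.
    move=> wD; apply/eqP; rewrite prodf_seq_eq0; apply/hasP.
    have /existsNP[i /not_implyP[_ iD]] : ~ D w by move/negP: wD; rewrite inE.
    exists i; first exact: mem_index_enum.
    by rewrite /= indicE memNset.
  rewrite integral_indic// setIT.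
  transitivity (\prod_(i in J) P (X i @^-1` S i)).
    by apply: (indX J S) => i; have [] := hS i.
  rewrite -prodEFin; apply: eq_big => [i|i _]; first by rewrite finset.in_setT.
  rewrite eS fineK// fin_num_measure//.
  by apply: measurable_funPTI; have [] := hS i.
move=> kn h e mh h0 he hI; pose j := Ordinal kn.
pose G w := (\prod_(i < n | i != j) h i (X i w))%R.
pose c := (\prod_(i < n | i != j) e i)%R.
have e0 i : (0 <= e i)%R.
  by rewrite -lee_fin -he; apply: integral_ge0 => w _; rewrite lee_fin.
rewrite (bigD1 j)//= EFinM muleC -/c -he.
transitivity (\int[P]_w ((h j (X j w))%:E * (G w)%:E)).
  by apply: eq_integral => w _; rewrite (bigD1 j)//= EFinM.
pose H x := (h j x)%:E.
rewrite -(@ge0_integral_distribution _ _ _ _ _ P (X j) H)//; last 2 first.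
- exact/measurable_EFinP.
- by move=> x; rewrite lee_fin.
apply: (@ge0_integral_weighted_image _ _ _ _ _ P _ (X j) G c H) => //.
- rewrite /G; under eq_fun do rewrite -big_filter.
  by apply: measurable_prod => i _; exact: measurableT_comp.
- by move=> w; exact: prodr_ge0.
- by apply: prodr_ge0.
- move=> S mS.
  pose h' i := if i == j then \1_S else h i.
  pose e' i := if i == j then fine (P (X j @^-1` S)) else e i.
  have mXS : measurable (X j @^-1` S) by exact: measurable_funPTI.
  have -> : c%:E * P (X j @^-1` S) = (\prod_i e' i)%:E.
    rewrite (bigD1 j)//= EFinM {1}/e' eqxx fineK ?fin_num_measure// muleC.
    by congr (_ * _%:E); apply: eq_bigr => i /negbTE ij; rewrite /e' ij.
  rewrite -(IH (ltnW kn) h' e').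
  + apply: eq_integral => w _; rewrite [in RHS](bigD1 j)//= EFinM; congr (_ * _%:E).
      by rewrite /h' eqxx !indicE.
    by apply: eq_bigr => i /negbTE ij; rewrite /h' ij.
  + by move=> i; rewrite /h'; case: ifPn => _ //; exact: measurable_indic.
  + by move=> i x; rewrite /h'; case: ifPn.
  + move=> i; rewrite /h' /e'; case: ifPn => [/eqP ->|//].
    by rewrite fineK ?fin_num_measure// -[in RHS](setIT (X j @^-1` S)) -integral_indic.
  + move=> i ki; rewrite /h'; case: ifPn => [_|ij]; first by exists S.
    by apply: hI; rewrite ltn_neqAle ki andbT eq_sym; apply: contra ij => /eqP ik; exact/eqP/val_inj.
- exact/measurable_EFinP.
- by move=> x; rewrite lee_fin.
Qed.
End independence.

Section independence_sigma.
Local Open Scope ereal_scope.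

(** [Om] is viewed as two measurable spaces, one for each generated sigma-algebra. Independence says
    that the diagonal map sends [P] to the product of its two restrictions; Tonelli does the
    rest. *)
Lemma ge0_integral_independent_sigma (R : realType) d (Om : measurableType d)
    (P : probability Om R) (S1 S2 : set (set Om))
    (H : g_sigma_algebraType S1 * g_sigma_algebraType S2 -> \bar R) :
  S1 `<=` measurable -> S2 `<=` measurable ->
  (forall E F, <<s S1 >> E -> <<s S2 >> F -> P (E `&` F) = P E * P F) ->
  measurable_fun setT H -> (forall z, 0 <= H z) ->
  \int[P]_w H (w, w) = \int[P]_v \int[P]_u H (u, v).
Proof.
move=> mS1 mS2 indS mH H0.
have sub1 : <<s S1 >> `<=` @measurable d Om.
  by apply: smallest_sub => //; exact: sigma_algebra_measurable.
have sub2 : <<s S2 >> `<=` @measurable d Om.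
  by apply: smallest_sub => //; exact: sigma_algebra_measurable.
pose i1 : Om -> g_sigma_algebraType S1 := fun w => w.
pose i2 : Om -> g_sigma_algebraType S2 := fun w => w.
have mi1 : measurable_fun setT i1.
  by move=> _ A mA; rewrite setTI; exact: sub1.
have mi2 : measurable_fun setT i2.
  by move=> _ A mA; rewrite setTI; exact: sub2.
pose P1 := distribution P (mfun_Sub (mem_set mi1) : {RV P >-> _}).
pose P2 := distribution P (mfun_Sub (mem_set mi2) : {RV P >-> _}).
have mi12 : measurable_fun setT (fun w => (i1 w, i2 w)).
  exact: measurable_fun_pair.
pose P12 := distribution P (mfun_Sub (mem_set mi12) : {RV P >-> _}).
have P12E A : measurable A -> (P1 \x P2) A = P12 A.
  apply: product_measure_unique => E F mE mF.
  exact: indS.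
transitivity (\int[P1 \x P2]_z H z).
  rewrite (eq_measure_integral P12); last by move=> A mA _; exact: P12E.
  by rewrite ge0_integral_distribution.
rewrite fubini_tonelli2//.
rewrite /P2 ge0_integral_distribution//; first last.
- by move=> v; apply: integral_ge0.
- exact: measurable_fun_fubini_tonelli_G.
apply: eq_integral => v _ /=.
rewrite /fubini_G /P1 ge0_integral_distribution//.
exact: measurableT_comp mH (pair2_measurable _).
Qed.
End independence_sigma.

Section exponential_moment.
Local Open Scope ereal_scope.

(** The [xi] are integrated with the [tau] frozen, which leaves a quadratic exponent in [tau] with
    coefficient [s / k]. By [kE] the two normalising factors multiply to that of a single Gaussian
    of variance [a^2 + sig^2]. *)
Lemma integral_prod_exp_sqr (R : realType) d (Om : measurableType d)
    (P : probability Om R) (n : nat) (xi tau : 'I_n -> {RV P >-> R})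
    (sig : R) (a s : 'I_n -> R) :
  (forall i, centered_gaussian 1 (xi i)) ->
  (forall i, centered_gaussian sig (tau i)) ->
  mutually_independent xi -> mutually_independent tau ->
  independent_families xi tau ->
  (forall i, 0 < 1 - 2 * s i * (a i ^+ 2 + sig ^+ 2))%R ->
  \int[P]_w (\prod_i expR (s i * (a i * xi i w + tau i w) ^+ 2)%R)%:E =
  (\prod_i (Num.sqrt (1 - 2 * s i * (a i ^+ 2 + sig ^+ 2)))^-1)%:E.
Proof.
move=> gxi gtau ixi itau ixitau s_small.
pose gen (X : 'I_n -> {RV P >-> R}) : set (set Om) :=
  [set E | exists i, exists2 A : set R, measurable A & E = X i @^-1` A].
have gen_meas X : gen X `<=` measurable.
  by move=> E [i [A mA ->]]; exact: measurable_funPTI.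
have mgen X i :
    measurable_fun setT (X i : g_sigma_algebraType (gen X) -> R).
  by move=> _ A mA; rewrite setTI; apply: sub_sigma_algebra; exists i, A.
pose H (z : g_sigma_algebraType (gen xi) * g_sigma_algebraType (gen tau)) :=
  (\prod_i expR (s i * (a i * xi i z.1 + tau i z.2) ^+ 2)%R)%:E.
have mH : measurable_fun setT H.
  apply/measurable_EFinP; apply: measurable_prod => i _.
  apply: measurableT_comp => //; apply: measurable_funM => //.
  apply: measurable_funX; apply: measurable_funD.
    apply: measurable_funM => //.
    exact: measurableT_comp (mgen xi i) (@measurable_fst _ _ _ _).
  exact: measurableT_comp (mgen tau i) (@measurable_snd _ _ _ _).
have H0 z : 0 <= H z by rewrite lee_fin; apply: prodr_ge0 => i _; exact: expR_ge0.
rewrite (ge0_integral_independent_sigma (gen_meas xi) (gen_meas tau) _ mH H0)//.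
pose k i := (1 - 2 * s i * a i ^+ 2 * 1 ^+ 2)%R.
have k0 i : (0 < k i)%R.
  rewrite /k expr1n mulr1; have := s_small i.
  have := sqr_ge0 sig; have := sqr_ge0 (a i).
  by have [s0|s0] := lerP (s i) 0%R; nra.
have kE i : (1 - 2 * s i * (a i ^+ 2 + sig ^+ 2) =
             k i * (1 - 2 * (s i / k i) * 1 ^+ 2 * sig ^+ 2))%R.
  have kn0 : k i != 0%R by rewrite gt_eqF.
  transitivity (k i - 2 * s i * sig ^+ 2)%R; first by rewrite /k; ring.
  by move: (k i) kn0 => c c0; field.
have k'0 i : (0 < 1 - 2 * (s i / k i) * 1 ^+ 2 * sig ^+ 2)%R.
  by have := s_small i; rewrite kE pmulr_rgt0.
transitivity (\int[P]_v (\prod_i ((Num.sqrt (k i))^-1 *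
    expR (s i / k i * (1 * tau i v + 0) ^+ 2)))%:E).
  apply: eq_integral => v _.
  rewrite (@integral_prod_mutually_independent _ _ _ P n xi
    (fun i x => expR (s i * (a i * x + tau i v) ^+ 2)%R)
    (fun i => (Num.sqrt (k i))^-1 * expR (s i * tau i v ^+ 2 / k i))%R)//.
  all: try by move=> i; exact: measurable_exp_sqr.
  all: try by move=> i x; exact: expR_ge0.
  - by congr EFin; apply: eq_bigr => i _; congr (_ * expR _)%R; ring.
  - by move=> i; exact: (integral_centered_gaussian_exp_sqr _ (gxi i) (k0 i)).
rewrite (@integral_prod_mutually_independent _ _ _ P n tau
  (fun i x => (Num.sqrt (k i))^-1 * expR (s i / k i * (1 * x + 0) ^+ 2))%R
  (fun i => (Num.sqrt (1 - 2 * s i * (a i ^+ 2 + sig ^+ 2)))^-1)%R)//.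
all: try by move=> i; apply: measurable_funM => //; exact: measurable_exp_sqr.
all: try by move=> i x; rewrite mulr_ge0 ?expR_ge0// invr_ge0 sqrtr_ge0.
- move=> i; under eq_integral do rewrite EFinM.
  rewrite ge0_integralZl//.
  + rewrite (integral_centered_gaussian_exp_sqr _ (gtau i))//.
    rewrite -EFinM kE sqrtrM ?ltW// invfM expr0n /= mulr0 mul0r expR0 mulr1.
    by [].
  + apply/measurable_EFinP.
    by apply: (measurableT_comp (measurable_exp_sqr _ _ _)); exact: measurable_funP.
Qed.

End exponential_moment.

(** After taking reciprocals and using [expR y >= 1 + y], what remains is [(1 + z) (1 - z + 2 z^2) =
    1 + z^2 (1 + 2 z) >= 1]. *)
Lemma expR_sub_sqr_le (R : realType) (z : R) :
  - 2^-1 <= z -> expR (z - 2 * z ^+ 2) <= 1 + z.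
Proof.
move=> z2; have z1 : 0 < 1 + z by lra.
rewrite -[z - _]opprK expRN -[leRHS]invrK lef_pV2 ?posrE ?invr_gt0 ?expR_gt0//.
apply: le_trans (expR_ge1Dx _).
rewrite -(ler_pM2l z1) divff ?gt_eqF//.
have : 0 <= z ^+ 2 * (1 + 2 * z) by rewrite mulr_ge0 ?sqr_ge0//; lra.
by move=> h; lra.
Qed.

(** The left side is the moment generating function of the centered square [v - y^2], with [u] the
    tilt times [v]; for small [u] it is sub-Gaussian. Squaring both sides reduces it to the previous
    bound at [2 u]. *)
Lemma expR_sqrtV_le (R : realType) (u : R) : `|u| <= 4^-1 ->
  expR u * (Num.sqrt (1 + 2 * u))^-1 <= expR (4 * u ^+ 2).
Proof.
rewrite ler_norml => /andP[u1 u2].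
have u0 : 0 < 1 + 2 * u by lra.
rewrite ler_pdivrMr ?sqrtr_gt0//.
have -> : expR (4 * u ^+ 2) * Num.sqrt (1 + 2 * u) =
    Num.sqrt (expR (8 * u ^+ 2) * (1 + 2 * u)).
  rewrite sqrtrM ?expR_ge0//; congr (_ * _).
  have -> : 8 * u ^+ 2 = 4 * u ^+ 2 + 4 * u ^+ 2 by ring.
  by rewrite expRD -expr2 sqrtr_sqr ger0_norm ?expR_ge0.
have -> : expR u = Num.sqrt (expR (2 * u)).
  have -> : 2 * u = u + u by ring.
  by rewrite expRD -expr2 sqrtr_sqr ger0_norm ?expR_ge0.
apply: ler_wsqrtr.
have E : 2 * u = 8 * u ^+ 2 + (2 * u - 2 * (2 * u) ^+ 2) by ring.
by rewrite [X in expR X <= _]E expRD ler_pM2l ?expR_gt0//; apply: expR_sub_sqr_le; lra.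
Qed.

(** * Deviation bounds for weighted sums of centered squares *)

Section deviation.

Lemma probability_bigsetU_le (R : realType) d (Om : measurableType d)
    (P : probability Om R) (T : Type) (s : seq T) (F : T -> set Om) (b : R) :
  (forall g, measurable (F g)) -> (forall g, (P (F g) <= b%:E)%E) ->
  (P (\big[setU/set0]_(g <- s) F g) <= ((size s)%:R * b)%:E)%E.
Proof.
move=> mF Pb; elim: s => [|g s IH].
  by rewrite big_nil measure0 mul0r.
rewrite big_cons (le_trans (measureU2 _ _ _))//=.
  by apply: bigsetU_measurable => i _.
by rewrite -[(size s).+1]addn1 natrD mulrDl mul1r addrC EFinD leeD.
Qed.

(** Chernoff's bound at a tilt [s] that is deliberately not optimised: it is common to all weights
    [delta], so that the variance term can later be compared with the curvature of the risk. *)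
Lemma exp_sqr_deviation (R : realType) d (Om : measurableType d)
    (P : probability Om R) (n : nat) (xi tau : 'I_n -> {RV P >-> R})
    (sig : R) (a delta : 'I_n -> R) (s t : R) :
  (forall i, centered_gaussian 1 (xi i)) ->
  (forall i, centered_gaussian sig (tau i)) ->
  mutually_independent xi -> mutually_independent tau ->
  independent_families xi tau ->
  let v i := a i ^+ 2 + sig ^+ 2 in
  let Z w := \sum_i (v i - (a i * xi i w + tau i w) ^+ 2) * delta i in
  0 < s -> (forall i, `|s * delta i * v i| <= 4^-1) ->
  let F := [set w | 4 * s * (\sum_i (delta i * v i) ^+ 2) + t / s <= Z w] in
  measurable F /\ (P F <= (expR (- t))%:E)%E.
Proof.
move=> gxi gtau ixi itau ixitau v Z s0 sv F; rewrite {}/F.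
have mZ : measurable_fun setT Z.
  apply: measurable_sum => i; apply: measurable_funM => //.
  apply: measurable_funB => //; apply: measurable_funX.
  by apply: measurable_funD => //; exact: measurable_funM.
split.
  rewrite -[X in measurable X]setTI.
  exact: measurable_fun_le.
pose ZR : {RV P >-> R} := mfun_Sub (mem_set mZ).
set c := _ + t / s.
apply: le_trans (chernoff ZR c s0) _.
have -> : ('M_P ZR s = \int[P]_w (expR (s * Z w))%:E)%E.
  rewrite /mmt_gen_fun unlock /=; apply: eq_integral => w _ /=.
  by rewrite mulrC.
have k0 i : 0 < 1 - 2 * (- (s * delta i)) * v i.
  by have := sv i; rewrite ler_norml => /andP[]; lra.
have -> : (\int[P]_w (expR (s * Z w))%:E = (\prod_i
    (expR (s * delta i * v i) * (Num.sqrt (1 + 2 * (s * delta i * v i)))^-1))%:E)%E.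
  rewrite big_split/= -expR_sum.
  under eq_integral => w _.
    have -> : s * Z w = \sum_i s * delta i * v i +
        \sum_i (- (s * delta i)) * (a i * xi i w + tau i w) ^+ 2.
      by rewrite -big_split/= mulr_sumr; apply: eq_bigr => i _; ring.
    rewrite expRD [X in _ * X]expR_sum EFinM; over.
  rewrite ge0_integralZl//=.
  - rewrite (integral_prod_exp_sqr gxi gtau)// -EFinM; congr (_ * _)%:E.
    by apply: eq_bigr => i _; congr (Num.sqrt _)^-1; rewrite /v; ring.
  - apply/measurable_EFinP; apply: measurable_prod => i _.
    apply: measurableT_comp => //; apply: measurable_funM => //.
    apply: measurable_funX; apply: measurable_funD => //.
    exact: measurable_funM.
  - by move=> w _; rewrite lee_fin; apply: prodr_ge0 => i _; exact: expR_ge0.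
rewrite -EFinM lee_fin.
have -> : - t = \sum_i (4 * (s * delta i * v i) ^+ 2) - s * c.
  rewrite /c mulrDr [s * (t / s)]mulrC divfK ?gt_eqF// opprD addrA.
  suff -> : \sum_i (4 * (s * delta i * v i) ^+ 2) =
      s * (4 * s * \sum_i (delta i * v i) ^+ 2) by rewrite subrr add0r.
  by rewrite !mulr_sumr; apply: eq_bigr => i _; ring.
rewrite expRD ler_pM2r ?expR_gt0// expR_sum.
apply: ler_prod => i _; rewrite mulr_ge0 ?expR_ge0 ?invr_ge0 ?sqrtr_ge0//=.
exact: expR_sqrtV_le.
Qed.

(** The good event is the complement of a finite union, fixed before any index is inspected; the
    index may then be chosen depending on [w]. *)
Lemma exp_sqr_deviation_uniform (R : realType) d (Om : measurableType d)
    (P : probability Om R) (n : nat) (xi tau : 'I_n -> {RV P >-> R})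
    (sig : R) (a : 'I_n -> R) (T : finType) (delta : T -> 'I_n -> R) (s t : R) :
  (forall i, centered_gaussian 1 (xi i)) ->
  (forall i, centered_gaussian sig (tau i)) ->
  mutually_independent xi -> mutually_independent tau ->
  independent_families xi tau ->
  let v i := a i ^+ 2 + sig ^+ 2 in
  0 < s -> (forall g i, `|s * delta g i * v i| <= 4^-1) ->
  exists A : set Om, [/\ measurable A,
    ((1 - #|T|%:R * expR (- t))%:E <= P A)%E &
    forall w, A w -> forall g,
      \sum_i (v i - (a i * xi i w + tau i w) ^+ 2) * delta g i <=
      4 * s * (\sum_i (delta g i * v i) ^+ 2) + t / s].
Proof.
move=> gxi gtau ixi itau ixitau v s0 sv.
pose Z g w := \sum_i (v i - (a i * xi i w + tau i w) ^+ 2) * delta g i.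
pose F g := [set w | 4 * s * (\sum_i (delta g i * v i) ^+ 2) + t / s <= Z g w].
have FP g := exp_sqr_deviation t gxi gtau ixi itau ixitau s0 (sv g).
have mF g : measurable (F g) by have [] := FP g.
pose U := \big[setU/set0]_(g <- enum T) F g.
have mU : measurable U by apply: bigsetU_measurable => i _.
exists (~` U); split; first exact: measurableC.
- rewrite probability_setC// EFinB leeB//.
  by rewrite cardT; apply: probability_bigsetU_le => // g; have [] := FP g.
- move=> w Uw g; rewrite leNgt; apply/negP => /ltW Zg; apply: Uw.
  by rewrite /U -bigcup_seq; exists g => //=; rewrite mem_enum.
Qed.
End deviation.

(** * Oracle inequality *)

Section divergence.
Variable R : realType.

(** Half of [t - 1 - ln t] is the Kullback-Leibler divergence of centered Gaussians with variance
    ratio [t]. With [u = sqrt t] it satisfies [t - 1 - ln t >= (u - 1)^2], while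
    [(t - 1)^2 = (u + 1)^2 (u - 1)^2] and [(u + 1)^2 <= 2 (t + 1)]. *)
Lemma sub_ln_ge (T t : R) : 0 < t -> t <= T ->
  (2 * (T + 1))^-1 * (t - 1) ^+ 2 <= t - 1 - ln t.
Proof.
move=> t0 tT; pose u := Num.sqrt t.
have u0 : 0 < u by rewrite sqrtr_gt0.
have tu : t = u ^+ 2 by rewrite sqr_sqrtr ?ltW.
have lnu : ln t <= 2 * (u - 1).
  rewrite tu lnXn// -[ln u *+ 2]mulr_natl ler_pM2l//.
  have := le_ln1Dx (x := u - 1); rewrite addrCA subrr addr0; apply.
  by lra.
apply: le_trans (_ : (u - 1) ^+ 2 <= _); last first.
  have -> : (u - 1) ^+ 2 = t - 1 - 2 * (u - 1) by rewrite tu; ring.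
  by lra.
rewrite ler_pdivrMl; last by lra.
have -> : (t - 1) ^+ 2 = (u + 1) ^+ 2 * (u - 1) ^+ 2 by rewrite tu; ring.
apply: ler_wpM2r; first exact: sqr_ge0.
by have := sqr_ge0 (u - 1); nra.
Qed.

(** From [ln t^-1 <= t^-1 - 1] the left side is at most [t - 2 + t^-1 = (t - 1)^2 / t]. *)
Lemma sub_ln_le (T t : R) : 0 < T -> T^-1 <= t ->
  t - 1 - ln t <= T * (t - 1) ^+ 2.
Proof.
move=> T0 Tt; have t0 : 0 < t by apply: lt_le_trans Tt; rewrite invr_gt0.
have : ln t^-1 <= t^-1 - 1.
  have := le_ln1Dx (x := t^-1 - 1); rewrite addrCA subrr addr0; apply.
  have ti0 : 0 < t^-1 by rewrite invr_gt0.
  lra.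
rewrite lnV ?posrE// => lnt.
have : t^-1 * (t - 1) ^+ 2 <= T * (t - 1) ^+ 2.
  by apply: ler_wpM2r; rewrite ?sqr_ge0// -[leRHS]invrK lef_pV2 ?posrE ?invr_gt0.
have -> : t^-1 * (t - 1) ^+ 2 = t - 2 + t^-1.
  by field; rewrite gt_eqF.
by move=> ?; lra.
Qed.

End divergence.

Section precision.
Variables (R : realType) (M smax sig : R).
Hypotheses (M1 : 1 < M) (sig0 : 0 <= sig) (sigmax : sig <= smax).

Local Notation V := (M ^+ 2 + smax ^+ 2).
(** In the objective [y^2] is multiplied by the precision, so function errors are transferred to
    this scale. The lower bound [M^-1] keeps it Lipschitz even when [sig = 0]. *)
Local Notation prec b := ((b ^+ 2 + sig ^+ 2)^-1).
Local Notation inM b := (M^-1 <= b <= M).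

Let M0 : 0 < M. Proof. by apply: lt_trans M1. Qed.

Lemma variance_bounds b : inM b ->
  (M ^+ 2)^-1 <= b ^+ 2 + sig ^+ 2 <= V.
Proof.
have Mi : 0 < M^-1 by rewrite invr_gt0.
move=> /andP[b1 b2]; apply/andP; split.
  rewrite -exprVn; apply: (@le_trans _ _ (b ^+ 2)); last by rewrite lerDl sqr_ge0.
  have b0 : 0 <= b by lra.
  have Mi0 : 0 <= M^-1 by lra.
  by rewrite lerXn2r ?nnegrE.
have b0 : 0 <= b by lra.
have smax0 : 0 <= smax := le_trans sig0 sigmax.
by apply: lerD; rewrite lerXn2r ?nnegrE//; exact: ltW.
Qed.

Lemma variance_gt0 b : inM b -> 0 < b ^+ 2 + sig ^+ 2.
Proof.
move=> /variance_bounds/andP[+ _]; apply: lt_le_trans.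
by rewrite invr_gt0 exprn_gt0.
Qed.

Lemma prec_gt0 b : inM b -> 0 < prec b.
Proof. by move=> bM; rewrite invr_gt0 variance_gt0. Qed.

Lemma prec_le b : inM b -> prec b <= M ^+ 2.
Proof.
move=> bM; rewrite -[leRHS]invrK lef_pV2 ?posrE ?invr_gt0 ?exprn_gt0 ?variance_gt0//.
by have /andP[] := variance_bounds bM.
Qed.

Lemma prec_ge b : inM b -> V^-1 <= prec b.
Proof.
move=> bM; have v0 := variance_gt0 bM; have /andP[_ vV] := variance_bounds bM.
by rewrite lef_pV2 ?posrE//; apply: lt_le_trans vV.
Qed.

Lemma V_gt0 : 0 < V.
Proof. by rewrite ltr_pwDl ?exprn_gt0// sqr_ge0. Qed.

Lemma prec_lip b c : inM b -> inM c ->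
  `|prec b - prec c| <= 2 * M ^+ 5 * `|b - c|.
Proof.
move=> bM cM; have vb := variance_gt0 bM; have vc := variance_gt0 cM.
have -> : prec b - prec c = ((b + c) * (prec b * prec c)) * (c - b).
  by field; rewrite !gt_eqF.
rewrite normrM [`|c - b|]distrC; apply: ler_wpM2r => //.
have Mi : 0 < M^-1 by rewrite invr_gt0.
move: (prec_le bM) (prec_le cM) (prec_gt0 bM) (prec_gt0 cM).
move: bM cM => /andP[b1 b2] /andP[c1 c2] pb pc pb0 pc0.
rewrite ger0_norm; last first.
  by rewrite !mulr_ge0 ?(ltW pb0) ?(ltW pc0)//; lra.
have -> : 2 * M ^+ 5 = (2 * M) * (M ^+ 2 * M ^+ 2) by ring.
apply: ler_pM => //; [lra|by rewrite mulr_ge0 ?ltW|lra|].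
by apply: ler_pM => //; exact: ltW.
Qed.

Lemma ratio_le a b : inM a -> inM b ->
  `|(a ^+ 2 + sig ^+ 2) * prec b - 1| <= 2 * M ^+ 3 * `|a - b|.
Proof.
move=> aM bM; have vb := variance_gt0 bM.
have -> : (a ^+ 2 + sig ^+ 2) * prec b - 1 = (a - b) * ((a + b) * prec b).
  by field; rewrite gt_eqF.
rewrite normrM mulrC; apply: ler_wpM2r => //.
move: aM bM (prec_le bM) (prec_gt0 bM) => /andP[a1 a2] /andP[b1 b2] pb pb0.
have Mi : 0 < M^-1 by rewrite invr_gt0.
rewrite ger0_norm ?mulr_ge0 ?(ltW pb0)//; last by lra.
have -> : 2 * M ^+ 3 = (2 * M) * M ^+ 2 by ring.
by apply: ler_pM => //; [lra|exact: ltW|lra].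
Qed.

Lemma ratio_ge a b : inM a -> inM b ->
  `|a - b| <= M * V * `|(a ^+ 2 + sig ^+ 2) * prec b - 1|.
Proof.
move=> aM bM; have vb := variance_gt0 bM.
have -> : (a ^+ 2 + sig ^+ 2) * prec b - 1 = (a - b) * ((a + b) * prec b).
  by field; rewrite gt_eqF.
rewrite normrM mulrCA -[leLHS]mulr1; apply: ler_wpM2l => //.
move: aM bM (prec_ge bM) (prec_gt0 bM) => /andP[a1 a2] /andP[b1 b2] pb pb0.
have Mi : 0 < M^-1 by rewrite invr_gt0.
rewrite ger0_norm ?mulr_ge0 ?(ltW pb0)//; last lra.
have -> : 1 = M * V * (M^-1 * V^-1) by field; rewrite !gt_eqF ?V_gt0.
apply: ler_wpM2l; first by rewrite mulr_ge0 ?ltW ?V_gt0.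
by apply: ler_pM => //; [exact: ltW|rewrite invr_ge0 ltW ?V_gt0|lra].
Qed.

Lemma ratio_bounds a b : inM a -> inM b ->
  (V * M ^+ 2)^-1 <= (a ^+ 2 + sig ^+ 2) * prec b <= V * M ^+ 2.
Proof.
move=> aM bM; have /andP[va1 va2] := variance_bounds aM.
have va := variance_gt0 aM; apply/andP; split; last first.
  by apply: ler_pM => //; [exact: ltW|exact/ltW/prec_gt0|exact: prec_le].
rewrite invfM mulrC; apply: ler_pM => //.
- by rewrite invr_ge0 exprn_ge0 // ltW.
- by rewrite invr_ge0 ltW ?V_gt0.
- exact: prec_ge.
Qed.

End precision.

(** [D] is the expected excess risk and [S] the sum of squared relative variance errors. Minimality
    bounds [D b - D u] by a noise term, which is split along [b], its grid point, the truth [a] and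
    the competitor [u]. Only the parts between grid point, truth and competitor need a deviation
    bound. *)
Lemma oracle_inequality (R : realType) (M smax : R) : 1 < M -> 0 <= smax ->
  exists C1 : R, 0 < C1 /\
  forall d (Om : measurableType d) (P : probability Om R) (n : nat)
    (xi tau : 'I_n -> {RV P >-> R}) (sig : R) (a u : 'I_n -> R)
    (T : finType) (g : T -> 'I_n -> R) (eta t : R),
  (0 < n)%N -> 0 <= sig <= smax ->
  (forall i, centered_gaussian 1 (xi i)) ->
  (forall i, centered_gaussian sig (tau i)) ->
  mutually_independent xi -> mutually_independent tau ->
  independent_families xi tau ->
  (forall i, M^-1 <= a i <= M) -> (forall i, M^-1 <= u i <= M) ->
  (forall k i, M^-1 <= g k i <= M) -> 0 <= eta <= 1 -> 0 <= t ->
  let y w i := a i * xi i w + tau i w in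
  let nll w (b : 'I_n -> R) :=
    n%:R^-1 * \sum_(i < n) (y w i ^+ 2 / (b i ^+ 2 + sig ^+ 2)) +
    n%:R^-1 * \sum_(i < n) ln (b i ^+ 2 + sig ^+ 2) in
  exists A : set Om, [/\ measurable A,
    ((1 - (#|T|.+2)%:R * expR (- t))%:E <= P A)%E &
    forall w, A w -> forall b : 'I_n -> R, (forall i, M^-1 <= b i <= M) ->
      (exists k, forall i, `|b i - g k i| <= eta) ->
      nll w b <= nll w u ->
      n%:R^-1 * \sum_(i < n) (b i - a i) ^+ 2 <=
      C1 * (n%:R^-1 * \sum_(i < n) (u i - a i) ^+ 2 + t / n%:R + eta)].
Proof.
move=> M1 smax0; have M0 : 0 < M by apply: lt_trans M1.
pose V := M ^+ 2 + smax ^+ 2; pose T1 := V * M ^+ 2.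
have V0 : 0 < V by exact: V_gt0.
have M20 : 0 < M ^+ 2 by rewrite exprn_gt0.
have T10 : 0 < T1 by rewrite mulr_gt0.
pose c := (2 * (T1 + 1))^-1.
have c0 : 0 < c by rewrite invr_gt0; lra.
(* At this tilt the noise costs [8 s S b = c / 2 * S b], half of the lower bound [c * S b] for
   [D b]; it also satisfies the smallness condition of the exponential moment. *)
pose s := c / 16.
have s0 : 0 < s by rewrite divr_gt0.
pose kap := 2 * M ^+ 5.
have kap0 : 0 < kap by rewrite mulr_gt0// exprn_gt0.
(* The excess risk is bounded below by [c] and above by [T1] times the squared
   relative variance error. *)
pose E1 := 4 * M ^+ 6.
pose C0 := (M * V) ^+ 2 * (2 / c).
pose C1 := C0 * ((T1 + c / 2) * E1 + 2 / s + 8 * s * (V * kap) ^+ 2 +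
   kap * (2 * V + 4 * s * V ^+ 2 + s^-1)).
have C00 : 0 < C0 by rewrite mulr_gt0 ?divr_gt0// exprn_gt0// mulr_gt0.
have E10 : 0 < E1 by rewrite mulr_gt0// exprn_gt0.
have C10 : 0 < C1.
  have p1 : 0 < (T1 + c / 2) * E1 by rewrite mulr_gt0//; lra.
  have p2 : 0 < 2 / s by rewrite divr_gt0.
  have p3 : 0 <= 8 * s * (V * kap) ^+ 2 by rewrite mulr_ge0 ?sqr_ge0//; lra.
  have V20 : 0 < V ^+ 2 by rewrite exprn_gt0.
  have p4 : 0 < kap * (2 * V + 4 * s * V ^+ 2 + s^-1).
    rewrite mulr_gt0//; have si : 0 < s^-1 by rewrite invr_gt0.
    by have := mulr_gt0 s0 V20; lra.
  by rewrite mulr_gt0//; lra.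
exists C1; split=> // d Om P n xi tau sig a u T g eta t n0 /andP[sig0 sigmax].
move=> gxi gtau ixi itau ixitau aM uM gM /andP[eta0 eta1] t0 y nll.
pose q (b : R) := (b ^+ 2 + sig ^+ 2)^-1.
pose v i := a i ^+ 2 + sig ^+ 2.
(* Two weights besides the grid, whence [#|T|.+2]: one for the competitor, and the constant [-1],
   which bounds the sum of the [y^2] and thereby the rounding error. *)
pose delta (k : option (option T)) i : R :=
  match k with
  | Some (Some k) => q (g k i) - q (a i)
  | Some None => q (a i) - q (u i)
  | None => -1
  end.
have vq b i : M^-1 <= b <= M -> T1^-1 <= v i * q b <= T1.
  by move=> bM; exact: ratio_bounds.
have v0 i : 0 < v i by exact: (variance_gt0 M1 sig0 sigmax).
have vV i : v i <= V by have /andP[] := variance_bounds M1 sig0 sigmax (aM i).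
have vqa i : v i * q (a i) = 1 by apply: divff; rewrite gt_eqF.
have M21 : 1 <= M ^+ 2 by exact/exprn_ege1/ltW.
have V1 : 1 <= V by rewrite /V; have := sqr_ge0 smax; lra.
have T11 : 1 <= T1 by rewrite /T1; nra.
have sT : s * T1 <= 4^-1.
  rewrite /s /c mulrAC ler_pdivrMr// mulrC ler_pdivrMr; last by lra.
  by lra.
have s_small k i : `|s * delta k i * v i| <= 4^-1.
  have vqg b : M^-1 <= b <= M -> 0 <= v i * q b <= T1.
    by move=> /(vq _ i)/andP[h1 h2]; rewrite h2 andbT (le_trans _ h1)// invr_ge0 ltW.
  have dT : `|delta k i * v i| <= T1.
    rewrite /delta; case: k => [[k|]|].
    - have /andP[h1 h2] := vqg _ (gM k i).
      rewrite mulrBl ![_ * v i]mulrC vqa ler_norml; apply/andP; split; lra.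
    - have /andP[h1 h2] := vqg _ (uM i).
      rewrite mulrBl ![_ * v i]mulrC vqa ler_norml; apply/andP; split; lra.
    - rewrite mulN1r normrN gtr0_norm//; apply: le_trans (vV i) _.
      by rewrite ler_peMr// ltW.
  rewrite -mulrA normrM gtr0_norm//; apply: le_trans sT.
  by rewrite ler_pM2l.
have [A [mA PA AZ]] := @exp_sqr_deviation_uniform _ _ _ P n xi tau sig a
  (option (option T)) delta s t gxi gtau ixi itau ixitau s0 s_small.
exists A; split=> //; first by move: PA; rewrite !card_option.
move=> w Aw b bM [k bk] nllb.
pose z i := v i - y w i ^+ 2.
pose D (x : 'I_n -> R) := \sum_i (v i * q (x i) - 1 - ln (v i * q (x i))).
pose S (x : 'I_n -> R) := \sum_i (v i * q (x i) - 1) ^+ 2.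
have Zg : \sum_i z i * (q (g k i) - q (a i)) <= 4 * s * S (g k) + t / s.
  apply: le_trans (AZ w Aw (Some (Some k))) _; rewrite lerD2r ler_pM2l ?mulr_gt0//.
  by apply: ler_sum => i _; rewrite /delta mulrBl ![_ * v i]mulrC vqa.
have Zu : \sum_i z i * (q (a i) - q (u i)) <= 4 * s * S u + t / s.
  apply: le_trans (AZ w Aw (Some None)) _; rewrite lerD2r ler_pM2l ?mulr_gt0//.
  by apply: ler_sum => i _; rewrite /delta mulrBl ![_ * v i]mulrC vqa -sqrrN opprB.
have Zy : \sum_i y w i ^+ 2 <= n%:R * V + 4 * s * (n%:R * V ^+ 2) + t / s.
  have := AZ w Aw None; rewrite /delta.
  have -> : \sum_i (a i ^+ 2 + sig ^+ 2 - (a i * xi i w + tau i w) ^+ 2) * -1 =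
      \sum_i y w i ^+ 2 - \sum_i v i.
    by rewrite -sumrB; apply: eq_bigr => i _; rewrite /v /y; ring.
  have h1 : \sum_i v i <= n%:R * V.
    apply: le_trans (ler_sum _ (fun i _ => vV i)) _.
    by rewrite sumr_const card_ord mulr_natl.
  have h2 : 4 * s * \sum_i (-1 * (a i ^+ 2 + sig ^+ 2)) ^+ 2 <= 4 * s * (n%:R * V ^+ 2).
    rewrite ler_pM2l ?mulr_gt0//.
    apply: (@le_trans _ _ (\sum_(i < n) V ^+ 2)).
      apply: ler_sum => i _; rewrite mulN1r sqrrN.
      by rewrite lerXn2r ?nnegrE ?(ltW V0)//; [exact/ltW/v0|exact: vV].
    by rewrite sumr_const card_ord mulr_natl.
  by move=> h3; lra.
have nR0 : 0 < n%:R :> R by rewrite ltr0n.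
(* Up to a term free of [b], [n] times the objective at [b] is [D b] minus the sum of
   [z i * q (b i)]. *)
have Dbu : D b - D u <= \sum_i z i * (q (b i) - q (u i)).
  have : n%:R * (nll w b - nll w u) <= 0.
    by rewrite pmulr_rle0// subr_le0.
  rewrite /nll !mulrBr !mulrDr !mulVKf ?gt_eqF// => h.
  rewrite -subr_le0; apply: le_trans h.
  rewrite le_eqVlt; apply/orP; left; apply/eqP.
  rewrite /D -!sumrB -!big_split/= -!sumrB; apply: eq_bigr => i _.
  have lnq x : M^-1 <= x <= M -> ln (v i * q x) = ln (v i) - ln (x ^+ 2 + sig ^+ 2).
    move=> xM; have vx := variance_gt0 M1 sig0 sigmax xM.
    by rewrite lnM ?posrE ?invr_gt0// lnV.
  by rewrite !lnq// /z /q; ring.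
have Sb : c * S b <= D b.
  rewrite mulr_sumr; apply: ler_sum => i _.
  have /andP[h1 h2] := vq _ i (bM i).
  by apply: sub_ln_ge => //; apply: lt_le_trans h1; rewrite invr_gt0.
have Su : D u <= T1 * S u.
  rewrite mulr_sumr; apply: ler_sum => i _.
  by have /andP[h1 h2] := vq _ i (uM i); exact: sub_ln_le.
have qbg i : `|q (b i) - q (g k i)| <= kap * eta.
  apply: le_trans (prec_lip M1 sig0 sigmax (bM i) (gM k i)) _.
  by rewrite ler_pM2l.
(* Rounding to the grid is not a matter of concentration: [|z i| <= v i + y^2], and the sum of these
   is of order [n] on the event. *)
have Zbg : \sum_i z i * (q (b i) - q (g k i)) <=
    kap * eta * (n%:R * (2 * V + 4 * s * V ^+ 2) + t / s).
  apply: (@le_trans _ _ (\sum_i (kap * eta) * (v i + y w i ^+ 2))).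
    apply: ler_sum => i _; rewrite mulrC; apply: le_trans (ler_norm _) _.
    rewrite normrM; apply: ler_pM => //.
    by apply: le_trans (ler_normB _ _) _; rewrite ger0_norm ?(ltW (v0 i))// ger0_norm ?sqr_ge0.
  rewrite -mulr_sumr; apply: ler_wpM2l; first by rewrite mulr_ge0// ltW.
  rewrite big_split/=.
  have h1 : \sum_i v i <= n%:R * V.
    apply: le_trans (ler_sum _ (fun i _ => vV i)) _.
    by rewrite sumr_const card_ord mulr_natl.
  by lra.
(* The variance term of the deviation bound sits at the grid point; moving it back to [b] doubles
   it. *)
have Sg : S (g k) <= 2 * S b + 2 * (n%:R * (V * (kap * eta)) ^+ 2).
  have -> : 2 * (n%:R * (V * (kap * eta)) ^+ 2) =
      \sum_(i < n) 2 * (V * (kap * eta)) ^+ 2.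
    by rewrite sumr_const card_ord -[RHS]mulr_natl; ring.
  rewrite mulr_sumr -big_split/=; apply: ler_sum => i _.
  set X := v i * q (g k i) - 1; set Y := v i * q (b i) - 1.
  have XY : (X - Y) ^+ 2 <= (V * (kap * eta)) ^+ 2.
    rewrite -[leLHS]real_normK ?num_real//.
    have nn : 0 <= V * (kap * eta) by rewrite mulr_ge0 ?(ltW V0)// mulr_ge0// ltW.
    rewrite lerXn2r ?nnegrE//.
    have -> : X - Y = v i * (q (g k i) - q (b i)) by rewrite /X /Y; ring.
    rewrite normrM (gtr0_norm (v0 i)); apply: ler_pM => //; first exact/ltW/v0.
    by rewrite distrC.
  by have := sqr_ge0 (X - 2 * Y); nra.
have Zb : \sum_i z i * (q (b i) - q (u i)) <= 8 * s * S b +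
    8 * s * (n%:R * (V * (kap * eta)) ^+ 2) + 4 * s * S u + 2 * (t / s) +
    kap * eta * (n%:R * (2 * V + 4 * s * V ^+ 2) + t / s).
  have -> : \sum_i z i * (q (b i) - q (u i)) =
      \sum_i z i * (q (b i) - q (g k i)) + \sum_i z i * (q (g k i) - q (a i)) +
      \sum_i z i * (q (a i) - q (u i)).
    by rewrite -!big_split/=; apply: eq_bigr => i _; ring.
  have : 4 * s * S (g k) <= 4 * s * (2 * S b + 2 * (n%:R * (V * (kap * eta)) ^+ 2)).
    by rewrite ler_pM2l// mulr_gt0.
  by move=> h; lra.
have Sb0 : c / 2 * S b <= (T1 + c / 2) * S u + 2 * (t / s) +
    8 * s * (n%:R * (V * (kap * eta)) ^+ 2) +
    kap * eta * (n%:R * (2 * V + 4 * s * V ^+ 2) + t / s).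
  have Su0 : 0 <= S u by apply: sumr_ge0 => i _; exact: sqr_ge0.
  have cs : c = 16 * s by rewrite /s; field.
  have csu : 0 <= c * S u by rewrite mulr_ge0// ltW.
  move: Dbu Sb Su Zb csu; rewrite cs.
  by move: (S b) (S u) (D b) (D u) => Sb' Su' Db' Du' *; lra.
have Sba : \sum_i (b i - a i) ^+ 2 <= (M * V) ^+ 2 * S b.
  rewrite mulr_sumr; apply: ler_sum => i _; rewrite -exprMn -[leLHS]real_normK ?num_real//.
  rewrite -[leRHS]real_normK ?num_real// lerXn2r ?nnegrE// distrC normrM.
  rewrite (gtr0_norm (mulr_gt0 M0 V0)).
  exact: ratio_ge.
have Sua : S u <= E1 * \sum_i (u i - a i) ^+ 2.
  rewrite mulr_sumr; apply: ler_sum => i _.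
  have -> : E1 * (u i - a i) ^+ 2 = (2 * M ^+ 3 * `|a i - u i|) ^+ 2.
    by rewrite exprMn real_normK ?num_real// /E1; ring.
  have nn : 0 <= 2 * M ^+ 3 * `|a i - u i|.
    by rewrite mulr_ge0// mulr_ge0// exprn_ge0// ltW.
  rewrite -[leLHS]real_normK ?num_real// lerXn2r ?nnegrE//.
  exact: ratio_le.
have eta2 : eta ^+ 2 <= eta by rewrite expr2 ler_piMr.
set U := n%:R^-1 * \sum_(i < n) (u i - a i) ^+ 2.
set r := t / n%:R.
have U0 : 0 <= U.
  by rewrite mulr_ge0 ?invr_ge0 ?(ltW nR0)//; apply: sumr_ge0 => i _; exact: sqr_ge0.
have r0 : 0 <= r by rewrite divr_ge0// ltW.
pose k1 := (T1 + c / 2) * E1; pose k2 := 2 / s.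
pose k3 := 8 * s * (V * kap) ^+ 2; pose k4 := kap * (2 * V + 4 * s * V ^+ 2).
pose k5 := kap * s^-1.
have k10 : 0 <= k1 by rewrite mulr_ge0 ?ltW//; lra.
have k20 : 0 <= k2 by rewrite divr_ge0// ltW.
have k30 : 0 <= k3 by rewrite mulr_ge0 ?sqr_ge0//; lra.
have k40 : 0 <= k4.
  rewrite mulr_ge0 ?(ltW kap0)//; have := mulr_gt0 s0 (exprn_gt0 2 V0); lra.
have k50 : 0 <= k5 by rewrite mulr_ge0 ?invr_ge0 ?ltW.
have C1E : C1 = C0 * (k1 + k2 + k3 + k4 + k5) by rewrite /C1 /k1 /k2 /k3 /k4 /k5; ring.
have Sbn : n%:R^-1 * S b <= 2 / c * (k1 * U + k2 * r + k3 * eta + k4 * eta + k5 * r).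
  have h : n%:R^-1 * (c / 2 * S b) <= n%:R^-1 * ((T1 + c / 2) * S u + 2 * (t / s) +
    8 * s * (n%:R * (V * (kap * eta)) ^+ 2) +
    kap * eta * (n%:R * (2 * V + 4 * s * V ^+ 2) + t / s)).
    by rewrite ler_pM2l ?invr_gt0.
  have h2 : n%:R^-1 * ((T1 + c / 2) * S u) <= k1 * U.
    rewrite mulrCA /k1 -mulrA; apply: ler_wpM2l; first by lra.
    by rewrite /U mulrCA; apply: ler_wpM2l => //; rewrite invr_ge0 ltW.
  have h3 : k3 * eta ^+ 2 <= k3 * eta by exact: ler_wpM2l.
  have h4 : k5 * r * eta <= k5 * r by rewrite ler_piMr// mulr_ge0.
  have -> : n%:R^-1 * S b = 2 / c * (n%:R^-1 * (c / 2 * S b)).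
    by field; rewrite !gt_eqF.
  apply: ler_wpM2l; first by rewrite divr_ge0// ltW.
  apply: le_trans h _.
  have -> : n%:R^-1 * ((T1 + c / 2) * S u + 2 * (t / s) +
      8 * s * (n%:R * (V * (kap * eta)) ^+ 2) +
      kap * eta * (n%:R * (2 * V + 4 * s * V ^+ 2) + t / s)) =
    n%:R^-1 * ((T1 + c / 2) * S u) + k2 * r + k3 * eta ^+ 2 + k4 * eta +
      k5 * r * eta.
    by rewrite /k2 /k3 /k4 /k5 /r; field; rewrite !gt_eqF.
  by lra.
apply: (@le_trans _ _ (n%:R^-1 * ((M * V) ^+ 2 * S b))).
  by rewrite ler_pM2l ?invr_gt0.
have -> : C1 * (U + r + eta) =
    (M * V) ^+ 2 * (2 / c * ((k1 + k2 + k3 + k4 + k5) * (U + r + eta))).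
  by rewrite C1E /C0; ring.
rewrite mulrCA; apply: ler_wpM2l; first exact: sqr_ge0.
apply: le_trans Sbn _; apply: ler_wpM2l; first by rewrite divr_ge0// ltW.
have : 0 <= (k2 + k3 + k4 + k5) * U by rewrite mulr_ge0// !addr_ge0.
have : 0 <= (k1 + k3 + k4) * r by rewrite mulr_ge0// !addr_ge0.
have : 0 <= (k1 + k2 + k5) * eta by rewrite mulr_ge0// !addr_ge0.
by lra.
Qed.

(** * Covering numbers of ReLU networks *)

Section covering.
Variable R : realType.
Implicit Types (N dout din L q W : nat) (B K eta : R).

Definition sup_le n (x : 'cV[R]_n) (e : R) := forall i, `|x i 0| <= e.

Lemma mulmx_sup_le m n (A : 'M[R]_(m, n)) (x : 'cV[R]_n) (a e : R) :
  0 <= a -> mx_bounded a A -> sup_le x e -> sup_le (A *m x) (n%:R * a * e).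
Proof.
move=> a0 Aa xe i; rewrite mxE; apply: le_trans (ler_norm_sum _ _ _) _.
apply: (@le_trans _ _ (\sum_(j < n) a * e)).
  by apply: ler_sum => j _; rewrite normrM ler_pM.
by rewrite sumr_const card_ord -[leLHS]mulr_natl mulrA.
Qed.

Lemma relu_lip n (x z : 'cV[R]_n) (e : R) :
  sup_le (x - z) e -> sup_le (relu x - relu z) e.
Proof.
move=> xz i; have := xz i; rewrite !mxE; apply: le_trans.
move: (x i 0) (z i 0) => a b.
have := ler_norm (a - b); have := ler_norm (b - a); rewrite [`|b - a|]distrC.
move=> h1 h2; rewrite ler_norml /Num.max; apply/andP.
by do 2 case: ifPn; rewrite -?leNgt => h3 h4; split; lra.
Qed.

Lemma relu_sup_le n (x : 'cV[R]_n) (e : R) : sup_le x e -> sup_le (relu x) e.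
Proof.
move=> xe i; have := xe i; rewrite !mxE; apply: le_trans.
by rewrite /Num.max; case: ifPn; rewrite -?leNgt => h1; rewrite ?normr0.
Qed.

Lemma relu_net_lip N dout B W L din (h : 'cV[R]_din -> 'cV[R]_dout) :
  0 <= B -> (din <= W)%N -> (N <= W)%N -> @relu_net R N dout B L din h ->
  forall x z e, 0 <= e -> sup_le (x - z) e ->
    sup_le (h x - h z) ((W%:R * B) ^+ L.+1 * e).
Proof.
move=> B0 + NW.
have affine_lip m n (A : 'M[R]_(m, n)) b x z e : (n <= W)%N -> 0 <= e ->
    mx_bounded B A -> sup_le (x - z) e ->
    sup_le (A *m x + b - (A *m z + b)) (W%:R * B * e).
  move=> nW e0 AB xz i.
  have -> : A *m x + b - (A *m z + b) = A *m (x - z).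
    by rewrite mulmxBr opprD addrACA subrr addr0.
  apply: le_trans (mulmx_sup_le B0 AB xz i) _.
  by rewrite !ler_wpM2r// ler_nat.
elim: L din h => [|L IH] din h dW /=.
  by move=> [A [b [AB bB ->]]] x z e e0 xz; rewrite expr1; exact: affine_lip.
move=> [A [b [h' [AB bB hh ->]]]] x z e e0 xz.
rewrite exprSr -mulrA; apply: (IH _ _ _ hh) => //.
  by rewrite !mulr_ge0.
by apply: relu_lip; exact: affine_lip.
Qed.

(** Rounding down: for [|z| <= B] the selected grid value stays in [[-B, B]], although the grid
    itself may extend beyond. *)
Lemma grid_approx B eta q : 0 <= B -> 0 < eta -> 2 * B / eta < q%:R ->
  exists gr : 'I_q -> R, forall z, `|z| <= B ->
    exists j, `|gr j| <= B /\ `|z - gr j| <= eta.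
Proof.
move=> B0 eta0 qB; exists (fun j => - B + eta * j%:R) => z.
rewrite ler_norml => /andP[z1 z2].
pose y := (z + B) / eta.
have y0 : 0 <= y by rewrite divr_ge0 ?(ltW eta0)//; lra.
have yq : (Num.truncn y < q)%N.
  rewrite -(ltr_nat R); apply: le_lt_trans qB.
  apply: le_trans (_ : y <= _); first by have /andP[] := truncn_itv y0.
  by rewrite ler_pM2r ?invr_gt0//; lra.
exists (Ordinal yq) => /=.
have /andP[t1 t2] := truncn_itv y0.
have zy : z = - B + eta * y by rewrite /y mulrC divfK ?gt_eqF//; ring.
have h1 : eta * (Num.truncn y)%:R <= eta * y by rewrite ler_pM2l.
have h2 : eta * y < eta * (Num.truncn y).+1%:R by rewrite ltr_pM2l.
have h3 : 0 <= eta * (Num.truncn y)%:R by rewrite mulr_ge0// ltW.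
rewrite -[(Num.truncn y).+1]addn1 natrD in h2.
by split; rewrite ler_norml; apply/andP; split; lra.
Qed.

Lemma mx_grid_approx B eta q m n (gr : 'I_q -> R) (A : 'M[R]_(m, n)) :
  (forall z, `|z| <= B -> exists j, `|gr j| <= B /\ `|z - gr j| <= eta) ->
  mx_bounded B A -> exists J : 'M['I_q]_(m, n),
    mx_bounded B (map_mx gr J) /\ mx_bounded eta (A - map_mx gr J).
Proof.
move=> grP AB.
have /choice[J JP] : forall ij : 'I_m * 'I_n, exists j,
    `|gr j| <= B /\ `|A ij.1 ij.2 - gr j| <= eta by move=> ij; exact/grP/AB.
exists (\matrix_(i, j) J (i, j)).
by split=> i j; rewrite !mxE; have [] := JP (i, j).
Qed.

(* Rounding the parameters to a grid of mesh [eta]; [F k] need not be in the class. *)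
Lemma relu_net_cover N dout B W eta q L din K :
  1 <= B -> (dout <= W)%N -> (N <= W)%N -> (0 < W)%N ->
  0 < eta -> 2 * B / eta < q%:R -> (din <= W)%N -> 1 <= K ->
  exists (T : finType) (F : T -> 'cV[R]_din -> 'cV[R]_dout),
    (#|T| <= q ^ (L.+1 * (W * W + W)))%N /\
    forall g, @relu_net R N dout B L din g -> exists k, forall x, sup_le x K ->
      sup_le (g x - F k x) (eta * K * (4 * W%:R * B) ^+ (2 * L.+1)).
Proof.
move=> B1 doutW NW W0 eta0 qB.
have B0 : 0 <= B by lra.
have [gr grP] := grid_approx B0 eta0 qB.
have q0 : (0 < q)%N.
  by rewrite -(ltr_nat R); apply: le_lt_trans qB; rewrite divr_ge0 ?mulr_ge0// ltW.
have W1 : 1 <= W%:R :> R by rewrite ler1n.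
(* A layer may cost one factor [a] for the growth of its inputs and one for the Lipschitz constant
   of the layers above it, whence the exponent [2 * L.+1]. *)
pose a := 4 * W%:R * B.
have WB1 : 1 <= W%:R * B by nra.
have a1 : 1 <= a by rewrite /a -mulrA; lra.
have WA : 4 * W%:R <= a by rewrite /a ler_peMr// ?mulr_ge0//.
have affine_approx m n (A A' : 'M[R]_(m, n)) b b' x k : (n <= W)%N -> 1 <= k ->
    mx_bounded eta (A - A') -> mx_bounded eta (b - b') -> sup_le x k ->
    sup_le (A *m x + b - (A' *m x + b')) (eta * (2 * W%:R * k)).
  move=> nW K1 AA bb xk i.
  have -> : A *m x + b - (A' *m x + b') = (A - A') *m x + (b - b').
    by rewrite mulmxBl opprD addrACA.
  rewrite mxE; apply: le_trans (ler_normD _ _) _.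
  have := mulmx_sup_le (ltW eta0) AA xk i; have := bb i 0.
  have nW' : n%:R * (eta * k) <= W%:R * (eta * k).
    by apply: ler_wpM2r; rewrite ?ler_nat// mulr_ge0 ?(ltW eta0)//; lra.
  have : eta <= W%:R * (eta * k).
    rewrite -[leLHS]mul1r; apply: ler_pM => //; first exact: ltW.
    by rewrite ler_peMr// ltW.
  by move=> h1 h2 h3; lra.
have affine_bound m n (A : 'M[R]_(m, n)) b x k : (n <= W)%N -> 1 <= k ->
    mx_bounded B A -> mx_bounded B b -> sup_le x k ->
    sup_le (A *m x + b) (2 * W%:R * B * k).
  move=> nW K1 AB bB xk i; rewrite mxE; apply: le_trans (ler_normD _ _) _.
  have := mulmx_sup_le B0 AB xk i; have := bB i 0.
  have nW' : n%:R * (B * k) <= W%:R * (B * k).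
    by apply: ler_wpM2r; rewrite ?ler_nat// mulr_ge0//; lra.
  have : B <= W%:R * (B * k).
    by rewrite -[leLHS]mul1r; apply: ler_pM => //; rewrite ler_peMr.
  by move=> h1 h2 h3; lra.
elim: L din K => [|L IH] din K dinW K1.
  pose T : finType := ('M['I_q]_(dout, din) * 'cV['I_q]_dout)%type.
  exists T, (fun k x => map_mx gr k.1 *m x + map_mx gr k.2); split.
    rewrite card_prod !card_mx card_ord -expnD mul1n leq_pexp2l//.
    by rewrite leq_add// ?muln1// leq_mul.
  move=> g [A [b [AB bB ->]]].
  have [J [JB JA]] := mx_grid_approx grP AB.
  have [j [jB jb]] := mx_grid_approx grP bB.
  exists (J, j) => x xK i /=; apply: le_trans (affine_approx _ _ _ _ _ _ _ _ dinW K1 JA jb xK i) _.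
  rewrite -[leRHS]mulrA ler_pM2l// -/a muln1 [leRHS]mulrC ler_pM2r; last by lra.
  by nra.
pose K' := 2 * W%:R * B * K.
have K'1 : 1 <= K'.
  by rewrite /K'; nra.
have [T [F [cT FT]]] := IH N K' NW K'1.
pose T' : finType := (('M['I_q]_(N, din) * 'cV['I_q]_N) * T)%type.
exists T', (fun k x => F k.2 (relu (map_mx gr k.1.1 *m x + map_mx gr k.1.2))); split.
  rewrite !card_prod !card_mx card_ord -expnD mulSn [leqRHS]expnD leq_mul//.
  by rewrite leq_pexp2l// leq_add// ?muln1// leq_mul.
move=> g [A [b [h [AB bB hh ->]]]].
have [J [JB JA]] := mx_grid_approx grP AB.
have [j [jB jb]] := mx_grid_approx grP bB.
have [k Fk] := FT h hh.
exists ((J, j), k) => x xK i /=.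
set z := relu (A *m x + b); set z' := relu _.
have zz : sup_le (z - z') (eta * (2 * W%:R * K)).
  by apply: relu_lip; exact: affine_approx.
have z'K : sup_le z' K' by apply: relu_sup_le; exact: affine_bound.
(* First the rounding of this layer, seen through the exact remaining network; then the rounding of
   the remaining network at the already rounded input, which is bounded by [K']. The induction is
   therefore over all input bounds. *)
have -> : h z - F k z' = (h z - h z') + (h z' - F k z').
  by rewrite addrA subrK.
rewrite mxE; apply: le_trans (ler_normD _ _) _.
have e0 : 0 <= eta * (2 * W%:R * K) by rewrite mulr_ge0 ?(ltW eta0)// mulr_ge0//; lra.
apply: le_trans (lerD (relu_net_lip B0 NW NW hh e0 zz i) (Fk z' z'K i)) _.
rewrite -/a; set p := a ^+ L.+1.
have p1 : 1 <= p by exact: exprn_ege1.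
have WBp : (W%:R * B) ^+ L.+1 <= p.
  by rewrite lerXn2r ?nnegrE /a -?mulrA; lra.
have -> : a ^+ (2 * L.+2) = p ^+ 2 * a ^+ 2.
  by rewrite /p -exprM -exprD mulnS addnC [(2 * _)%N]mulnC.
have -> : a ^+ (2 * L.+1) = p ^+ 2 by rewrite /p -exprM mulnC.
have h1 : (W%:R * B) ^+ L.+1 * (eta * (2 * W%:R * K)) <= p ^+ 2 * (eta * (a / 2 * K)).
  apply: ler_pM => //; first by rewrite exprn_ge0//; lra.
    by apply: le_trans WBp _; nra.
  rewrite ler_pM2l// ler_pM2r; lra.
have h2 : eta * K' * p ^+ 2 = p ^+ 2 * (eta * (a / 2 * K)).
  by rewrite /K' /a; field.
rewrite h2; apply: le_trans (lerD h1 (lexx _)) _.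
have -> : p ^+ 2 * (eta * (a / 2 * K)) + p ^+ 2 * (eta * (a / 2 * K)) =
  eta * K * (p ^+ 2 * a) by field.
by rewrite !ler_pM2l ?ler_eXnr ?mulr_gt0 ?exprn_gt0//; lra.
Qed.
End covering.

(** * Polynomial interpolation of smooth functions *)

Section interpolation1.
Variable R : realType.

Lemma poly_antiderivative (p : {poly R}) (z c : R) :
  exists q : {poly R}, [/\ (size q <= (size p).+1)%N, q^`() = p & q.[z] = c].
Proof.
pose q0 := \poly_(i < (size p).+1) (p`_i.-1 / i%:R) : {poly R}.
exists (q0 + (c - q0.[z])%:P); split.
- apply: leq_trans (size_polyD _ _) _; rewrite geq_max size_poly/=.
  by apply: leq_trans (size_polyC_leq1 _) _.
- rewrite derivD derivC addr0; apply/polyP => i.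
  rewrite coef_deriv coef_poly ltnS /=.
  case: ltnP => ip; first by rewrite -[LHS]mulr_natr divfK// pnatr_eq0.
  by rewrite mul0rn nth_default.
- by rewrite hornerD hornerC addrC subrK.
Qed.

(** Induction on [r]: the approximant of [D 1] is integrated, and the mean value theorem multiplies
    the error by [h]. The clause on the derivative at [z] serves to bound [D 1] later. *)
Lemma taylor_poly (r : nat) (D : nat -> R -> R) (z h e : R) :
  0 <= h ->
  (forall k (x : R), (k < r)%N -> is_derive x 1 (D k) (D k.+1 x)) ->
  (forall x, z <= x <= z + h -> `|D r x - D r z| <= e) ->
  exists p : {poly R}, [/\ (size p <= r.+1)%N, p.[z] = D 0 z,
    (0 < r)%N -> p^`().[z] = D 1 z &
    forall x, z <= x <= z + h -> `|D 0 x - p.[x]| <= e * h ^+ r].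
Proof.
move=> h0; elim: r D => [|r IH] D dD De.
  exists (D 0 z)%:P; split; rewrite ?hornerC//; first exact: size_polyC_leq1.
  by move=> x xz; rewrite hornerC mulr1; exact: De.
have [||p [sp pz _ pP]] := IH (fun k => D k.+1).
- by move=> k x kr; exact: dD.
- exact: De.
have [q [sq q' qz]] := poly_antiderivative p z (D 0 z).
exists q; split; rewrite ?q'//; first exact: leq_trans sq _.
move=> x /andP[zx xh].
pose f y := D 0 y - q.[y].
have df (y : R) : is_derive y 1 f (D 1 y - p.[y]).
  rewrite -q'.
  have := dD 0 y isT => dy.
  exact: is_deriveB.
have [y yz] : exists2 y, y \in `[z, x]%R & f x - f z = (D 1 y - p.[y]) * (x - z).
  apply: MVT_segment => //.
  apply: derivable_within_continuous => y _.
  by have [] := df y.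
rewrite /f qz subrr subr0 => ->.
move: yz; rewrite in_itv /= => /andP[zy yx].
rewrite normrM exprSr mulrA; apply: ler_pM => //.
  by apply: pP; rewrite zy (le_trans yx).
by rewrite ger0_norm; lra.
Qed.

End interpolation1.

Section interpolation.
Variable R : realType.
Implicit Types (r t : nat).

Lemma lagrange_basis r : (0 < r)%N ->
  exists (lag : 'I_r.+1 -> {poly R}) (L : R),
    [/\ 1 <= L,
      forall p : {poly R}, (size p <= r.+1)%N ->
        p = \sum_(j < r.+1) p.[j%:R / r%:R]%:P * lag j,
      forall j, (size (lag j) <= r.+1)%N &
      forall u, 0 <= u <= 1 -> \sum_j `|(lag j).[u]| <= L].
Proof.
move=> r0; pose x (j : nat) : R := j%:R / r%:R.
have r0R : r%:R != 0 :> R by rewrite pnatr_eq0 -lt0n.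
have xinj : injective x.
  by move=> i j /(congr1 ( *%R^~ r%:R)); rewrite /x !divfK// => /eqP; rewrite eqr_nat => /eqP.
pose lag (j : 'I_r.+1) : {poly R} := tnth (@qpoly.lagrange R r.+1 x) j.
exists lag, (1 + \sum_j \sum_(i < r.+1) `|(lag j)`_i|).
have slag j : size (lag j) = r.+1 by exact: size_lagrange_.
split.
- by rewrite lerDl; apply: sumr_ge0 => j _; exact: sumr_ge0.
- by move=> p sp; exact: (lagrange_gen (n := r.+1) _ xinj sp).
- by move=> j; rewrite slag.
- move=> u /andP[u0 u1]; rewrite ler_wpDl//; apply: ler_sum => j _.
  rewrite horner_coef slag; apply: le_trans (ler_norm_sum _ _ _) _.
  apply: ler_sum => i _; rewrite normrM normrX ler_piMr// ger0_norm//.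
  exact: exprn_ile1.
Qed.

Definition set_coord t (x : 'cV[R]_t) (k : 'I_t) (y : R) : 'cV[R]_t :=
  \col_i (if i == k then y else x i 0).

(** Interpolation reproduces polynomials of degree [r], so its error is at most [1 + L] times that
    of the Taylor polynomial, [L] being the Lebesgue constant of the nodes. *)
Lemma interpolation_error r (lag : 'I_r.+1 -> {poly R}) (L : R) (D : nat -> R -> R)
    (z h e u : R) :
  (0 < r)%N ->
  (forall p : {poly R}, (size p <= r.+1)%N ->
        p = \sum_(j < r.+1) p.[j%:R / r%:R]%:P * lag j) ->
  (forall u, 0 <= u <= 1 -> \sum_j `|(lag j).[u]| <= L) ->
  0 <= h -> 0 <= e ->
  (forall k (x : R), (k < r)%N -> is_derive x 1 (D k) (D k.+1 x)) ->
  (forall x, z <= x <= z + h -> `|D r x - D r z| <= e) ->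
  0 <= u <= 1 ->
  `|D 0 (z + h * u) - \sum_(j < r.+1) D 0 (z + h * (j%:R / r%:R)) * (lag j).[u]| <=
    (1 + L) * (e * h ^+ r).
Proof.
move=> r0 lagP lagL h0 e0 dD De u01.
have [p [sp _ _ pP]] := taylor_poly h0 dD De.
pose q := p \Po (z%:P + h%:P * 'X).
have sq : (size q <= r.+1)%N.
  have s2 : (size (z%:P + h%:P * 'X)%R <= 2)%N.
    apply: leq_trans (size_polyD _ _) _; rewrite geq_max.
    rewrite (leq_trans (size_polyC_leq1 _))//= mul_polyC.
    by apply: leq_trans (size_scale_leq _ _) _; rewrite size_polyX.
  apply: leq_trans (size_comp_poly_leq _ _) _; rewrite ltnS.
  apply: leq_trans (_ : (size p).-1 * 1 <= _)%N; first by rewrite leq_mul2l orbC -subn1 leq_subLR s2.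
  by rewrite muln1 -subn1 leq_subLR.
have qE v : q.[v] = p.[z + h * v] by rewrite horner_comp !hornerE.
have err v : 0 <= v <= 1 -> `|D 0 (z + h * v) - q.[v]| <= e * h ^+ r.
  move=> /andP[v0 v1]; rewrite qE; apply: pP.
  by rewrite lerDl mulr_ge0//= lerD2l ler_piMr.
have -> : D 0 (z + h * u) - \sum_(j < r.+1) D 0 (z + h * (j%:R / r%:R)) * (lag j).[u] =
    (D 0 (z + h * u) - q.[u]) -
    \sum_(j < r.+1) (D 0 (z + h * (j%:R / r%:R)) - q.[j%:R / r%:R]) * (lag j).[u].
  under [in RHS]eq_bigr do rewrite mulrBl.
  suff -> : q.[u] = \sum_(j < r.+1) q.[j%:R / r%:R] * (lag j).[u].
    by rewrite sumrB; ring.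
  rewrite [in LHS](lagP q sq) horner_sum.
  by apply: eq_bigr => j _; rewrite hornerM hornerC.
apply: le_trans (ler_normB _ _) _; rewrite mulrDl mul1r; apply: lerD; first exact: err.
apply: le_trans (ler_norm_sum _ _ _) _.
have eh0 : 0 <= e * h ^+ r by rewrite mulr_ge0 ?exprn_ge0.
apply: le_trans (_ : L * (e * h ^+ r) <= _) => //.
apply: le_trans (ler_wpM2r eh0 (lagL u u01)); rewrite mulr_suml.
apply: ler_sum => j _; rewrite normrM mulrC; apply: ler_wpM2l => //; apply: err.
have r0R : 0 < r%:R :> R by rewrite ltr0n.
by rewrite divr_ge0// ler_pdivrMr// mul1r ler_nat -ltnS ltn_ord.
Qed.

(* The values of [f] at the nodes [z + h c / r], [c] ranging over [{0..r}^t],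
   weighted by the products of the univariate Lagrange polynomials. *)
Lemma tensor_interpolation r t (lag : 'I_r.+1 -> {poly R}) (L : R) (r0 : (0 < r)%N)
  (lagL : forall u, 0 <= u <= 1 -> \sum_j `|(lag j).[u]| <= L) :
  0 <= L ->
  exists (NT : finType) (c : NT -> 'I_t -> 'I_r.+1) (Kt : R),
  (#|NT| <= r.+1 ^ t)%N /\ 0 <= Kt /\
  forall (f : 'cV[R]_t -> R) (z : 'cV[R]_t) (h e : R), 0 <= h -> 0 <= e ->
  (forall k x u, 0 <= u <= 1 ->
    `|f (set_coord x k (z k 0 + h * u)) -
      \sum_(j < r.+1) f (set_coord x k (z k 0 + h * (j%:R / r%:R))) * (lag j).[u]| <= e) ->
  forall u : 'I_t -> R, (forall k, 0 <= u k <= 1) ->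
  `|f (\col_k (z k 0 + h * u k)) - \sum_nu
     f (\col_k (z k 0 + h * ((c nu k)%:R / r%:R))) * \prod_k (lag (c nu k)).[u k]|
    <= Kt * e.
Proof.
move=> L0.
(* The coordinates are interpolated one after the other along a list; those outside the list keep
   their true value [u k]. Each new coordinate changes the constant [Kt] to [1 + L * Kt]. *)
suff [NT [c [Kt [cNT [Kt0 H]]]]] : exists (NT : finType) (c : NT -> 'I_t -> 'I_r.+1) (Kt : R),
  (#|NT| <= r.+1 ^ size (enum 'I_t))%N /\ 0 <= Kt /\
  forall (f : 'cV[R]_t -> R) (z : 'cV[R]_t) (h e : R), 0 <= h -> 0 <= e ->
  (forall k x u, 0 <= u <= 1 ->
    `|f (set_coord x k (z k 0 + h * u)) -
      \sum_(j < r.+1) f (set_coord x k (z k 0 + h * (j%:R / r%:R))) * (lag j).[u]| <= e) ->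
  forall u : 'I_t -> R, (forall k, 0 <= u k <= 1) ->
  `|f (\col_k (z k 0 + h * u k)) - \sum_nu
     f (\col_k (z k 0 + h * (if k \in enum 'I_t then (c nu k)%:R / r%:R else u k))) *
     \prod_(k <- enum 'I_t) (lag (c nu k)).[u k]| <= Kt * e.
  exists NT, c, Kt; rewrite size_enum_ord in cNT; split=> //; split=> // f z h e h0 e0 He u u01.
  have := H f z h e h0 e0 He u u01; apply: le_trans.
  rewrite le_eqVlt; apply/orP; left; apply/eqP; congr (`| _ - _ |).
  apply: eq_bigr => nu _; rewrite -[\prod_(k <- _) _]big_enum; congr (f _ * _).
  by apply/matrixP => k i; rewrite !mxE mem_enum.
elim: (enum 'I_t) (enum_uniq 'I_t) => [|k s IH] /=.
  move=> _; exists unit, (fun _ _ => ord0), 0; rewrite card_unit; split=> //; split=> // f z h e h0 e0 He u u01.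
  rewrite (eq_bigr (fun=> f (\col_k (z k 0 + h * u k)))); last first.
    by move=> i _; rewrite big_nil mulr1.
  by rewrite sumr_const card_unit subrr normr0 mul0r.
move=> /andP[ks us]; have [NT [c [Kt [cNT [Kt0 H]]]]] := IH us.
exists ('I_r.+1 * NT)%type, (fun nu i => if i == k then nu.1 else c nu.2 i), (1 + L * Kt).
split; first by rewrite card_prod card_ord expnS leq_mul.
split; first by rewrite addr_ge0// mulr_ge0.
move=> f z h e h0 e0 He u u01.
pose u' j i := if i == k then j%:R / r%:R else u i.
pose S u := \sum_nu f (\col_i (z i 0 + h * (if i \in s then (c nu i)%:R / r%:R else u i))) *
   \prod_(i <- s) (lag (c nu i)).[u i].
have r0R : 0 < r%:R :> R by rewrite ltr0n.
have u'01 (j : 'I_r.+1) i : 0 <= u' j i <= 1.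
  rewrite /u'; case: ifP => // _.
  by rewrite divr_ge0//= ler_pdivrMr// mul1r ler_nat -ltnS ltn_ord.
pose X := \col_i (z i 0 + h * u i).
have XE : X = set_coord X k (z k 0 + h * u k).
  by apply/matrixP => i j; rewrite !mxE; case: eqP => // ->.
have X'E (j : nat) : \col_i (z i 0 + h * u' j i) = set_coord X k (z k 0 + h * (j%:R / r%:R)).
  by apply/matrixP => i l; rewrite !mxE /u'; case: eqP => // ->.
have -> : f X - \sum_nu
    f (\col_i (z i 0 + h * (if i \in k :: s then
        (if i == k then nu.1 else c nu.2 i)%:R / r%:R else u i))) *
    \prod_(i <- k :: s) (lag (if i == k then nu.1 else c nu.2 i)).[u i] =
  (f X - \sum_(j < r.+1) f (\col_i (z i 0 + h * u' j i)) * (lag j).[u k]) +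
  \sum_(j < r.+1) (f (\col_i (z i 0 + h * u' j i)) - S (u' j)) * (lag j).[u k].
  under [X in _ = _ + X]eq_bigr do rewrite mulrBl.
  rewrite sumrB addrA subrK; congr (_ - _).
  rewrite -(pair_big xpredT xpredT (fun j nu =>
    f (\col_i (z i 0 + h * (if i \in k :: s then
        (if i == k then j else c nu i)%:R / r%:R else u i))) *
    \prod_(i <- k :: s) (lag (if i == k then j else c nu i)).[u i]))/=.
  apply: eq_bigr => j _; rewrite /S mulr_suml; apply: eq_bigr => nu _.
  rewrite big_cons eqxx -[RHS]mulrA [X in _ = _ * X]mulrC; congr (f _ * (_ * _)).
    apply/matrixP => i l; rewrite !mxE inE /u'; congr (_ + h * _).
    by case: eqP => [->|_]//=; rewrite (negbTE ks).
  apply: eq_big_seq => i is_.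
  have ik : (i == k) = false by apply/negbTE; apply: contra ks => /eqP <-.
  by rewrite ik /u' ik.
apply: le_trans (ler_normD _ _) _; rewrite mulrDl mul1r; apply: lerD.
  under eq_bigr do rewrite X'E.
  by rewrite [in f X]XE; exact: He.
apply: le_trans (ler_norm_sum _ _ _) _.
have Ke0 : 0 <= Kt * e by rewrite mulr_ge0.
rewrite -mulrA; apply: le_trans (ler_wpM2r Ke0 (lagL (u k) (u01 k))).
rewrite mulr_suml; apply: ler_sum => j _; rewrite normrM mulrC; apply: ler_wpM2l => //.
exact: H.
Qed.

End interpolation.

(** * Boundedness, Lipschitz continuity and local interpolation of smooth functions *)

Section smooth.
Variable R : realType.

Lemma mindex_seq_pure t (k : 'I_t) (r : nat) :
  mindex_seq [ffun i => if i == k then r else 0%N] = nseq r k.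
Proof.
suff H s : uniq s -> flatten [seq nseq ([ffun i => if i == k then r else 0%N] i) i | i <- s]
    = if k \in s then nseq r k else [::].
  by rewrite /mindex_seq H ?enum_uniq// mem_enum.
elim: s => //= i s IH /andP[si us]; rewrite IH// ffunE inE [i == k]eq_sym.
by have [->|] := eqVneq k i; first by rewrite (negbTE si) cats0.
Qed.

Lemma pderivable_nseq t (k : 'I_t) (g : 'cV[R]_t -> R) r n :
  pderivable (nseq r k) g -> (n < r)%N ->
  forall x, derivable (pderivs (nseq n k) g) x (delta_mx k 0).
Proof.
elim: r => //= r IH [gr dg]; rewrite ltnS leq_eqVlt => /predU1P[->//|nr].
exact: IH.
Qed.

Lemma set_coordD t (x : 'cV[R]_t) k (y h : R) :
  set_coord x k (h + y) = h *: delta_mx k 0 + set_coord x k y.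
Proof.
apply/matrixP => i j; rewrite !mxE ord1 eqxx andbT.
by case: eqP => _; rewrite ?mulr1 ?mulr0 ?add0r.
Qed.

Lemma is_derive_set_coord t (G : 'cV[R]_t -> R) (x : 'cV[R]_t) k (y : R) :
  derivable G (set_coord x k y) (delta_mx k 0) ->
  is_derive y 1 (fun y => G (set_coord x k y))
    ('D_(delta_mx k 0) G (set_coord x k y)).
Proof.
move=> dG; have E : (fun h : R => h^-1 *: (G (set_coord x k (h *: 1 + y)) - G (set_coord x k y)))
    = (fun h : R => h^-1 *: (G (h *: delta_mx k 0 + set_coord x k y) - G (set_coord x k y))).
  by apply/funext => h; rewrite -set_coordD; congr (_ *: (G (set_coord _ _ (_ + _)) - _)); exact: mulr1.
split; first by rewrite /derivable; move: dG; rewrite /derivable -E.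
by rewrite /derive -E.
Qed.

Lemma enorm_set_coord t (x : 'cV[R]_t) k (y y' : R) :
  enorm (set_coord x k y - set_coord x k y') = `|y - y'|.
Proof.
rewrite /enorm (bigD1 k)//= big1 ?addr0; last first.
  by move=> i /negbTE ik; rewrite !mxE ik subrr expr0n.
by rewrite !mxE eqxx sqrtr_sqr.
Qed.

Definition derivative_chain (r : nat) (C s : R) (D : nat -> R -> R) :=
  (forall k (x : R), (k < r)%N -> is_derive x 1 (D k) (D k.+1 x)) /\
  (forall x y, `|D r x - D r y| <= C * `|x - y| `^ s).

(** The chain on a coordinate line consists of the pure partial derivatives. As [s < 1], the bound
    [1 <= beta] forces [r > 0], so there is a first derivative to work with. *)
Lemma holder_smooth_chain t beta C (g : 'cV[R]_t -> R) : 1 <= beta ->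
  holder_smooth beta C g -> exists (r : nat) (s : R),
    [/\ (0 < r)%N, 0 < s < 1, beta = r%:R + s &
    forall k x, exists2 D, derivative_chain r C s D &
      forall y, D 0 y = g (set_coord x k y)].
Proof.
move=> beta1 [r [s [s01 betaE H]]]; exists r, s; split=> //.
  case: r betaE {H} => // betaE; move: beta1; rewrite betaE.
  by move: s01 => /andP[_]; rewrite mulr0n add0r ltNge => /negbTE ->.
move=> k x; exists (fun n y => pderivs (nseq n k) g (set_coord x k y)) => //.
have [] := H [ffun i => if i == k then r else 0%N].
  rewrite (bigD1 k)//= ffunE eqxx big1 ?addn0// => i /negbTE ik.
  by rewrite ffunE ik.
rewrite mindex_seq_pure => dg Hg; split.
- by move=> n y nr; apply: is_derive_set_coord; exact: pderivable_nseq dg nr _.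
- by move=> y y'; apply: le_trans (Hg _ _) _; rewrite enorm_set_coord.
Qed.

(** [D 1 z] is the derivative at [z] of the Taylor polynomial; by Lagrange's formula this is a fixed
    combination of the node values of that polynomial, which differ from those of [D 0] by at most
    [C]. *)
Lemma derivative_chain_bound (r : nat) : (0 < r)%N -> exists L1 : R, 0 <= L1 /\
  forall C s D z (B : R), 0 <= C -> derivative_chain r C s D -> 0 < s -> 
    (forall x, z <= x <= z + 1 -> `|D 0 x| <= B) -> `|D 1 z| <= L1 * (B + C).
Proof.
move=> r0; have [lag [L [L1 lagP slag lagL]]] := lagrange_basis R r0.
exists (\sum_j `|(lag j)^`().[0]|); split; first exact: sumr_ge0.
move=> C s D z B C0 [dD Ds] s0 DB.
have De x : z <= x <= z + 1 -> `|D r x - D r z| <= C.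
  move=> /andP[zx xz]; apply: le_trans (Ds _ _) _.
  rewrite ler_piMr//; apply: le_trans (_ : 1 `^ s <= 1); last by rewrite powR1.
  by apply: ge0_ler_powR; rewrite ?nnegrE ?(ltW s0)// ger0_norm; lra.
have [p [sp pz /(_ r0) p'z pP]] := taylor_poly ler01 dD De.
pose q := p \Po (z%:P + 'X).
have sq : (size q <= r.+1)%N.
  apply: leq_trans (size_comp_poly_leq _ _) _; rewrite ltnS addrC size_XaddC /=.
  by rewrite muln1 -subn1 leq_subLR.
have qE v : q.[v] = p.[z + v] by rewrite horner_comp !hornerE.
have <- : q^`().[0] = D 1 z.
  by rewrite deriv_comp derivD derivC derivX add0r mulr1 horner_comp !hornerE ?addr0.
rewrite (lagP q sq) raddf_sum horner_sum mulr_suml.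
apply: le_trans (ler_norm_sum _ _ _) _; apply: ler_sum => j _.
rewrite [X in `|X.[0]|]derivM derivC mul0r add0r hornerM hornerC normrM mulrC.
apply: ler_wpM2l => //; rewrite qE.
have r0R : 0 < r%:R :> R by rewrite ltr0n.
have zj : z <= z + j%:R / r%:R <= z + 1.
  rewrite lerDl divr_ge0//= lerD2l ler_pdivrMr// mul1r ler_nat -ltnS.
  exact: ltn_ord.
have := pP _ zj; rewrite expr1n mulr1 => h1; have h2 := DB _ zj.
rewrite -[p.[_]](subrK (D 0 (z + j%:R / r%:R))).
by apply: le_trans (ler_normD _ _) _; rewrite distrC; lra.
Qed.

(** The weights sum to 1, which will allow adding a constant to the tabulated values and subtracting
    it again at the end. *)
Lemma holder_smooth_interpolation t beta C (g : 'cV[R]_t -> R) :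
  1 <= beta -> 0 <= C -> holder_smooth beta C g ->
  exists (r : nat) (lag : 'I_r.+1 -> {poly R}) (NT : finType)
    (c : NT -> 'I_t -> 'I_r.+1) (Kt L : R),
  [/\ (0 < r)%N /\ r%:R <= beta, (#|NT| <= r.+1 ^ t)%N /\ (forall j, (size (lag j) <= r.+1)%N), 0 <= Kt,
    0 <= L /\ (forall u j, 0 <= u <= 1 -> `|(lag j).[u]| <= L) &
    (forall u : 'I_t -> R, (forall k, 0 <= u k <= 1) ->
       \sum_nu \prod_k (lag (c nu k)).[u k] = 1) /\
    forall (z : 'cV[R]_t) (h : R) (u : 'I_t -> R), 0 < h -> (forall k, 0 <= u k <= 1) ->
    `|g (\col_k (z k 0 + h * u k)) - \sum_nu
       g (\col_k (z k 0 + h * ((c nu k)%:R / r%:R))) * \prod_k (lag (c nu k)).[u k]|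
    <= Kt * h `^ beta].
Proof.
move=> beta1 C0 hg.
have [r [s [r0 /andP[s0 s1] betaE chain]]] := holder_smooth_chain beta1 hg.
have [lag [L [L1 lagP slag lagL]]] := lagrange_basis R r0.
have L0 : 0 <= L by lra.
have [NT [c [Kt [cNT [Kt0 H]]]]] := @tensor_interpolation R r t lag L r0 lagL L0.
exists r, lag, NT, c, (Kt * ((1 + L) * C)), L; split=> //.
- by rewrite betaE lerDl ltW.
- by rewrite !mulr_ge0//; lra.
- split=> // u j u01; apply: le_trans (lagL _ u01).
  by rewrite (bigD1 j)//= lerDl; exact: sumr_ge0.
split.
  move=> u u01; have lag1 v : \sum_j (lag j).[v] = 1.
    have sz1 : (size (1%R : {poly R}) <= r.+1)%N by rewrite size_poly1.
    have := congr1 (fun p => p.[v]) (lagP _ sz1); rewrite hornerC horner_sum => ->.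
    by apply: eq_bigr => j _; rewrite hornerM !hornerC mul1r.
  (* The error bound for the constant function 1, with error 0, is the partition of unity. *)
  have := H (fun=> 1) 0 1 0 ler01 (lexx _) _ u u01; rewrite mulr0 normr_le0 subr_eq0.
  under eq_bigr do rewrite mul1r; move=> h; apply/esym/eqP/h => k x v v01.
  by under eq_bigr do rewrite mul1r; rewrite lag1 subrr normr0.
move=> z h u h0 u01.
have -> : Kt * ((1 + L) * C) * h `^ beta = Kt * ((1 + L) * (C * h `^ s * h ^+ r)).
  rewrite betaE powRD; last by rewrite (gt_eqF h0) implybT.
  by rewrite powR_mulrn ?(ltW h0)//; ring.
have hs0 : 0 <= h `^ s by exact: powR_ge0.
have e0 : 0 <= (1 + L) * (C * h `^ s * h ^+ r).
  apply: mulr_ge0; first lra.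
  by rewrite !mulr_ge0 ?exprn_ge0 ?(ltW h0).
apply: H => // [|k x v v01]; first exact: ltW.
have [D [dD Ds] DE] := chain k x.
have := interpolation_error (e := C * h `^ s) r0 lagP lagL (ltW h0) _ dD _ v01.
move=> /(_ (z k 0)); rewrite mulr_ge0// => /(_ isT).
rewrite DE; under eq_bigr do rewrite DE; apply.
move=> y /andP[y1 y2]; apply: le_trans (Ds _ _) _; apply: ler_wpM2l => //.
by apply: ge0_ler_powR; rewrite ?nnegrE ?(ltW s0) ?(ltW h0)// ger0_norm; lra.
Qed.

Definition in_box t (K : R) (x : 'cV[R]_t) := forall k, - K <= x k 0 <= K.

(** Smoothness speaks of partial derivatives only, so instead of continuity and compactness one uses
    interpolation with [[-K, K]^t] as a single cell: finitely many values bound [g]. *)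
Lemma holder_smooth_bounded t beta C (g : 'cV[R]_t -> R) (K : R) :
  1 <= beta -> 0 <= C -> holder_smooth beta C g -> 0 < K ->
  exists B : R, forall x, in_box K x -> `|g x| <= B.
Proof.
move=> beta1 C0 hg K0.
have [r [lag [NT [c [Kt [L [_ _ Kt0 [L0 lagL] [_ H]]]]]]]] :=
  holder_smooth_interpolation beta1 C0 hg.
pose z : 'cV[R]_t := const_mx (- K).
pose node nu : 'cV[R]_t := \col_k (z k 0 + 2 * K * ((c nu k)%:R / r%:R)).
exists (\sum_nu `|g (node nu)| * L ^+ t + Kt * (2 * K) `^ beta) => x xK.
pose u k := (x k 0 + K) / (2 * K).
have u01 k : 0 <= u k <= 1.
  have /andP[x1 x2] := xK k; rewrite divr_ge0 ?ler_pdivrMr; lra.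
have K20 : 0 < 2 * K by lra.
have xE : x = \col_k (z k 0 + 2 * K * u k).
  apply/matrixP => k j; rewrite !mxE ord1 /u; field; lra.
have := H z (2 * K) u K20 u01; rewrite -xE -/(node _).
set S := \sum_nu _ => hS.
have hS2 : `|S| <= \sum_nu `|g (node nu)| * L ^+ t.
  apply: le_trans (ler_norm_sum _ _ _) _; apply: ler_sum => nu _.
  rewrite normrM; apply: ler_wpM2l => //; rewrite normr_prod.
  apply: le_trans (_ : \prod_(k < t) L <= _); last by rewrite prodr_const card_ord.
  by apply: ler_prod => k _; rewrite normr_ge0/=; exact: lagL.
rewrite -[g x](subrK S); apply: le_trans (ler_normD _ _) _; lra.
Qed.

Lemma holder_smooth_lip t beta C (g : 'cV[R]_t -> R) (K : R) :
  1 <= beta -> 0 <= C -> holder_smooth beta C g -> 0 < K ->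
  exists Lam : R, 0 <= Lam /\ forall x x' e, in_box K x -> in_box K x' ->
    0 <= e -> (forall k, `|x k 0 - x' k 0| <= e) -> `|g x - g x'| <= Lam * e.
Proof.
move=> beta1 C0 hg K0.
have [r [s [r0 /andP[s0 s1] _ chain]]] := holder_smooth_chain beta1 hg.
(* The derivative bound looks at values one unit ahead, beyond the box of size [K]. *)
have [|B gB] := @holder_smooth_bounded _ _ _ _ (K + 1) beta1 C0 hg; first lra.
have [L1 [L10 DL]] := derivative_chain_bound r0.
have B0 : 0 <= B.
  have := gB 0; have : in_box (K + 1) (0 : 'cV[R]_t) by move=> k; rewrite mxE; apply/andP; lra.
  by move=> h /(_ h); exact: le_trans.
pose lam := L1 * (B + C).
have lam0 : 0 <= lam by rewrite mulr_ge0// addr_ge0.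
exists (t%:R * lam); split; first by rewrite mulr_ge0.
move=> x x' e xK x'K e0 xx'.
have one k w y y' : in_box K w -> - K <= y -> y <= y' -> y' <= K ->
    `|g (set_coord w k y') - g (set_coord w k y)| <= lam * (y' - y).
  move=> wK Ky yy' y'K; have [D ch DE] := chain k w; rewrite -!DE.
  have [dD _] := ch.
  have [v vyy ->] : exists2 v, v \in `[y, y']%R & D 0 y' - D 0 y = D 1 v * (y' - y).
    apply: MVT_segment => // [v _|]; first exact: dD.
    by apply: derivable_within_continuous => v _; have [] := dD 0 v r0.
  rewrite normrM (ger0_norm (x := y' - y)); last by lra.
  apply: ler_wpM2r; first lra.
  move: vyy; rewrite in_itv/= => /andP[yv vy'].
  apply: DL C0 ch s0 _ => // a /andP[a1 a2]; rewrite DE; apply: gB => i.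
  have /andP[w1 w2] := wK i.
  by rewrite mxE; case: eqP => _; apply/andP; split; lra.
(* The path from [x] to [x'] changes one coordinate at a time, so that each step lies on a
   coordinate line. *)
pose mix (w : seq 'I_t) : 'cV[R]_t := \col_i (if i \in w then x' i 0 else x i 0).
have mixK (w : seq 'I_t) : in_box K (mix w).
  by move=> i; rewrite mxE; case: ifP => _; [exact: x'K|exact: xK].
suff H (w : seq 'I_t) : `|g (mix w) - g x| <= (size w)%:R * (lam * e).
  have := H (enum 'I_t); rewrite size_enum_ord distrC mulrA.
  by congr (`|_ - g _| <= _); apply/matrixP => i j; rewrite !mxE mem_enum ord1.
elim: w => [|k w IH].
  have -> : mix [::] = x by apply/matrixP => i j; rewrite !mxE ord1.
  by rewrite subrr normr0 mul0r.
have -> : mix (k :: w) = set_coord (mix w) k (x' k 0).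
  by apply/matrixP => i j; rewrite !mxE inE; case: eqP => [->|].
have E : mix w = set_coord (mix w) k (mix w k 0).
  by apply/matrixP => i j; rewrite !mxE; case: eqP => [->|].
have step : `|g (set_coord (mix w) k (x' k 0)) - g (mix w)| <= lam * e.
  rewrite [in g (mix w)]E.
  have /andP[a1 a2] := x'K k; have /andP[b1 b2] := mixK w k.
  have ex : `|x' k 0 - mix w k 0| <= e.
    by rewrite mxE; case: ifP => _; rewrite ?subrr ?normr0// distrC.
  have [yy|yy] := leP (mix w k 0) (x' k 0).
    apply: le_trans (one k (mix w) _ _ (mixK w) _ _ _) _ => //.
    by apply: ler_wpM2l => //; apply: le_trans ex; exact: ler_norm.
  rewrite distrC; apply: le_trans (one k (mix w) _ _ (mixK w) _ _ _) _ => //; first exact: ltW.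
  by apply: ler_wpM2l => //; apply: le_trans ex; rewrite distrC; exact: ler_norm.
rewrite -[g (set_coord _ _ _) - g x](subrKA (g (mix w))).
rewrite /= -[(size _).+1]addn1 natrD mulrDl mul1r [leRHS]addrC.
by apply: le_trans (ler_normD _ _) _; exact: lerD.
Qed.

End smooth.

(** * ReLU networks observed at finitely many points *)

Section affine_combination.
Variables (R : realType) (X : Type).

(** The sum of the absolute coefficients is bounded, and not only each of them: this is the factor
    by which weight bounds grow when affine maps are composed, whatever the number of terms. *)
Definition affine_comb (J : Type) (F : J -> X -> R) (A : R) (f : X -> R) : Prop :=
  exists (s : seq (J * R)) (c : R), [/\ \sum_(ja <- s) `|ja.2| <= A, `|c| <= A &
    forall p, f p = \sum_(ja <- s) ja.2 * F ja.1 p + c].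

Variables (J : Type) (F : J -> X -> R).
Implicit Types (A a c : R) (f g : X -> R).

Lemma affine_comb_ge0 A f : affine_comb F A f -> 0 <= A.
Proof. by case=> [s [c [_ cA _]]]; apply: le_trans cA. Qed.

Lemma affine_comb_le A A' f : A <= A' -> affine_comb F A f -> affine_comb F A' f.
Proof.
by move=> AA [s [c [h1 h2 h3]]]; exists s, c; split=> //; exact: le_trans AA.
Qed.

Lemma affine_comb_ext A f g : (forall p, f p = g p) ->
  affine_comb F A f -> affine_comb F A g.
Proof. by move=> fg [s [c [h1 h2 h3]]]; exists s, c; split=> // p; rewrite -fg. Qed.

Lemma affine_comb_conv A A' f g : affine_comb F A f -> A <= A' ->
  (forall p, f p = g p) -> affine_comb F A' g.
Proof. by move=> Ff AA fg; exact: affine_comb_ext fg (affine_comb_le AA Ff). Qed.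

Lemma affine_comb_mem j : affine_comb F 1 (F j).
Proof.
exists [:: (j, 1)], 0; split=> [||p]; rewrite ?big_seq1/= ?normr0 ?normr1//.
by rewrite mul1r addr0.
Qed.

Lemma affine_comb_cst A c : `|c| <= A -> affine_comb F A (fun=> c).
Proof.
move=> cA; exists [::], c; split=> // [|p]; rewrite big_nil ?add0r//.
exact: le_trans cA.
Qed.

Lemma affine_comb_scale A f a : affine_comb F A f ->
  affine_comb F (`|a| * A) (fun p => a * f p).
Proof.
case=> [s [c [h1 h2 h3]]]; exists [seq (ja.1, a * ja.2) | ja <- s], (a * c); split.
- rewrite big_map/= (eq_bigr (fun ja => `|a| * `|ja.2|)); last by move=> ? _; rewrite normrM.
  by rewrite -mulr_sumr ler_wpM2l.
- by rewrite normrM ler_wpM2l.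
- move=> p; rewrite h3 big_map/= mulrDr mulr_sumr; congr (_ + _).
  by apply: eq_bigr => ja _; rewrite mulrA.
Qed.

Lemma affine_comb_add A1 A2 f1 f2 : affine_comb F A1 f1 -> affine_comb F A2 f2 ->
  affine_comb F (A1 + A2) (fun p => f1 p + f2 p).
Proof.
case=> [s1 [c1 [h1 h2 h3]]] [s2 [c2 [h4 h5 h6]]]; exists (s1 ++ s2), (c1 + c2); split.
- by rewrite big_cat lerD.
- by apply: le_trans (ler_normD _ _) _; exact: lerD.
- by move=> p; rewrite h3 h6 big_cat/=; ring.
Qed.

Lemma affine_comb_sum (I : Type) (r : seq I) (P : pred I) (A : I -> R) (f : I -> X -> R) :
  (forall i, P i -> affine_comb F (A i) (f i)) ->
  affine_comb F (\sum_(i <- r | P i) A i) (fun p => \sum_(i <- r | P i) f i p).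
Proof.
move=> H; elim: r => [|i r IH].
  rewrite big_nil; apply: (affine_comb_ext (f := fun=> 0)); first by move=> p; rewrite big_nil.
  by apply: affine_comb_cst; rewrite normr0.
rewrite big_cons; case: ifP => Pi.
  apply: affine_comb_ext (affine_comb_add (H i Pi) IH).
  by move=> p; rewrite big_cons Pi.
by apply: affine_comb_ext IH => p; rewrite big_cons Pi.
Qed.

End affine_combination.

Section networks.
Variables (R : realType) (d : nat) (X : Type) (x : X -> 'cV[R]_d).
Implicit Types (k w N : nat) (A B : R).

(* [net k w B F]: simultaneously for all [j], [F j] is an affine function, with
   coefficients at most [B], of one and the same [k]-th hidden layer of a network of
   width [w]; the functions are only observed at the points [x p]. *)
Fixpoint net k w B : forall J : Type, (J -> X -> R) -> Prop :=
  match k with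
  | 0 => fun J F => forall j, exists (a : 'I_d -> R) (c : R),
      [/\ forall i, `|a i| <= B, `|c| <= B &
        forall p, F j p = \sum_i a i * x p i 0 + c]
  | k'.+1 => fun J F => exists H : 'I_w -> X -> R, net k' w B H /\
      forall j, exists (a : 'I_w -> R) (c : R),
      [/\ forall i, `|a i| <= B, `|c| <= B &
        forall p, F j p = \sum_i a i * Num.max (H i p) 0 + c]
  end.

Lemma affine_trans (I J : Type) (r : seq I) A B (H : I -> X -> R)
    (F : J -> X -> R) (G : X -> R) : 0 <= B ->
  (forall j, exists (a : I -> R) (c : R), [/\ forall i, `|a i| <= B, `|c| <= B &
        forall p, F j p = \sum_(i <- r) a i * H i p + c]) ->
  affine_comb F A G ->
  exists (a : I -> R) (c : R), [/\ forall i, `|a i| <= A * B + A, `|c| <= A * B + A &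
        forall p, G p = \sum_(i <- r) a i * H i p + c].
Proof.
move=> B0 FH GF; have A0 := affine_comb_ge0 GF.
have [s [c [sA cA GE]]] := GF.
have /choice[ac acP] : forall j, exists ac : (I -> R) * R,
    [/\ forall i, `|ac.1 i| <= B, `|ac.2| <= B &
        forall p, F j p = \sum_(i <- r) ac.1 i * H i p + ac.2].
  by move=> j; have [a [b ?]] := FH j; exists (a, b).
have bnd (f : J -> R) : (forall j, `|f j| <= B) -> `|\sum_(ja <- s) ja.2 * f ja.1| <= A * B.
  move=> fB; apply: le_trans (ler_norm_sum _ _ _) _.
  apply: le_trans (ler_wpM2r B0 sA); rewrite mulr_suml.
  by apply: ler_sum => ja _; rewrite normrM ler_wpM2l.
exists (fun i => \sum_(ja <- s) ja.2 * (ac ja.1).1 i).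
exists (\sum_(ja <- s) ja.2 * (ac ja.1).2 + c); split.
- move=> i; apply: ler_wpDr => //; apply: (bnd (fun j => (ac j).1 i)) => j.
  by have [] := acP j.
- apply: le_trans (ler_normD _ _) _; apply: lerD => //.
  by apply: (bnd (fun j => (ac j).2)) => j; have [] := acP j.
- move=> p; rewrite GE addrA; congr (_ + _).
  under eq_bigr => ja _.
    have [_ _ ->] := acP ja.1.
    rewrite mulrDr mulr_sumr; over.
  rewrite big_split/= exchange_big/=; congr (_ + _); apply: eq_bigr => i _.
  by rewrite mulr_suml; apply: eq_bigr => ja _; rewrite mulrA.
Qed.

(** An affine map of the outputs merges with the last affine layer, at no cost in depth. *)
Lemma net_affine k w A B (J J' : Type) (F : J -> X -> R) (G : J' -> X -> R) :
  0 <= B -> net k w B F -> (forall j, affine_comb F A (G j)) ->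
  B <= A * B + A -> net k w (A * B + A) G.
Proof.
move=> B0 + GF BA.
have mono k' (J0 : Type) (F0 : J0 -> X -> R) : net k' w B F0 -> net k' w (A * B + A) F0.
  elim: k' J0 F0 => [|k' IH] J0 F0 /=.
    move=> H j; have [a [c [h1 h2 h3]]] := H j; exists a, c; split=> // [i|].
      exact: le_trans BA.
    exact: le_trans BA.
  move=> [H [netH FH]]; exists H; split; first exact: IH.
  move=> j; have [a [c [h1 h2 h3]]] := FH j; exists a, c; split=> // [i|].
    exact: le_trans BA.
  exact: le_trans BA.
case: k => [|k] /=.
  by move=> FH j; exact: (affine_trans B0 FH (GF j)).
move=> [H [netH FH]]; exists H; split; first exact: mono.
by move=> j; exact: (affine_trans B0 FH (GF j)).
Qed.

Lemma net_le k w B B' (J : Type) (F : J -> X -> R) :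
  B <= B' -> net k w B F -> net k w B' F.
Proof.
move=> BB; elim: k J F => [|k IH] J F /=.
  move=> H j; have [a [c [h1 h2 h3]]] := H j; exists a, c; split=> // [i|].
    exact: le_trans BB.
  exact: le_trans BB.
move=> [H [netH FH]]; exists H; split; first exact: IH.
move=> j; have [a [c [h1 h2 h3]]] := FH j; exists a, c; split=> // [i|].
  exact: le_trans BB.
exact: le_trans BB.
Qed.

(** Layers have width exactly [w], while the units of a gadget are indexed by a finite type; the
    remaining units are idle. *)
Definition pad (T : Type) (U : finType) w (dflt : T) (H : U -> T) (i : 'I_w) : T :=
  if insub (val i) : option 'I_#|U| is Some j then H (enum_val j) else dflt.

Lemma sum_pad (U : finType) w (a : U -> R) (H : U -> X -> R) p : (#|U| <= w)%N ->
  \sum_(i < w) pad 0 a i * Num.max (pad (fun=> 0) H i p) 0 =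
  \sum_u a u * Num.max (H u p) 0.
Proof.
move=> Uw; rewrite (bigID (fun i : 'I_w => (i < #|U|)%N))/= [X in _ + X]big1 ?addr0; last first.
  by move=> i iU; rewrite /pad insubF ?mul0r//; exact/negbTE.
rewrite (big_ord_narrow Uw) [RHS](reindex (@enum_val U predT)) /=; last first.
  by apply: onW_bij; exact: enum_val_bij.
by apply: eq_bigr => i _; rewrite /pad /= valK.
Qed.

Lemma net_reindex k w B (J J' : Type) (F : J -> X -> R) (G : J' -> X -> R) : 0 <= B ->
  (forall j', (exists j, G j' = F j) \/ G j' = fun=> 0) -> net k w B F -> net k w B G.
Proof.
move=> B0 GF.
have zero n (H : 'I_n -> X -> R) : exists (a : 'I_n -> R) (c : R),
    [/\ forall i, `|a i| <= B, `|c| <= B & forall p : X, 0 = \sum_i a i * H i p + c].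
  exists (fun=> 0), 0; split=> [i||p]; rewrite ?normr0// big1 ?addr0// => i _.
  by rewrite mul0r.
case: k => [|k] /=.
  by move=> FH j'; have [[j ->]|->] := GF j'; [exact: FH|exact: zero].
move=> [H [netH FH]]; exists H; split=> // j'.
by have [[j ->]|->] := GF j'; [exact: FH|exact: zero].
Qed.

Lemma net_pad k w B (U : finType) (H : U -> X -> R) : 0 <= B ->
  net k w B H -> net k w B (pad (fun=> 0) H : 'I_w -> X -> R).
Proof.
move=> B0; apply: net_reindex => // i; rewrite /pad.
by case: insub => [j|]; [left; exists (enum_val j)|right].
Qed.

(** The step by which all gadgets are built: [H] are the preactivations of one new layer. The weight
    bound grows by the factor [2 * A], so a bounded number of layers keeps it polynomial in [n] once
    [A] is. *)
Lemma net_relu k w A B (J J' : Type) (U : finType) (F : J -> X -> R)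
    (H : U -> X -> R) (G : J' -> X -> R) :
  1 <= A -> 1 <= B -> (#|U| <= w)%N -> net k w B F ->
  (forall u, affine_comb F A (H u)) ->
  (forall j, affine_comb (fun u p => Num.max (H u p) 0) A (G j)) ->
  net k.+1 w (2 * A * B) G.
Proof.
move=> A1 B1 Uw netF FH HG.
have A0 : 0 <= A by lra.
have B0 : 0 <= B by lra.
have AB : A * B + A <= 2 * A * B.
  have : A <= A * B by rewrite ler_peMr.
  by lra.
have BA : B <= A * B + A.
  have : B <= A * B by rewrite ler_peMl.
  by lra.
exists (pad (fun=> 0) H); split.
  apply: net_pad; first by rewrite !mulr_ge0.
  apply: net_le AB _; exact: net_affine netF FH BA.
pose rH u p := Num.max (H u p) 0.
have rHP u : exists (a : U -> R) (c : R), [/\ forall i, `|a i| <= 1, `|c| <= 1 &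
    forall p, rH u p = \sum_(i <- index_enum U) a i * rH i p + c].
  exists (fun v => (v == u)%:R), 0; split.
  - by move=> v; case: eqP => _; rewrite ?normr1 ?normr0.
  - by rewrite normr0.
  - move=> p; rewrite addr0 (bigD1 u)//= eqxx mul1r big1 ?addr0// => v /negbTE ->.
    by rewrite mul0r.
move=> j; have [a [c [aA cA GE]]] := affine_trans ler01 rHP (HG j).
have AAB : A * 1 + A <= 2 * A * B.
  by rewrite mulr1 -mulr2n -[A *+ 2]mulr_natl ler_peMr// mulr_ge0.
exists (pad 0 a), c; split.
- move=> i; rewrite /pad; case: insub => [u|]; last by rewrite normr0 !mulr_ge0.
  exact: le_trans (aA _) AAB.
- exact: le_trans cA AAB.
- by move=> p; rewrite GE sum_pad.
Qed.

Lemma net_parallel k w w' B (I : finType) (J : Type) (F : I -> J -> X -> R) :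
  0 <= B -> (#|I| * w <= w')%N -> (forall i, net k w B (F i)) ->
  net k w' B (fun ij : I * J => F ij.1 ij.2).
Proof.
move=> B0 Iw; elim: k J F => [|k IH] J F /=; first by move=> FH [i j]; exact: FH.
move=> /choice[H HP].
have netH : net k w' B (fun iv : I * 'I_w => H iv.1 iv.2).
  by apply: IH => i; have [] := HP i.
exists (pad (fun=> 0) (fun iv : I * 'I_w => H iv.1 iv.2)); split; first exact: net_pad.
move=> [i j] /=; have [_ FH] := HP i; have [a [c [aB cB FE]]] := FH j.
exists (pad 0 (fun iv : I * 'I_w => if iv.1 == i then a iv.2 else 0)), c; split=> //.
- move=> v; rewrite /pad; case: insub => [u|]; last by rewrite normr0.
  by case: ifP; rewrite ?normr0.
- move=> p; rewrite sum_pad; last by rewrite card_prod card_ord.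
  rewrite FE; congr (_ + _).
  rewrite -(pair_big xpredT xpredT (fun i' v =>
    (if i' == i then a v else 0) * Num.max (H i' v p) 0))/=.
  rewrite (bigD1 i)//= [X in _ + X]big1 ?addr0; last first.
    by move=> i' /negbTE ii; apply: big1 => v _; rewrite ii mul0r.
  by apply: eq_bigr => v _; rewrite eqxx.
Qed.

(** [relu_net] grows at the input side and [net] at the output side; this reconciles the two. *)
Lemma relu_net_rcons N dout k din (g : 'cV[R]_din -> 'cV[R]_N) B
    (W : 'M[R]_(dout, N)) (b : 'cV[R]_dout) :
  mx_bounded B W -> mx_bounded B b -> @relu_net R N N B k din g ->
  @relu_net R N dout B k.+1 din (fun z => W *m relu (g z) + b).
Proof.
move=> WB bB; elim: k din g => [|k IH] din g /=.
  move=> [W0 [b0 [WB0 bB0 ->]]]; exists W0, b0, (fun z => W *m z + b); split=> //.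
  by exists W, b.
move=> [W0 [b0 [h [WB0 bB0 hh ->]]]].
by exists W0, b0, (fun z => W *m relu (h z) + b); split=> //; exact: IH.
Qed.

Lemma net_relu_net k w B m (F : 'I_m -> X -> R) : net k w B F ->
  exists2 g, @relu_net R w m B k d g & forall p i, g (x p) i 0 = F i p.
Proof.
have mxE' m' n (a : 'I_m' -> ('I_n -> R) * R) (z : 'cV[R]_n) i :
    ((\matrix_(i < m', j < n) (a i).1 j) *m z + \col_i (a i).2) i 0 =
    \sum_j (a i).1 j * z j 0 + (a i).2.
  by rewrite !mxE; congr (_ + _); apply: eq_bigr => j _; rewrite !mxE.
elim: k m F => [|k IH] m F /=.
  move=> FH; have /choice[a aP] : forall j, exists ac : ('I_d -> R) * R,
      [/\ forall i, `|ac.1 i| <= B, `|ac.2| <= B &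
        forall p, F j p = \sum_i ac.1 i * x p i 0 + ac.2].
    by move=> j; have [a [c ?]] := FH j; exists (a, c).
  exists (fun z => (\matrix_(i < m, j < d) (a i).1 j) *m z + \col_i (a i).2).
    by eexists; eexists; split; [| |reflexivity] => i j; rewrite !mxE; have [] := aP i.
  by move=> p i; rewrite mxE'; have [_ _ ->] := aP i.
move=> [H [netH FH]].
have [g gn gE] := IH _ _ netH.
have /choice[a aP] : forall j, exists ac : ('I_w -> R) * R,
      [/\ forall i, `|ac.1 i| <= B, `|ac.2| <= B &
        forall p, F j p = \sum_i ac.1 i * Num.max (H i p) 0 + ac.2].
  by move=> j; have [a [c ?]] := FH j; exists (a, c).
exists (fun z => (\matrix_(i < m, j < w) (a i).1 j) *m relu (g z) + \col_i (a i).2).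
  by apply: relu_net_rcons gn => i j; rewrite !mxE; have [] := aP i.
move=> p i; rewrite mxE'; have [_ _ ->] := aP i; congr (_ + _).
by apply: eq_bigr => j _; rewrite mxE gE.
Qed.

End networks.

(** * Digit extraction *)

Section digits.
Variable R : realType.

(** A ramp of slope [dl^-1] is an exact step here, because a fractional part [f <= 1 - dl] never
    puts the argument on the slope. *)
Lemma relu_step (b e beta : nat) (f dl : R) : 0 < dl -> 0 <= f -> f <= 1 - dl ->
  dl^-1 * (Num.max (e%:R + f - beta%:R + dl) 0 - Num.max (e%:R + f - beta%:R) 0) =
  (beta <= e)%N%:R.
Proof.
move=> d0 f0 f1; have [be|eb] := leqP beta e.
  have be' : beta%:R <= e%:R :> R by rewrite ler_nat.
  rewrite !max_l; [|lra|lra].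
  by rewrite addrAC subrr add0r mulVf ?gt_eqF.
have eb' : e%:R + 1 <= beta%:R :> R by rewrite natr1 ler_nat.
by rewrite !max_r; [rewrite subrr mulr0|lra|lra].
Qed.

Lemma relu_indicator (b e beta : nat) (f dl : R) : 0 < dl -> 0 <= f -> f <= 1 - dl ->
  let st c := dl^-1 * (Num.max (e%:R + f - c%:R + dl) 0 - Num.max (e%:R + f - c%:R) 0) in
  st beta - st beta.+1 = (e == beta)%:R.
Proof.
move=> d0 f0 f1 /=; rewrite !relu_step//.
by case: ltngtP; rewrite ?subrr ?subr0.
Qed.

Lemma modn_digit (E b m : nat) : (0 < b)%N ->
  (E %% b ^ m.+1 = (E %/ b ^ m %% b) * b ^ m + E %% b ^ m)%N.
Proof.
move=> b0; have bm : (0 < b ^ m)%N by rewrite expn_gt0 b0.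
rewrite {1}(divn_eq E (b ^ m)) {1}(divn_eq (E %/ b ^ m) b) mulnDl -mulnA -expnS -addnA.
rewrite modnMDl modn_small// expnS.
apply: (@leq_trans ((E %/ b ^ m %% b).+1 * b ^ m)).
  by rewrite mulSn addnC ltn_add2r ltn_mod.
by rewrite leq_mul2r ltn_mod b0 orbT.
Qed.

(** Pigeonhole: among the [n.+1] shifts [j / n.+1] each point spoils at most one, since two
    different shifts are at least [1 / n.+1] apart modulo 1. *)
Lemma shift_away_from_integers (n : nat) (y : 'I_n -> R) : (forall i, 0 <= y i) ->
  exists s : R, 0 <= s < 1 /\ forall i,
    (y i + s) - (Num.truncn (y i + s))%:R <= 1 - n.+1%:R^-1.
Proof.
move=> y0; pose sh (j : 'I_n.+1) : R := j%:R / n.+1%:R.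
have n0 : 0 < n.+1%:R :> R by rewrite ltr0n.
have sh01 j : 0 <= sh j < 1.
  by rewrite divr_ge0//= ltr_pdivrMr// mul1r ltr_nat ltn_ord.
apply: contrapT => nosh.
have /choice[f fP] : forall j, exists i,
    1 - n.+1%:R^-1 < (y i + sh j) - (Num.truncn (y i + sh j))%:R.
  move=> j; apply: contrapT => noi; apply: nosh; exists (sh j); split=> // i.
  by rewrite leNgt; apply/negP => h; apply: noi; exists i.
have ninj : ~ injective f.
  by move=> /leq_card; rewrite !card_ord ltnn.
apply: ninj => j j' ff; apply/eqP; apply/negPn/negP => jj'.
wlog lt : j j' ff jj' / (j < j')%N.
  move=> W; case: (ltngtP j j') => // h; first exact: (W j j').
    by apply: (W j' j) => //; rewrite eq_sym.
  by move/eqP: jj'; apply; exact: val_inj.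
have := fP j; have := fP j'; rewrite -ff; set yy := y (f j).
have yy0 : 0 <= yy by exact: y0.
have y1 : 0 <= yy + sh j by rewrite addr_ge0//; have /andP[] := sh01 j.
have y2 : 0 <= yy + sh j' by rewrite addr_ge0//; have /andP[] := sh01 j'.
have /andP[a1 a2] := truncn_itv y1; have /andP[b1 b2] := truncn_itv y2.
move=> h' h.
set E := Num.truncn (yy + sh j) in h a1 a2; set E' := Num.truncn (yy + sh j') in h' b1 b2.
have dj : sh j' = sh j + (j' - j)%:R / n.+1%:R.
  by rewrite /sh natrB ?(ltnW lt)// -mulrDl addrC subrK.
have m1 : n.+1%:R^-1 <= (j' - j)%:R / n.+1%:R :> R.
  by rewrite ler_peMl ?invr_ge0 ?(ltW n0)// ler1n subn_gt0.
have m2 : (j' - j)%:R / n.+1%:R <= 1 - n.+1%:R^-1 :> R.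
  rewrite ler_pdivrMr// mulrBl mul1r mulVf ?gt_eqF// -natr1 addrK ler_nat.
  by rewrite leq_subLR (leq_trans _ (leq_addl _ _))// -ltnS ltn_ord.
rewrite dj in b1 b2 h' *.
move: a2 b2; rewrite -[E.+1%:R]natr1 -[E'.+1%:R]natr1 => a2 b2.
move: ((j' - j)%N%:R / n.+1%:R : R) (n.+1%:R^-1 : R) m1 m2 b1 b2 h h' => dd nn m1 m2 b1 b2 h h'.
have E1 : (E < E')%N.
  have : E%:R < E'%:R :> R by lra.
  by rewrite ltr_nat.
have : E.+1%:R <= E'%:R :> R by rewrite ler_nat.
by rewrite -natr1; lra.
Qed.

(* The bound on the remainders keeps them away from [1], where the digit maps jump. *)
Lemma digit_expansion (n b D : nat) (K : R) (v : 'I_n -> R) :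
  (1 < b)%N -> (0 < D)%N -> 0 < K -> (forall p, `|v p| <= K) ->
  exists (s : R) (e : 'I_D -> 'I_n -> 'I_b) (z : nat -> 'I_n -> R),
  [/\ 0 <= s < 1,
    forall p, z 0 p = (v p + K) / (4 * K) + s / b%:R ^+ D,
    forall (j : 'I_D) p, b%:R * z j p = (e j p)%:R + z j.+1 p &
    forall j p, (j <= D)%N -> 0 <= z j p <= 1 - (n.+1%:R * b%:R ^+ D)^-1].
Proof.
move=> b1 D0 K0 vK; pose y p := b%:R ^+ D * ((v p + K) / (4 * K)).
have b0 : (0 < b)%N by apply: leq_trans b1.
have bR : 2 <= b%:R :> R by rewrite ler_nat.
have bD1 : 2 <= b%:R ^+ D :> R.
  apply: le_trans bR _; case: D D0 {y} => // D _.
  by rewrite exprS ler_peMr// exprn_ege1// ler1n ltnW.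
have bD0 : 0 < b%:R ^+ D :> R by lra.
(* Dividing by [4 K] and not by [2 K] leaves the upper half of the unit interval free for the
   shift. *)
have q01 p : 0 <= (v p + K) / (4 * K) <= 2^-1.
  have := vK p; rewrite ler_norml => /andP[v1 v2].
  apply/andP; split; first by apply: divr_ge0; lra.
  by rewrite ler_pdivrMr; lra.
have y0 p : 0 <= y p by rewrite mulr_ge0 ?(ltW bD0)//; have /andP[] := q01 p.
have [s [s01 sP]] := shift_away_from_integers y0.
have n0 : 0 < n.+1%:R :> R by rewrite ltr0n.
pose E p := Num.truncn (y p + s).
have ys0 p : 0 <= y p + s by rewrite addr_ge0//; have /andP[] := s01.
pose rho p := y p + s - (E p)%:R.
have rho0 p : 0 <= rho p by rewrite subr_ge0; have /andP[] := truncn_itv (ys0 p).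
have ED p : (E p < b ^ D)%N.
  rewrite -(ltr_nat R) natrX; apply: (@le_lt_trans _ _ (y p + s)).
    by have /andP[] := truncn_itv (ys0 p).
  have : y p <= b%:R ^+ D * 2^-1 by rewrite ler_wpM2l ?(ltW bD0)//; have /andP[] := q01 p.
  by have /andP[] := s01; lra.
(* All digits are read off the single integer [E p], most significant first; each remainder is the
   lower part of [E p] plus the common fractional part [rho p], rescaled. *)
exists s, (fun j p => Ordinal (ltn_pmod (E p %/ b ^ (D - j.+1)) b0)).
exists (fun j p => ((E p %% b ^ (D - j))%:R + rho p) / b%:R ^+ (D - j)).
have bm m : 0 < b%:R ^+ m :> R by rewrite exprn_gt0//; lra.
split=> //.
- move=> p; rewrite subn0 modn_small// /rho addrC subrK mulrDl; congr (_ + _).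
  by rewrite /y mulrC mulKf// gt_eqF.
- move=> j p /=; have -> : (D - j = (D - j.+1).+1)%N by have := ltn_ord j; lia.
  rewrite modn_digit// natrD natrM natrX exprS.
  by field; rewrite !gt_eqF//; lra.
- move=> j p jD; have := sP p; rewrite -/(E p) -/(rho p) => rho1.
  apply/andP; split; first by apply: divr_ge0; [exact: addr_ge0|exact: ltW].
  have h1 : (E p %% b ^ (D - j))%:R <= b%:R ^+ (D - j) - 1 :> R.
    by rewrite -natrX lerBrDr natr1 ler_nat ltn_mod expn_gt0 b0.
  rewrite ler_pdivrMr//; apply: (@le_trans _ _ (b%:R ^+ (D - j) - n.+1%:R^-1)).
    by apply: le_trans (lerD h1 rho1) _; rewrite [_ - 1]addrC addrACA addNr add0r.
  rewrite mulrBl mul1r lerD2l lerN2 invfM -mulrA ler_piMr ?invr_ge0 ?(ltW n0)//.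
  rewrite mulrC ler_pdivrMr// mul1r ler_eXn2l ?leq_subr//; lra.
Qed.

End digits.

Section gadget.
Variables (R : realType) (d : nat) (X : Type) (x : X -> 'cV[R]_d).
Variables (t D b : nat).
Variable e : 'I_t -> 'I_D -> X -> 'I_b.
Implicit Types (k w : nat) (A B : R).

Definition digit_is (kib : 'I_t * ('I_D * 'I_b)) (p : X) : R :=
  (e kib.1 kib.2.1 p == kib.2.2)%:R.

Lemma max0_id (y : R) : 0 <= y -> Num.max y 0 = y.
Proof. by move=> y0; rewrite max_l. Qed.

(** The state after [j] digits is the indicators found so far together with the remainder [z j]. One
    layer passes the indicators on, which ReLU leaves alone since they are nonnegative, applies
    ramps at all thresholds to [b * z j], and obtains the next remainder by subtracting the digit
    found. *)
Lemma net_digit_step k w A B (z : 'I_t -> nat -> X -> R) (dl : R) (j : nat) :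
  let st j (ko : 'I_t * option ('I_D * 'I_b)) p :=
    if ko.2 is Some ib then if (ib.1 < j)%N then digit_is (ko.1, ib) p else 0
    else z ko.1 j p in
  1 <= A -> 1 <= B -> 0 < dl <= 1 ->
  (forall i (l : 'I_D) p, b%:R * z i l p = (e i l p)%:R + z i l.+1 p) ->
  (forall i l p, (l <= D)%N -> 0 <= z i l p <= 1 - dl) ->
  2 * b%:R + 1 + 4 * b%:R ^+ 2 / dl <= A ->
  (t * (1 + D * b + b.+1 * 2) <= w)%N ->
  (j < D)%N -> net x k w B (st j) -> net x k.+1 w (2 * A * B) (st j.+1).
Proof.
move=> st A1 B1 /andP[dl0 dl1] zE z01 AE wE jD netS.
pose jj := Ordinal jD.
have bR0 : 0 <= b%:R :> R by [].
have bdl : 0 <= 4 * b%:R ^+ 2 / dl by rewrite divr_ge0 ?mulr_ge0 ?exprn_ge0// ltW.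
pose U : finType := ('I_t * (option ('I_D * 'I_b) + 'I_b.+1 * bool))%type.
pose H (u : U) p : R := match u.2 with
  | inl o => st j (u.1, o) p
  | inr (beta, c) => b%:R * z u.1 j p - beta%:R + (if c then dl else 0) end.
pose rH u p := Num.max (H u p) 0.
have z0 i l p : (l <= D)%N -> 0 <= z i l p by move=> /(z01 i l p)/andP[].
have st0 ko p : 0 <= st j ko p.
  case: ko => i [[l be]|]; rewrite /st /=; last by apply: z0; exact: ltnW.
  by case: (l < j)%N.
have carry i o : affine_comb rH 1 (st j (i, o)).
  apply: affine_comb_ext (affine_comb_mem rH (i, inl o)) => p.
  by rewrite /rH /H/= max0_id.
have ind i (beta : 'I_b) : affine_comb rH (4 / dl) (digit_is (i, (jj, beta))).
  pose s0 : 'I_b.+1 := widen_ord (leqnSn b) beta; pose s1 : 'I_b.+1 := lift ord0 beta.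
  have stp (s : 'I_b.+1) : affine_comb rH (dl^-1 * (1 + 1)) (fun p =>
      dl^-1 * (rH (i, inr (s, true)) p + -1 * rH (i, inr (s, false)) p)).
    rewrite -[X in X * (1 + 1)]gtr0_norm ?invr_gt0//; apply: affine_comb_scale.
    apply: affine_comb_add; first exact: affine_comb_mem.
    by have := affine_comb_scale (-1) (affine_comb_mem rH (i, inr (s, false)));
      rewrite normrN normr1 mulr1.
  apply: affine_comb_conv (affine_comb_add (stp s0)
    (affine_comb_scale (-1) (stp s1))) _ _.
    by rewrite normrN normr1 le_eqVlt; apply/orP; left; apply/eqP; ring.
  move=> p; rewrite /digit_is /=.
  have /andP[f0 f1] := z01 i j.+1 p jD.
  have <- := @relu_indicator R b (e i jj p) beta (z i j.+1 p) dl dl0 f0 f1.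
  have zz := zE i jj p; rewrite /= in zz.
  by rewrite /rH /H /= zz !addr0 /bump add1n; ring.
apply: (net_relu (U := U) (F := st j) (H := H)) => //.
- by move: wE; rewrite add1n card_prod card_sum card_option !card_prod !card_ord card_bool.
- move=> [i [q|[beta c]]].
    by apply: affine_comb_le (affine_comb_mem (st j) (i, q)); lra.
  apply: affine_comb_conv (affine_comb_add
    (affine_comb_scale b%:R (affine_comb_mem (st j) (i, None)))
    (affine_comb_cst (st j) (A := b%:R + 1) (c := - beta%:R + (if c then dl else 0)) _)) _ _.
  - apply: le_trans (ler_normD _ _) _; apply: lerD.
      by rewrite normrN ger0_norm// ler_nat -ltnS.
    by case: c; rewrite ?normr0// gtr0_norm.
  - by rewrite mulr1 ger0_norm//; lra.
  - by move=> p; rewrite /H /st /= addrA.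
- move=> [i [[l beta]|]]; last first.
    apply: affine_comb_conv (affine_comb_add
      (affine_comb_scale b%:R (carry i None))
      (affine_comb_sum (index_enum 'I_b) (P := predT) (fun beta _ =>
        affine_comb_scale (- (beta : 'I_b)%:R) (ind i beta)))) _ _.
    + rewrite mulr1 ger0_norm//.
      have : \sum_(beta < b) `|- beta%:R| * (4 / dl) <= \sum_(beta < b) b%:R * (4 / dl).
        apply: ler_sum => beta _; apply: ler_wpM2r; first by rewrite divr_ge0// ltW.
        by rewrite normrN ger0_norm// ler_nat ltnW.
      rewrite sumr_const card_ord -[X in _ <= X -> _]mulr_natl.
      have -> : b%:R * (b%:R * (4 / dl)) = 4 * b%:R ^+ 2 / dl :> R by ring.
      by move=> h; lra.
    + move=> p /=; have := zE i jj p => /= ->.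
      rewrite addrAC (bigD1 (e i jj p))//= big1 ?addr0; last first.
        by move=> beta be; rewrite /digit_is/= eq_sym (negbTE be) mulr0.
      by rewrite /digit_is/= eqxx mulr1 subrr add0r.
  rewrite /st /=; case: (ltngtP l j) => lj.
  + rewrite ltnS (ltnW lj).
    apply: affine_comb_conv (carry i (Some (l, beta))) _ _ => // p.
    by rewrite /st/= lj.
  + rewrite ltnNge lj /=; apply: affine_comb_cst; rewrite normr0; lra.
  + rewrite lj ltnSn; have -> : l = jj by exact: val_inj.
    apply: affine_comb_le (ind i beta).
    have [b0|b0] := posnP b; first by case: beta; rewrite b0.
    have b1 : 1 <= b%:R ^+ 2 :> R by rewrite exprn_ege1// ler1n.
    have : 4 / dl <= 4 * b%:R ^+ 2 / dl.
      by rewrite ler_pM2r ?invr_gt0// ler_peMr.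
    by lra.
Qed.

Lemma net_digits k w A B (V : 'I_t -> X -> R) (z : 'I_t -> nat -> X -> R) (dl : R) :
  1 <= A -> 1 <= B -> 0 < dl <= 1 ->
  (forall i (l : 'I_D) p, b%:R * z i l p = (e i l p)%:R + z i l.+1 p) ->
  (forall i l p, (l <= D)%N -> 0 <= z i l p <= 1 - dl) ->
  2 * b%:R + 1 + 4 * b%:R ^+ 2 / dl <= A ->
  (t * (1 + D * b + b.+1 * 2) <= w)%N ->
  net x k w B V -> (forall i, affine_comb V A (z i 0%N)) ->
  net x (D + k) w ((2 * A) ^+ D.+1 * B) digit_is.
Proof.
move=> A1 B1 dl01 zE z01 AE wE netV zV.
pose st j (ko : 'I_t * option ('I_D * 'I_b)) p :=
    if ko.2 is Some ib then if (ib.1 < j)%N then digit_is (ko.1, ib) p else 0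
    else z ko.1 j p.
have netS j : (j <= D)%N -> net x (j + k) w ((2 * A) ^+ j.+1 * B) (st j).
  elim: j => [_|j IH jD].
    have BA : B <= A * B by rewrite ler_peMl//; lra.
    have AB : A <= A * B by rewrite ler_peMr//; lra.
    apply: (net_le (B := A * B + A)); first by rewrite expr1; lra.
    apply: (net_affine _ netV); last by lra.
      by lra.
    move=> [i [[l be]|]]; last exact: zV.
    by apply: affine_comb_cst; rewrite normr0; lra.
  rewrite exprS -mulrA addSn; apply: net_digit_step dl01 zE z01 AE wE jD (IH (ltnW jD)) => //.
  by rewrite -[1]mulr1; apply: ler_pM => //; apply: exprn_ege1; lra.
apply: net_reindex (netS D (leqnn D)).
  by rewrite mulr_ge0 ?exprn_ge0//; lra.
move=> [i [l be]]; left; exists (i, Some (l, be)); apply/funext => p.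
by rewrite /st/= ltn_ord.
Qed.

End gadget.

(** * Table lookup and exact multiplication *)

Section piecewise_polynomial.
Variables (R : realType) (d : nat) (X : Type) (x : X -> 'cV[R]_d).
Variables (t D b : nat).
Variable e : 'I_t -> 'I_D -> X -> 'I_b.
Implicit Types (k w : nat) (A B M : R).

Local Notation dig := (digit_is R e).
Local Notation J := ('I_t * ('I_D * 'I_b))%type.
Local Notation cells := {ffun 'I_t -> 'I_b}.

Lemma digit_is_ge0 kib p : 0 <= dig kib p. Proof. exact: ler0n. Qed.

(** Later layers still read the digits, so each layer carries their indicators along. *)
Definition with_digits (Q : Type) (f : Q -> X -> R) (q : J + Q) : X -> R :=
  match q with inl kib => dig kib | inr q => f q end.

Definition cell (l : 'I_D) (p : X) : cells := [ffun i => e i l p].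

Definition cell_is (pos : bool -> 'I_D) (fs : cells * bool) (p : X) : R :=
  (cell (pos fs.2) p == fs.1)%:R.

(** A conjunction as one unit: the sum of [t] indicators minus [t - 1] is 1 if all of them hold, and
    at most 0 otherwise. *)
Lemma net_cells k w A B pos : 1 <= A -> 1 <= B -> 2 * t%:R + 1 <= A ->
  (t * (D * b) + b ^ t * 2 <= w)%N ->
  net x k w B dig -> net x k.+1 w (2 * A * B) (with_digits (cell_is pos)).
Proof.
move=> A1 B1 tA wE netD.
pose U : finType := (J + cells * bool)%type.
pose H (u : U) p : R := match u with
  | inl kib => dig kib p
  | inr fs => \sum_i dig (i, (pos fs.2, fs.1 i)) p + (1 - t%:R) end.
apply: (net_relu (U := U) (F := dig) (H := H)) => //.
- by rewrite card_sum !card_prod card_ffun !card_ord card_bool.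
- case=> [kib|[f s]].
    by apply: affine_comb_le (affine_comb_mem dig kib).
  apply: (affine_comb_conv (affine_comb_add
    (affine_comb_sum (index_enum 'I_t) (P := predT) (fun i _ =>
      affine_comb_mem dig (i, (pos s, f i))))
    (affine_comb_cst dig (A := t%:R + 1) (c := 1 - t%:R) _))) => //.
  - by apply: le_trans (ler_normB _ _) _; rewrite normr1 ger0_norm// addrC.
  - by rewrite sumr_const card_ord; move: tA; rewrite mulr_natl; lra.
- case=> [kib|[f s]].
    apply: (affine_comb_conv (affine_comb_mem _ (inl kib : U))) => // p.
    by rewrite /= max0_id ?digit_is_ge0.
  apply: (affine_comb_conv (affine_comb_mem _ (inr (f, s) : U))) => // p.
  rewrite /H /cell_is /digit_is /=.
  have [<-|ne] := eqVneq (cell (pos s) p) f.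
    rewrite (eq_bigr (fun=> 1)); last by move=> i _; rewrite ffunE eqxx.
    by rewrite sumr_const card_ord addrC subrK max_l.
  have [i ni] : exists i, e i (pos s) p != f i.
    apply/existsP; rewrite -negb_forall; apply: contra ne => /forallP h.
    by apply/eqP/ffunP => i; rewrite ffunE; exact/eqP/h.
  rewrite max_r// (bigD1 i)//= (negbTE ni) add0r.
  have : \sum_(j < t | j != i) (e j (pos s) p == f j)%:R <= \sum_(j < t | j != i) 1 :> R.
    by apply: ler_sum => j _; rewrite lern1 leq_b1.
  rewrite (_ : \sum_(j < t | j != i) 1 = t%:R - 1 :> R); first lra.
  have : \sum_(j < t) 1 = t%:R :> R by rewrite sumr_const card_ord.
  by rewrite (bigD1 i)//= => <-; rewrite addrAC subrr add0r.
Qed.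

(** For a fixed second index [g], the entry selected by the first index is linear in the first
    indicators. Adding [M * 1_g - M] before ReLU keeps this entry if [g] is the right index and
    kills it otherwise, since entries lie in [[0, M]]. Thus [b^(2 t)] entries sit in the weights of
    a layer of width of order [b^t]. *)
Lemma net_lookup k w A B M pos (Q : finType) (F : Q -> cells -> cells -> R) :
  1 <= A -> 1 <= B -> 0 <= M ->
  (forall q f g, 0 <= F q f g <= M) ->
  M * ((b ^ t)%:R + 2) <= A -> (b ^ t)%:R <= A ->
  (t * (D * b) + #|Q| * b ^ t <= w)%N ->
  net x k w B (with_digits (cell_is pos)) ->
  net x k.+1 w (2 * A * B)
    (with_digits (fun q p => F q (cell (pos false) p) (cell (pos true) p))).
Proof.
move=> A1 B1 M0 FM MA bA wE netD.
pose U : finType := (J + Q * cells)%type.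
pose H (u : U) p : R := match u with
  | inl kib => dig kib p
  | inr qg => \sum_f F qg.1 f qg.2 * cell_is pos (f, false) p +
      (M * cell_is pos (qg.2, true) p + - M) end.
apply: (net_relu (U := U) (F := with_digits (cell_is pos)) (H := H)) => //.
- by rewrite card_sum !card_prod card_ffun !card_ord.
- case=> [kib|[q g]].
    by apply: affine_comb_le (affine_comb_mem (with_digits (cell_is pos)) (inl kib)).
  apply: (affine_comb_conv (affine_comb_add
    (affine_comb_sum (index_enum cells) (P := predT) (fun f _ =>
      affine_comb_scale (F q f g) (affine_comb_mem (with_digits (cell_is pos)) (inr (f, false)))))
    (affine_comb_add
      (affine_comb_scale M (affine_comb_mem (with_digits (cell_is pos)) (inr (g, true))))
    (affine_comb_cst _ (A := M) (c := - M) _)))) => //.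
  - by rewrite normrN ger0_norm.
  - rewrite mulr1 ger0_norm//; apply: le_trans MA.
    have : \sum_f `|F q f g| * 1 <= \sum_(f : cells) M.
      by apply: ler_sum => f _; have /andP[F0 F1] := FM q f g; rewrite mulr1 ger0_norm.
    rewrite sumr_const card_ffun !card_ord -[X in _ <= X -> _]mulr_natl => h.
    by lra.
- case=> [kib|q].
    apply: (affine_comb_conv (affine_comb_mem _ (inl kib : U))) => // p.
    by rewrite /= max0_id ?digit_is_ge0.
  apply: (affine_comb_conv (affine_comb_sum (index_enum cells) (P := predT) (fun g _ =>
      affine_comb_mem _ (inr (q, g) : U)))) => // [|p].
    by rewrite sumr_const card_ffun !card_ord.
  have lookup g : \sum_f F q f g * cell_is pos (f, false) p = F q (cell (pos false) p) g.
    rewrite (bigD1 (cell (pos false) p))//= /cell_is/= eqxx mulr1 big1 ?addr0//.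
    by move=> f /negbTE nf; rewrite eq_sym nf mulr0.
  rewrite /= (bigD1 (cell (pos true) p))//= [X in _ + X]big1 ?addr0.
    have /andP[F0 F1] := FM q (cell (pos false) p) (cell (pos true) p).
    by rewrite /H /= lookup /cell_is/= eqxx mulr1 subrr addr0 max_l.
  move=> g /negbTE ng; have /andP[F0 F1] := FM q (cell (pos false) p) g.
  by rewrite /H /= lookup /cell_is/= eq_sym ng mulr0 add0r max_r// subr_le0.
Qed.

(** The unit for the digit value [be] at place [l] returns [acc] or 0 by the same gate; weighting it
    with [c l * be] and summing gives the exact product. With [sel] only some of the accumulators
    are multiplied. *)
Lemma net_multiply k w A B M (Q : finType) (acc : Q -> X -> R) (sel : pred Q) (i : 'I_t)
    (c : 'I_D -> R) :
  1 <= A -> 1 <= B -> 0 <= M -> (forall q p, 0 <= acc q p <= M) ->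
  (forall l, 0 <= c l <= 1) ->
  1 + 2 * M <= A -> D%:R * b%:R ^+ 2 <= A ->
  (t * (D * b) + #|Q| * (1 + D * b) <= w)%N ->
  net x k w B (with_digits acc) ->
  net x k.+1 w (2 * A * B) (with_digits (fun q p => if sel q then
    acc q p * \sum_l c l * (e i l p)%:R else acc q p)).
Proof.
move=> A1 B1 M0 accM c01 MA DbA wE netS.
pose U : finType := (J + Q * option ('I_D * 'I_b))%type.
pose H (u : U) p : R := match u with
  | inl kib => dig kib p
  | inr (q, None) => acc q p
  | inr (q, Some lb) => acc q p + (M * dig (i, lb) p + - M) end.
apply: (net_relu (U := U) (F := with_digits acc) (H := H)) => //.
- by move: wE; rewrite add1n card_sum !card_prod card_option !card_prod !card_ord.
- case=> [kib|[q [lb|]]].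
  + by apply: affine_comb_le (affine_comb_mem (with_digits acc) (inl kib)).
  + apply: (affine_comb_conv (affine_comb_add
      (affine_comb_mem (with_digits acc) (inr q)) (affine_comb_add
      (affine_comb_scale M (affine_comb_mem (with_digits acc) (inl (i, lb))))
      (affine_comb_cst _ (A := M) (c := - M) _)))) => //.
      by rewrite normrN ger0_norm.
    by rewrite mulr1 ger0_norm//; lra.
  + by apply: affine_comb_le (affine_comb_mem (with_digits acc) (inr q)).
- case=> [kib|q].
    apply: (affine_comb_conv (affine_comb_mem _ (inl kib : U))) => // p.
    by rewrite /= max0_id ?digit_is_ge0.
  rewrite /=; case: (sel q); last first.
    apply: (affine_comb_conv (affine_comb_mem _ (inr (q, None) : U))) => // p.
    by rewrite /= max0_id//; have /andP[] := accM q p.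
  apply: (affine_comb_conv (affine_comb_sum (index_enum ('I_D * 'I_b)%type) (P := predT)
    (fun lb _ => affine_comb_scale (c lb.1 * (lb.2)%:R)
      (affine_comb_mem _ (inr (q, Some lb) : U))))) => // [|p].
    apply: le_trans DbA.
    apply: (@le_trans _ _ (\sum_(lb : 'I_D * 'I_b) b%:R)).
      apply: ler_sum => lb _; have /andP[c0 c1] := c01 lb.1.
      rewrite mulr1 ger0_norm ?mulr_ge0// -[leRHS]mul1r; apply: ler_pM => //.
      by rewrite ler_nat ltnW.
    by rewrite sumr_const card_prod !card_ord -[leLHS]mulr_natl natrM expr2 mulrA.
  have /andP[a0 aM] := accM q p.
  rewrite -(pair_big xpredT xpredT (fun l be => c l * (be : 'I_b)%:R *
    Num.max (H (inr (q, Some (l, be))) p) 0))/= mulr_sumr.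
  apply: eq_bigr => l _; rewrite (bigD1 (e i l p))//= big1 ?addr0.
    by rewrite /H /digit_is/= eqxx mulr1 subrr addr0 max_l// mulrC.
  by move=> be /negbTE nbe; rewrite /H /digit_is/= eq_sym nbe mulr0 add0r max_r ?mulr0// subr_le0.
Qed.

End piecewise_polynomial.

(** * Networks for smooth functions and their compositions *)

Section polynomial_net.
Variables (R : realType) (d : nat) (X : Type) (x : X -> 'cV[R]_d).
Implicit Types (k w : nat) (A B M : R).

Lemma net_ext k w B (J : Type) (F G : J -> X -> R) :
  (forall j p, F j p = G j p) -> net x k w B F -> net x k w B G.
Proof. by move=> FG; rewrite (_ : F = G)//; apply/funext => j; apply/funext. Qed.

(** The identity is the difference of two ReLU units. Extra layers of this kind bring networks for
    different orders of smoothness to one common depth. *)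
Lemma net_delay k w m A B (f : X -> R) : 2 <= A -> 1 <= B -> (2 <= w)%N -> 
  net x k w B (fun _ : unit => f) -> net x (m + k) w ((2 * A) ^+ m * B) (fun _ : unit => f).
Proof.
move=> A2 B1 w2 netf; have A1 : 1 <= A by lra.
elim: m => [|m IH]; first by rewrite mul1r.
rewrite exprS -mulrA addSn.
have IH' : net x (m + k) w ((2 * A) ^+ m * B) (fun _ : unit => f) by [].
pose H (s : bool) p := (if s then 1 else -1) * f p.
apply: (net_relu (U := bool) (H := H) _ _ _ IH') => //.
- by rewrite -[1]mulr1; apply: ler_pM => //; apply: exprn_ege1; lra.
- by rewrite card_bool.
- move=> s; apply: affine_comb_le; last by apply: affine_comb_scale; exact: (affine_comb_mem _ tt).
  by rewrite mulr1; case: s; rewrite ?normrN normr1.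
- move=> _; apply: (affine_comb_conv (affine_comb_add (affine_comb_mem _ true)
    (affine_comb_scale (-1) (affine_comb_mem _ false)))) => [|p].
    by rewrite normrN normr1 mulr1.
  by rewrite /H mul1r /Num.max; do 2 case: ifPn; rewrite -?leNgt => h1 h2; lra.
Qed.

Variables (t D b r : nat).
Variable e : 'I_t -> 'I_D -> X -> 'I_b.
Local Notation dig := (digit_is R e).
Local Notation cells := {ffun 'I_t -> 'I_b}.

(** There is one accumulator for each node and each exponent vector, started at the table value. The
    schedule runs through all pairs [(i, m)] with [m < r]; the accumulators of exponent larger than
    [m] in coordinate [i] are multiplied by [u i], so each ends with its monomial. *)
Lemma net_polynomial k w A B M (pos : bool -> 'I_D) (NT : finType)
    (F : NT -> cells -> cells -> R) (pol : NT -> 'I_t -> {poly R}) (c : 'I_D -> R) :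
  let u i p := \sum_l c l * (e i l p)%:R in
  let AT := {ffun 'I_t -> 'I_r.+1} in
  1 <= A -> 1 <= B -> 0 <= M ->
  (forall q f g, 0 <= F q f g <= M) ->
  (forall nu i, (size (pol nu i) <= r.+1)%N) ->
  (forall l, 0 <= c l <= 1) -> (forall i p, 0 <= u i p <= 1) ->
  2 * t%:R + 1 <= A -> M * ((b ^ t)%:R + 2) <= A -> (b ^ t)%:R <= A ->
  1 + 2 * M <= A -> D%:R * b%:R ^+ 2 <= A ->
  \sum_(q : NT * AT) `|\prod_i (pol q.1 i)`_(q.2 i)| <= A ->
  (t * (D * b) + 2 * b ^ t <= w)%N ->
  (t * (D * b) + #|{: NT * AT}| * b ^ t <= w)%N ->
  (t * (D * b) + #|{: NT * AT}| * (1 + D * b) <= w)%N ->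
  net x k w B dig ->
  net x (t * r + 2 + k) w ((2 * A) ^+ (t * r + 3) * B)
    (fun _ : unit => fun p => \sum_nu
      F nu (cell e (pos false) p) (cell e (pos true) p) * \prod_i (pol nu i).[u i p]).
Proof.
move=> u AT A1 B1 M0 FM spol c01 u01 A2 A3 A4 A5 A6 A7 w1 w2 w3 net0.
pose Q : finType := (NT * AT)%type.
pose T (nu : NT) p := F nu (cell e (pos false) p) (cell e (pos true) p).
pose acc (P : seq ('I_t * 'I_r)) (q : Q) p :=
  T q.1 p * \prod_(im <- P) (if (im.2 < q.2 im.1)%N then u im.1 p else 1).
have B1' m : 1 <= (2 * A) ^+ m * B.
  by rewrite -[1]mulr1; apply: ler_pM => //; apply: exprn_ege1; lra.
have net2 : net x k.+2 w ((2 * A) ^+ 2 * B) (with_digits e (acc [::])).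
  have w1' : (t * (D * b) + b ^ t * 2 <= w)%N by rewrite [(b ^ t * 2)%N]mulnC.
  have B2 : 1 <= 2 * A * B by have := B1' 1%N; rewrite expr1.
  have net1 := net_cells pos A1 B1 A2 w1' net0.
  have := net_lookup (Q := Q) (F := fun q => F q.1) A1 B2 M0 (fun q => FM q.1) A3 A4 w2 net1.
  have -> : (2 * A) ^+ 2 * B = 2 * A * (2 * A * B) by rewrite expr2 -mulrA.
  move=> h; apply: net_ext h => -[kib|q] p //=.
  by rewrite /acc big_nil mulr1.
have accM P q p : 0 <= acc P q p <= M.
  rewrite /acc; have /andP[T0 TM] := FM q.1 (cell e (pos false) p) (cell e (pos true) p).
  have P01 : 0 <= \prod_(im <- P) (if (im.2 < q.2 im.1)%N then u im.1 p else 1) <= 1.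
    elim: P => [|im P /andP[p0 p1]]; rewrite ?big_nil ?ler01 ?lexx// big_cons.
    have /andP[u0 u1] : 0 <= (if (im.2 < q.2 im.1)%N then u im.1 p else 1) <= 1.
      by case: ifP => // _; rewrite ler01 lexx.
    by rewrite mulr_ge0//= mulr_ile1.
  have /andP[p0 p1] := P01.
  by rewrite mulr_ge0//= -[leRHS]mulr1 ler_pM.
have netP P : net x (size P + k.+2) w ((2 * A) ^+ (size P + 2) * B) (with_digits e (acc P)).
  elim: P => [|[i m] P IH]; first by rewrite !add0n.
  have := net_multiply (fun q : Q => (m < q.2 i)%N) i A1 (B1' _) M0 (accM P) c01 A5 A6 w3 IH.
  move=> h; rewrite (_ : size ((i, m) :: P) = (size P).+1)// !addSn exprS -[_ * _ * B]mulrA.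
  apply: net_ext h => -[kib|q] p //=.
  rewrite /acc big_cons /=; case: ifP => _; last by rewrite mul1r.
  by rewrite [_ * u i p]mulrC mulrCA mulrC.
pose P := enum {: 'I_t * 'I_r}.
have sP : size P = (t * r)%N by rewrite /P -cardT card_prod !card_ord.
have := netP P; rewrite sP => netf.
pose coef (q : Q) := \prod_i (pol q.1 i)`_(q.2 i).
have accE q p : acc P q p = T q.1 p * \prod_i u i p ^+ q.2 i.
  rewrite /acc; congr (_ * _); rewrite big_enum/=.
  rewrite -(pair_big xpredT xpredT (fun i (m : 'I_r) => if (m < q.2 i)%N then u i p else 1))/=.
  apply: eq_bigr => i _; rewrite -big_mkcond/=.
  have qr : (q.2 i <= r)%N by rewrite -ltnS.
  by rewrite (big_ord_narrow qr) prodr_const card_ord.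
have polE nu p : \prod_i (pol nu i).[u i p] =
    \sum_(a : AT) \prod_i (pol nu i)`_(a i) * \prod_i u i p ^+ a i.
  under eq_bigr => i _.
    rewrite (horner_coef_wide _ (spol nu i)); over.
  by rewrite bigA_distr_bigA; apply: eq_bigr => a _; rewrite big_split.
have out p : \sum_nu T nu p * \prod_i (pol nu i).[u i p] = \sum_q coef q * acc P q p.
  under eq_bigr => nu _ do rewrite polE mulr_sumr.
  rewrite pair_bigA; apply: eq_bigr => -[nu a] _ /=.
  by rewrite accE /coef /=; ring.
apply: (net_le (B := A * ((2 * A) ^+ (t * r + 2) * B) + A)).
  have -> : (t * r + 3 = (t * r + 2).+1)%N by rewrite addnS.
  rewrite exprS -mulrA; have := B1' (t * r + 2)%N; set BB := _ * B => BB1.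
  have : A <= A * BB by rewrite ler_peMr//; lra.
  by lra.
have -> : (t * r + 2 + k = t * r + k.+2)%N by rewrite -addnA add2n.
apply: (net_affine _ netf).
- by have := B1' (t * r + 2)%N; lra.
- move=> _; apply: (affine_comb_conv (affine_comb_sum (index_enum Q) (P := predT) (fun q _ =>
    affine_comb_scale (coef q) (affine_comb_mem (with_digits e (acc P)) (inr q))))) => [|p].
    by under eq_bigr do rewrite mulr1.
  by rewrite out.
- have := B1' (t * r + 2)%N; set BB := _ * B => BB1.
  have : BB <= A * BB by rewrite ler_peMl//; lra.
  by lra.
Qed.

End polynomial_net.

Section smooth_net.
Variable R : realType.

Lemma base_choice (t : nat) (Y : R) : (0 < t)%N -> 2 ^+ t <= Y ->
  exists b : nat, [/\ (1 < b)%N, (b ^ t)%:R <= Y & b%:R^-1 <= 2 * Y `^ (- t%:R^-1)].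
Proof.
move=> t0 tY; have Y0 : 0 < Y by apply: lt_le_trans tY; rewrite exprn_gt0.
have tR : 0 < t%:R :> R by rewrite ltr0n.
pose y := Y `^ t%:R^-1.
have y0 : 0 < y by exact: powR_gt0.
have yt : y ^+ t = Y.
  by rewrite -powR_mulrn ?(ltW y0)// -powRrM mulVf ?gt_eqF// powRr1 ?ltW.
have y2 : 2 <= y.
  rewrite leNgt; apply/negP => y2; move: tY; rewrite -yt leNgt => /negP; apply.
  by rewrite ltrXn2r ?ltW// -lt0n.
have /andP[b1 b2] := truncn_itv (ltW y0); set b := Num.truncn y in b1 b2.
have b2' : (1 < b)%N.
  by rewrite -ltnS -(ltr_nat R); apply: le_lt_trans b2.
exists b; split=> //.
  by rewrite natrX -yt lerXn2r ?nnegrE// ltW.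
have bR : 2 <= b%:R :> R by rewrite ler_nat.
rewrite powRN -/y -[2 in leRHS]invrK -invfM lef_pV2 ?posrE ?mulr_gt0 ?invr_gt0//; last by lra.
rewrite mulrC ler_pdivrMr//; move: b2; rewrite -natr1; lra.
Qed.

Lemma digit_sum (D b : nat) (ee : 'I_D -> nat) (z : nat -> R) (j : nat) :
  (0 < b)%N -> (forall l : 'I_D, b%:R * z l = (ee l)%:R + z l.+1) -> (j <= D)%N ->
  z 0%N = \sum_(l < D | (l < j)%N) (ee l)%:R / b%:R ^+ l.+1 + z j / b%:R ^+ j.
Proof.
move=> b0 zE; have bR : b%:R != 0 :> R by rewrite pnatr_eq0 -lt0n.
elim: j => [_|j IH jD]; first by rewrite big1 ?add0r ?divr1// => l; rewrite ltn0.
rewrite (IH (ltnW jD)) [in RHS](bigD1 (Ordinal jD))//=.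
rewrite [X in _ = _ + X + _](eq_bigl (fun l : 'I_D => (l < j)%N)); last first.
  move=> l; rewrite ltnS leq_eqVlt -val_eqE/=.
  by case: ltngtP => //=; rewrite ?andbT ?andbF.
rewrite addrAC addrC; congr (_ + _).
have -> : z j = ((ee (Ordinal jD))%:R + z j.+1) / b%:R by rewrite -zE mulrC mulKf.
by rewrite exprS; field; rewrite bR expf_neq0.
Qed.

(** [u] is the local coordinate in a cell of side [b^-2], truncated to the available digits so that
    [net_multiply] can use it: a digit of weight [b^-(l + 1)] has weight [b^-(l - 1)] relative to
    the cell. *)
Lemma digits_tail (D b : nat) (ee : 'I_D.+2 -> nat) (z : nat -> R) :
  (0 < b)%N -> (forall l : 'I_D.+2, b%:R * z l = (ee l)%:R + z l.+1) ->
  0 <= z 2%N <= 1 -> 0 <= z D.+2 ->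
  let u := \sum_(l < D.+2) (if (l < 2)%N then 0 else (b%:R ^+ l.-1)^-1) * (ee l)%:R in
  0 <= u <= 1 /\ z 0%N = (ee ord0)%:R / b%:R + (ee (lift ord0 ord0))%:R / b%:R ^+ 2 +
    b%:R ^- 2 * u + z D.+2 / b%:R ^+ D.+2.
Proof.
move=> b0 zE /andP[z20 z21] zD0 u.
have bR : 0 < b%:R :> R by rewrite ltr0n.
have b20 : 0 < b%:R ^+ 2 :> R by rewrite exprn_gt0.
have D2 : (2 <= D.+2)%N by [].
have head : \sum_(l < D.+2 | (l < 2)%N) (ee l)%:R / b%:R ^+ l.+1 =
    (ee ord0)%:R / b%:R + (ee (lift ord0 ord0))%:R / b%:R ^+ 2 :> R.
  rewrite (big_ord_narrow D2) !big_ord_recl big_ord0 addr0 /= expr1.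
  by congr (_%:R / _ + _%:R / _); congr ee; exact: val_inj.
have := digit_sum b0 zE (leqnn D.+2); rewrite (bigID (fun l : 'I_D.+2 => (l < 2)%N))/=.
rewrite (eq_bigl (fun l : 'I_D.+2 => (l < 2)%N)); last by move=> l; rewrite ltn_ord.
rewrite head.
have -> : \sum_(l < D.+2 | (l < D.+2)%N && ~~ (l < 2)%N) (ee l)%:R / b%:R ^+ l.+1 =
    b%:R ^- 2 * u.
  rewrite /u mulr_sumr big_mkcond; apply: eq_bigr => l _; rewrite ltn_ord/=.
  case: ltnP => l2 /=; first by rewrite mul0r mulr0.
  have -> : (l.+1 = 2 + l.-1)%N by case: (nat_of_ord l) l2.
  by rewrite exprD; field; rewrite !expf_neq0 ?gt_eqF.
move=> zS; split=> //.
have := digit_sum b0 zE D2; rewrite head zS => E.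
have u2 : b%:R ^- 2 * u <= b%:R ^- 2 * 1.
  rewrite [leRHS]mulrC; apply: (@le_trans _ _ (z 2%N / b%:R ^+ 2)).
    have : 0 <= z D.+2 / b%:R ^+ D.+2 by rewrite divr_ge0// exprn_ge0// ltW.
    by move: E; clear; lra.
  by rewrite ler_pM2r ?invr_gt0.
rewrite ler_pM2l ?invr_gt0// in u2; rewrite u2 andbT.
by apply: sumr_ge0 => l _; rewrite mulr_ge0//; case: ifP.
Qed.

(** The shift of the grid is known only once the data are, so cells and nodes may leave [[-K, K]]; a
    box independent of the shift contains them all, and [g] is defined and smooth there too. *)
Lemma node_in_box (K v0 y : R) (b : nat) (f0 f1 : 'I_b) : 0 < K -> (0 < b)%N ->
  - (5 * K) <= v0 <= - K -> 0 <= y <= 1 ->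
  - (5 * K) <= v0 + 4 * K * (f0%:R / b%:R + f1%:R / b%:R ^+ 2) + 4 * K / b%:R ^+ 2 * y <=
    5 * K.
Proof.
move=> K0 b0 /andP[v1 v2] /andP[y0 y1].
have bR : 0 < b%:R :> R by rewrite ltr0n.
have b20 : 0 < b%:R ^+ 2 :> R by rewrite exprn_gt0.
have digit_le (f : 'I_b) : f%:R <= b%:R - 1 :> R by rewrite lerBrDr natr1 ler_nat.
have -> : v0 + 4 * K * (f0%:R / b%:R + f1%:R / b%:R ^+ 2) + 4 * K / b%:R ^+ 2 * y =
    v0 + 4 * K * ((f0%:R * b%:R + f1%:R + y) / b%:R ^+ 2) by field; rewrite gt_eqF.
set q := _ / b%:R ^+ 2.
have q0 : 0 <= q by rewrite divr_ge0 ?addr_ge0 ?mulr_ge0// ltW.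
have q1 : q <= 1.
  rewrite ler_pdivrMr// mul1r; have := digit_le f0; have := digit_le f1.
  by move: (f0%:R : R) (f1%:R : R) => a1 a2 h1 h2; move: h1 h2 y1 bR; clear; nra.
move: K0 v1 v2 q0 q1; clear; move: q => q K0 v1 v2 q0 q1.
by apply/andP; split; nra.
Qed.

(** Two digits per coordinate give cells of side of order [Y^(- 2 / t)], so [h^beta] has exponent
    [- 2 beta / t], at most [- 2 gam]. The number [m] of digits makes the truncation error no larger
    in order. *)
Lemma base_rate (t b m : nat) (K Y beta gam : R) : (0 < t)%N -> 0 < K -> 1 <= Y ->
  0 <= beta -> gam * t%:R <= beta -> 2 * gam * t%:R <= m%:R ->
  b%:R^-1 <= 2 * Y `^ (- t%:R^-1) ->
  (4 * K / b%:R ^+ 2) `^ beta <= (4 * K) `^ beta * 2 `^ (2 * beta) * Y `^ (- (2 * gam)) /\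
  b%:R^-1 ^+ m <= 2 ^+ m * Y `^ (- (2 * gam)).
Proof.
move=> t0 K0 Y1 beta0 gamt gamm bY.
have tR : 0 < t%:R :> R by rewrite ltr0n.
have ib0 : 0 <= b%:R^-1 :> R by rewrite invr_ge0.
have Yt0 : 0 <= Y `^ (- t%:R^-1) by exact: powR_ge0.
have K40 : 0 <= 4 * K by lra.
have rate a : 2 * gam * t%:R <= a -> (Y `^ (- t%:R^-1)) `^ a <= Y `^ (- (2 * gam)).
  move=> ga; rewrite -powRrM; apply: ler_powR => //.
  by rewrite mulNr lerN2 [leRHS]mulrC ler_pdivlMr.
split.
  rewrite -exprVn powRM ?exprn_ge0// -mulrA ler_wpM2l ?powR_ge0// -powR_mulrn// -powRrM.
  apply: (@le_trans _ _ ((2 * Y `^ (- t%:R^-1)) `^ (2 * beta))).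
    by apply: ge0_ler_powR; rewrite ?nnegrE ?mulr_ge0.
  rewrite powRM// ler_wpM2l ?powR_ge0//; apply: rate.
  by move: gamt; clear; lra.
apply: (@le_trans _ _ ((2 * Y `^ (- t%:R^-1)) ^+ m)).
  by rewrite lerXn2r ?nnegrE ?mulr_ge0.
by rewrite exprMn ler_wpM2l ?exprn_ge0// -powR_mulrn//; exact: rate.
Qed.

Lemma grid_coordinates (n t b D : nat) (K : R) (V : 'I_t -> 'I_n -> R) :
  (1 < b)%N -> (0 < D)%N -> 0 < K -> (forall i p, `|V i p| <= K) ->
  exists (e : 'I_t -> 'I_D -> 'I_n -> 'I_b) (z : 'I_t -> nat -> 'I_n -> R) (v0 : 'I_t -> R),
  [/\ forall i (l : 'I_D) p, b%:R * z i l p = (e i l p)%:R + z i l.+1 p,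
    forall i l p, (l <= D)%N -> 0 <= z i l p <= 1 - (n.+1%:R * b%:R ^+ D)^-1,
    forall i p, V i p = v0 i + 4 * K * z i 0%N p,
    forall i, - (5 * K) <= v0 i <= - K &
    forall i, exists2 a, `|a| <= 2 & forall p, z i 0%N p = (4 * K)^-1 * V i p + a].
Proof.
move=> b1 D0 K0 VK.
have bR : 1 <= b%:R :> R by rewrite ler1n ltnW.
have bD1 : 1 <= b%:R ^+ D :> R by exact: exprn_ege1.
have bD0 : 0 < b%:R ^+ D :> R by apply: lt_le_trans bD1.
have /choice[S0 S0P] : forall i, exists sez : R * ('I_D -> 'I_n -> 'I_b) * (nat -> 'I_n -> R),
  [/\ 0 <= sez.1.1 < 1,
    forall p, sez.2 0%N p = (V i p + K) / (4 * K) + sez.1.1 / b%:R ^+ D,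
    forall (j : 'I_D) p, b%:R * sez.2 j p = (sez.1.2 j p)%:R + sez.2 j.+1 p &
    forall j p, (j <= D)%N -> 0 <= sez.2 j p <= 1 - (n.+1%:R * b%:R ^+ D)^-1].
  move=> i; have [s [e [z H]]] := digit_expansion b1 D0 K0 (VK i).
  by exists (s, e, z).
have sb i : 0 <= (S0 i).1.1 / b%:R ^+ D <= 1.
  have [/andP[s0 s1] _ _ _] := S0P i.
  rewrite divr_ge0 ?(ltW bD0)//= ler_pdivrMr// mul1r.
  exact: le_trans (ltW s1) bD1.
exists (fun i => (S0 i).1.2), (fun i => (S0 i).2).
exists (fun i => - K - 4 * K * ((S0 i).1.1 / b%:R ^+ D)); split.
- by move=> i; have [] := S0P i.
- by move=> i l p; have [_ _ _] := S0P i; exact.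
- by move=> i p; have [_ -> _ _] := S0P i; field; rewrite !gt_eqF.
- move=> i; move: (sb i); set q := _ / _ => /andP[q0 q1].
  by move: K0 q0 q1; clear; move: q => q K0 q0 q1; apply/andP; split; nra.
- move=> i; exists (K / (4 * K) + (S0 i).1.1 / b%:R ^+ D).
    have -> : K / (4 * K) = 4^-1 :> R by field; rewrite gt_eqF.
    move: (sb i); set q := _ / _ => /andP[q0 q1].
    by move: q0 q1; clear; move: q => q q0 q1; rewrite ger0_norm; lra.
  by move=> p; have [_ -> _ _] := S0P i; field; rewrite !gt_eqF.
Qed.

End smooth_net.

Lemma gadget_widths (t tM D b bt Q q : nat) : (t <= tM)%N -> (0 < b <= bt)%N -> (q <= Q)%N ->
  let w := ((tM * (D + 5) + Q * (D + 1) + 2) * bt)%N in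
  [/\ t * (1 + D * b + b.+1 * 2) <= w, t * (D * b) + 2 * bt <= w,
     t * (D * b) + q * bt <= w & t * (D * b) + q * (1 + D * b) <= w]%N.
Proof.
move=> ttM /andP[b0 bbt] qQ w.
have Db : (D * b <= D * bt)%N by rewrite leq_mul2l bbt orbT.
have bt0 : (0 < bt)%N := leq_trans b0 bbt.
have tDb : (t * (D * b) <= tM * (D * bt))%N by exact: leq_mul.
have h1 : (1 + D * b + b.+1 * 2 <= (D + 5) * bt)%N by lia.
have h2 : (1 + D * b <= (D + 1) * bt)%N by lia.
have wE : w = (tM * (D * bt) + tM * (5 * bt) + Q * ((D + 1) * bt) + 2 * bt)%N.
  by rewrite /w; lia.
split.
- by apply: leq_trans (leq_mul ttM h1) _; rewrite wE; lia.
- by rewrite wE; lia.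
- have : (q * bt <= Q * ((D + 1) * bt))%N by apply: leq_mul; lia.
  by rewrite wE; lia.
- by have := leq_mul qQ h2; rewrite wE; lia.
Qed.

Section smooth_net.
Variable R : realType.

(** [Cst] and [A0] may depend on [g], but depth, width factor and weight exponent involve only the
    uniform bounds [tM], [rM], [Dn]. The inputs [V] are themselves network outputs, so that
    compositions can be formed. *)
Lemma smooth_net (t tM rM Dn : nat) (beta C K gam : R) (g : 'cV[R]_t -> R) :
  (0 < t)%N -> (t <= tM)%N -> 1 <= beta -> beta <= rM%:R -> 0 <= C ->
  holder_smooth beta C g -> 0 < K -> 0 <= gam -> gam * t%:R <= beta ->
  2 * gam * t%:R <= Dn%:R ->
  let DD := Dn.+2 in
  let cw := (tM * (DD + 5) + rM.+1 ^ (2 * tM) * (DD + 1) + 2)%N in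
  exists Cst A0 : R, [/\ 0 <= Cst, 1 <= A0 &
  forall (n d : nat) (x : 'I_n -> 'cV[R]_d) (V : 'I_t -> 'I_n -> R) (Y A B : R) (w k : nat),
    (forall i p, `|V i p| <= K) -> 2 ^+ tM <= Y -> cw%:R * Y <= w%:R ->
    A0 * (n.+1%:R * Y ^+ (DD + 2)) <= A -> 1 <= B -> net x k w B V ->
    exists f : 'I_n -> R,
      net x (tM * rM + 2 + DD + k) w ((2 * A) ^+ (DD + tM * rM + 5) * B) (fun _ : unit => f) /\
      forall p, `|f p - g (\col_i V i p)| <= Cst * Y `^ (- (2 * gam))].
Proof.
move=> t0 ttM beta1 betaM C0 hg K0 gam0 gamt DnE DD cw.
have [r [lag [NT [c [Kt [L [[r0 rbeta] [cNT slag] Kt0 [L0 lagL] [PU interp]]]]]]]] :=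
  holder_smooth_interpolation beta1 C0 hg.
have rrM : (r <= rM)%N by rewrite -(ler_nat R); apply: le_trans betaM.
have K50 : 0 < 5 * K by lra.
have [M1 gM1] := holder_smooth_bounded beta1 C0 hg K50.
have [Lam [Lam0 gLam]] := holder_smooth_lip beta1 C0 hg K50.
pose M0 := Num.max M1 0.
have M00 : 0 <= M0 by rewrite le_max lexx orbT.
have gM0 y : in_box (5 * K) y -> - M0 <= g y <= M0.
  by move=> yK; rewrite -ler_norml; apply: le_trans (gM1 y yK) _; rewrite le_max lexx.
pose AT := {ffun 'I_t -> 'I_r.+1}.
pose Cpol := \sum_(q : NT * AT) `|\prod_i (lag (c q.1 i))`_(q.2 i)|.
have Cpol0 : 0 <= Cpol by exact: sumr_ge0.
(* One summand for each demand on the weights: rescaling the input, digit extraction, cells, lookup,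
   multiplication, the final polynomial and the final shift. *)
pose A0 := (4 * K)^-1 + 7 + (2 * t%:R + 1) + 3 * (2 * M0) + (1 + 2 * (2 * M0)) +
  DD%:R + Cpol + M0.
have iK0 : 0 < (4 * K)^-1 by rewrite invr_gt0; lra.
have t00 : 0 <= t%:R :> R by [].
have DD0 : 0 <= DD%:R :> R by [].
have [A0K A07 A0t A0M] : [/\ (4 * K)^-1 <= A0, 7 <= A0, 2 * t%:R + 1 <= A0 &
    3 * (2 * M0) <= A0].
  by rewrite /A0; move: iK0 t00 DD0 M00 Cpol0; clear; move=> *; split; lra.
have [A0M' A0D A0C A0M''] : [/\ 1 + 2 * (2 * M0) <= A0, DD%:R <= A0, Cpol <= A0 & M0 <= A0].
  by rewrite /A0; move: iK0 t00 DD0 M00 Cpol0; clear; move=> *; split; lra.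
(* The interpolation error, plus the effect on [g] of cutting off the digits. *)
pose Cst := Kt * ((4 * K) `^ beta * 2 `^ (2 * beta)) + Lam * (4 * K * 2 ^+ DD).
exists Cst, A0; split.
- have K40 : 0 <= 4 * K by lra.
  by apply: addr_ge0; apply: mulr_ge0 => //; apply: mulr_ge0 => //; exact: powR_ge0.
- by apply: le_trans A07; rewrite ler1n.
move=> n d x V Y A B w k VK YtM wY AE B1 netV.
have Yt : 2 ^+ t <= Y by apply: le_trans YtM; rewrite ler_eXn2l// ltr1n.
have [b [b1 btY bY]] := base_choice t0 Yt.
have b0 : (0 < b)%N by apply: leq_trans b1.
have bR : 1 <= b%:R :> R by rewrite ler1n.
have bR0 : 0 < b%:R :> R by rewrite ltr0n.
have Y1 : 1 <= Y by apply: le_trans Yt; rewrite exprn_ege1// ler1n.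
have bbt : (b <= b ^ t)%N by rewrite -[leqLHS]expn1 leq_pexp2l.
have bY1 : b%:R <= Y by apply: le_trans btY; rewrite ler_nat.
have Y00 : 0 <= Y by apply: le_trans Y1.
have n1 : 1 <= n.+1%:R :> R by rewrite ler1n.
have Yle m : (m <= DD + 2)%N -> Y ^+ m <= n.+1%:R * Y ^+ (DD + 2).
  move=> mD; rewrite -[leLHS]mul1r; apply: ler_pM => //; first exact: exprn_ge0.
  by rewrite ler_weXn2l.
(* [Z] dominates the steepest weight, of order [b^2 / dl] with [dl^-1 = n.+1 * b^DD]. *)
set Z := n.+1%:R * Y ^+ (DD + 2) in AE Yle.
have Z1 : 1 <= Z by rewrite -[1](expr0 Y); exact: Yle.
have Z0 : 0 <= Z by exact: le_trans Z1.
have ZY : Y <= Z by rewrite -[leLHS]expr1; apply: Yle; rewrite addnS.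
have ZY2 : Y ^+ 2 <= Z by apply: Yle; rewrite addn2.
have A0Z a y : 0 <= a -> a <= A0 -> 0 <= y -> y <= Z -> a * y <= A.
  by move=> a0 aA y0 yZ; apply: le_trans AE; exact: ler_pM.
have A0le a : 0 <= a -> a <= A0 -> a <= A.
  by move=> a0 aA; rewrite -[a]mulr1; exact: A0Z.
have A1 : 1 <= A by apply: A0le => //; apply: le_trans A07; rewrite ler1n.
have A2 : 2 <= A by apply: A0le => //; apply: le_trans A07; rewrite ler_nat.
have AX1 m y : 1 <= y -> 1 <= (2 * A) ^+ m * y.
  move=> y1; rewrite -[1]mulr1; apply: ler_pM => //; apply: exprn_ege1.
  by move: A1; clear; lra.
have [e [z [v0 [zE z01 VE v0K zV]]]] := grid_coordinates (D := DD) b1 isT K0 VK.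
pose dl : R := (n.+1%:R * b%:R ^+ DD)^-1.
have bD1 m : 1 <= b%:R ^+ m :> R by exact: exprn_ege1.
have dl01 : 0 < dl <= 1.
  have nb : 1 <= n.+1%:R * b%:R ^+ DD :> R by rewrite mulr_ege1.
  have nb0 : 0 < n.+1%:R * b%:R ^+ DD :> R by apply: lt_le_trans nb.
  by rewrite invr_gt0 nb0 invf_le1.
have zle1 i l p : (l <= DD)%N -> 0 <= z i l p <= 1.
  move=> lD; have /andP[-> /= h] := z01 i l p lD; apply: le_trans h _.
  by have /andP[d0 _] := dl01; rewrite lerBlDr lerDl ltW.
have wn a : (a <= cw * b ^ t)%N -> (a <= w)%N.
  move=> h; rewrite -(ler_nat R); apply: le_trans wY.
  apply: (@le_trans _ _ (cw * b ^ t)%:R); first by rewrite ler_nat.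
  by rewrite natrM ler_wpM2l.
have cQ : (#|{: NT * AT}| <= rM.+1 ^ (2 * tM))%N.
  rewrite card_prod card_ffun !card_ord mul2n -addnn expnD.
  have h : (r.+1 ^ t <= rM.+1 ^ tM)%N.
    by apply: (@leq_trans (rM.+1 ^ t)); [rewrite leq_exp2r|rewrite leq_pexp2l].
  by apply: leq_mul => //; exact: leq_trans h.
have bb : (0 < b <= b ^ t)%N by rewrite b0.
have [w1 w2 w3 w4] := gadget_widths DD ttM bb cQ.
have netdig : net x (DD + k) w ((2 * A) ^+ DD.+1 * B) (digit_is R e).
  apply: (net_digits (z := z) (dl := dl) A1 B1 dl01 zE z01 _ _ netV).
  - have h1 : 4 * b%:R ^+ 2 / dl <= 4 * Z.
      rewrite /dl /Z invrK -mulrA ler_pM2l// mulrCA ler_wpM2l// -exprD addnC.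
      by rewrite lerXn2r ?nnegrE.
    have h2 : 7 * Z <= A by exact: A0Z.
    by move: h1 h2 ZY bY1 Z1; clear; lra.
  - exact: wn.
  - move=> i; have [a a2 zi] := zV i.
    exists [:: (i, (4 * K)^-1)], a; split.
    + by rewrite big_seq1/= gtr0_norm//; apply: A0le => //; exact: ltW.
    + exact: le_trans a2 A2.
    + by move=> p; rewrite big_seq1.
pose pos (c : bool) : 'I_DD := if c then lift ord0 ord0 else ord0.
pose h := 4 * K / b%:R ^+ 2.
have h0 : 0 < h by rewrite divr_gt0 ?exprn_gt0// mulr_gt0.
pose corner (f0 f1 : {ffun 'I_t -> 'I_b}) : 'cV[R]_t :=
  \col_i (v0 i + 4 * K * ((f0 i)%:R / b%:R + (f1 i)%:R / b%:R ^+ 2)).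
pose node nu f0 f1 : 'cV[R]_t :=
  \col_i (corner f0 f1 i 0 + h * ((c nu i)%:R / r%:R)).
have r0R : 0 < r%:R :> R by rewrite ltr0n.
have nodeK nu f0 f1 : in_box (5 * K) (node nu f0 f1).
  move=> i; rewrite /node /corner !mxE; apply: node_in_box => //.
  by rewrite divr_ge0//= ler_pdivrMr// mul1r ler_nat -ltnS.
(* The gates require table entries that are nonnegative and bounded; [M0] is subtracted again in
   [f], the interpolation weights having sum 1. *)
pose F nu f0 f1 := g (node nu f0 f1) + M0.
have FM nu f0 f1 : 0 <= F nu f0 f1 <= 2 * M0.
  have /andP[g1 g2] := gM0 _ (nodeK nu f0 f1).
  by rewrite /F; move: g1 g2; clear; move=> g1 g2; apply/andP; split; lra.
pose cl (l : 'I_DD) : R := if (l < 2)%N then 0 else (b%:R ^+ l.-1)^-1.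
have cl01 l : 0 <= cl l <= 1.
  rewrite /cl; case: ifP => _; first by rewrite lexx ler01.
  have bl0 : 0 < b%:R ^+ l.-1 :> R by rewrite exprn_gt0.
  by rewrite invr_ge0 ltW//= invf_le1.
pose u i p := \sum_l cl l * (e i l p)%:R.
have tail i p : 0 <= u i p <= 1 /\ z i 0%N p = (e i ord0 p)%:R / b%:R +
    (e i (lift ord0 ord0) p)%:R / b%:R ^+ 2 + b%:R ^- 2 * u i p + z i DD p / b%:R ^+ DD.
  apply: (@digits_tail R Dn b (fun l => e i l p) (fun l => z i l p)) => //.
    exact: zle1.
  by have /andP[] := zle1 i DD p (leqnn _).
have u01 i p : 0 <= u i p <= 1 by have [] := tail i p.
pose I p := \sum_nu F nu (cell e (pos false) p) (cell e (pos true) p) *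
   \prod_i (lag (c nu i)).[u i p].
have netpol : net x (t * r + 2 + (DD + k)) w
    ((2 * A) ^+ (t * r + 3) * ((2 * A) ^+ DD.+1 * B)) (fun _ : unit => I).
  apply: (@net_polynomial R d _ x t DD b r e (DD + k)%N w A _ (2 * M0) pos NT F
    (fun nu i => lag (c nu i)) cl A1 (AX1 _ _ B1) _ FM (fun nu i => slag (c nu i)) cl01 u01) => //.
  - exact: mulr_ge0.
  - by apply: A0le => //; rewrite addr_ge0// mulr_ge0.
  - have h1 : 2 * M0 * (b ^ t)%:R <= 2 * M0 * Z.
      by rewrite ler_wpM2l ?mulr_ge0//; exact: le_trans ZY.
    have h2 : 2 * M0 <= 2 * M0 * Z by rewrite ler_peMr// mulr_ge0.
    have h3 : 3 * (2 * M0) * Z <= A by apply: A0Z => //; rewrite mulr_ge0// mulr_ge0.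
    by move: h1 h2 h3; clear; lra.
  - apply: le_trans btY _; apply: le_trans ZY _.
    by rewrite -[leLHS]mul1r; apply: A0Z => //; apply: le_trans A07; rewrite ler1n.
  - by apply: A0le => //; rewrite addr_ge0// !mulr_ge0.
  - apply: A0Z => //; by apply: le_trans ZY2; rewrite lerXn2r ?nnegrE.
  - exact: A0le.
  - exact: wn.
  - exact: wn.
  - exact: wn.
pose f p := I p - M0.
set B3 := (2 * A) ^+ (t * r + 3) * _ in netpol.
have B31 : 1 <= B3 by exact/AX1/AX1.
have netf : net x (t * r + 2 + (DD + k)) w (2 * A * B3) (fun _ : unit => f).
  have h1 : net x (t * r + 2 + (DD + k)) w (A * B3 + A) (fun _ : unit => f).
    apply: (net_affine _ netpol); first exact: le_trans B31.
      move=> _; exists [:: (tt, 1)], (- M0); split.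
      - by rewrite big_seq1 normr1.
      - by rewrite normrN ger0_norm//; exact: A0le.
      - by move=> p; rewrite big_seq1 mul1r.
    have : B3 <= A * B3 by rewrite ler_peMl//; exact: le_trans B31.
    by move: A1; clear; lra.
  apply: net_le h1.
  have : A <= A * B3 by rewrite ler_peMr//; exact: le_trans A1.
  by clear; lra.
have B41 : 1 <= 2 * A * B3 by rewrite -[2 * A]expr1; exact: AX1.
have w22 : (2 <= w)%N.
  by apply: wn; rewrite /cw; move: bb => /andP[]; clear; nia.
exists f; split.
  (* Idle layers make up for the [tM * rM - t * r] multiplications that this [g] does not use. *)
  have := net_delay (tM * rM - t * r) A2 B41 w22 netf.
  have trM : (t * r <= tM * rM)%N by exact: leq_mul.
  have -> : (2 * A) ^+ (tM * rM - t * r) * (2 * A * B3) = (2 * A) ^+ (DD + tM * rM + 5) * B.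
    have -> : (DD + tM * rM + 5 = tM * rM - t * r + (1 + ((t * r + 3) + DD.+1)))%N.
      by move: trM; clear; lia.
    by rewrite /B3; move: (2 * A) => a; rewrite !exprD expr1 -!mulrA.
  by have -> : (tM * rM - t * r + (t * r + 2 + (DD + k)) = tM * rM + 2 + DD + k)%N
    by move: trM; clear; lia.
move=> p.
pose zc := corner (cell e (pos false) p) (cell e (pos true) p).
have b20 : b%:R != 0 :> R by rewrite gt_eqF.
have xtE i : zc i 0 + h * u i p = v0 i + 4 * K * (z i 0%N p - z i DD p / b%:R ^+ DD).
  have -> : h * u i p = 4 * K * (b%:R ^- 2 * u i p) by rewrite /h; field.
  by have [_ ->] := tail i p; rewrite /zc /corner mxE !ffunE; ring.
have zD i : 0 <= z i DD p / b%:R ^+ DD <= b%:R^-1 ^+ DD.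
  have /andP[a3 a4] := zle1 i DD p (leqnn _).
  rewrite divr_ge0 ?exprn_ge0//= exprVn -[leRHS]mul1r ler_pM2r// invr_gt0.
  exact: exprn_gt0.
have K40 : 0 <= 4 * K by rewrite mulr_ge0// ltW.
(* The point given by all the digits: the network interpolates [g] at [xt] instead of at the true
   input, and the Lipschitz bound covers the difference. *)
pose xt : 'cV[R]_t := \col_i (zc i 0 + h * u i p).
have xtK : in_box (5 * K) xt.
  by move=> i; rewrite mxE /zc /corner mxE; exact: node_in_box.
have VKb : in_box (5 * K) (\col_i V i p).
  move=> i; rewrite mxE; have := VK i p; rewrite ler_norml; move: K0; clear.
  by move=> K0 /andP[h1 h2]; apply/andP; lra.
have fE : f p = \sum_nu g (\col_i (zc i 0 + h * ((c nu i)%:R / r%:R))) *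
    \prod_i (lag (c nu i)).[u i p].
  rewrite /f /I /F; under eq_bigr do rewrite mulrDl.
  by rewrite big_split/= -mulr_sumr PU// mulr1 addrK.
have e1 : `|f p - g xt| <= Kt * h `^ beta.
  by rewrite fE distrC; exact: interp.
have e2 : `|g xt - g (\col_i V i p)| <= Lam * (4 * K * b%:R^-1 ^+ DD).
  apply: gLam => //.
    by rewrite mulr_ge0// exprn_ge0// invr_ge0.
  move=> i; rewrite [xt i 0]mxE [X in _ - X]mxE xtE VE.
  have -> : v0 i + 4 * K * (z i 0%N p - z i DD p / b%:R ^+ DD) -
      (v0 i + 4 * K * z i 0%N p) = - (4 * K * (z i DD p / b%:R ^+ DD)) by ring.
  have /andP[q0 q1] := zD i.
  have q2 : 0 <= 4 * K * (z i DD p / b%:R ^+ DD) by exact: mulr_ge0.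
  by rewrite normrN ger0_norm// ler_wpM2l.
have beta0 : 0 <= beta by exact: le_trans beta1.
have DnE' : 2 * gam * t%:R <= DD%:R.
  by apply: le_trans DnE _; rewrite ler_nat /DD -addn2 leq_addr.
have [hb bD] := base_rate t0 K0 Y1 beta0 gamt DnE' bY.
rewrite -[f p - _](subrKA (g xt)); apply: le_trans (ler_normD _ _) _.
rewrite /Cst mulrDl; apply: lerD.
  by apply: le_trans e1 _; rewrite -mulrA ler_wpM2l.
apply: le_trans e2 _; rewrite -[leRHS]mulrA; apply: ler_wpM2l => //.
by rewrite -[leRHS]mulrA; exact: ler_wpM2l.
Qed.

End smooth_net.

(** * Hierarchical compositions *)

Section hierarchical_net.
Variable R : realType.

Definition bounded_class (PP : set (R * nat)) (gam : R) (tM rM : nat) : Prop :=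
  forall bt, PP bt -> [/\ 1 <= bt.1, (0 < bt.2)%N, bt.1 <= rM%:R, (bt.2 <= tM)%N &
    gam * bt.2%:R <= bt.1].

(** Induction on the level: the inner networks run in parallel on equal shares of the width and feed
    the network of the outer function, whose Lipschitz constant multiplies their errors. *)
Lemma hclass_net (PP : set (R * nat)) (gam : R) (tM rM Dn : nat) (C : R) (d l : nat) :
  0 < C -> 0 <= gam -> bounded_class PP gam tM rM -> 2 * gam * tM%:R <= Dn%:R ->
  (0 < tM)%N ->
  let cw := (tM * (Dn.+2 + 5) + rM.+1 ^ (2 * tM) * (Dn.+2 + 1) + 2)%N in
  forall (f : 'cV[R]_d -> R) (K : R), hclass C PP l.+1 f -> 0 < K ->
  exists Cst A0 M : R, [/\ 0 <= Cst, 1 <= A0, forall y, in_box K y -> `|f y| <= M &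
  forall (n : nat) (x : 'I_n -> 'cV[R]_d) (Y A : R) (N : nat),
    (forall p, in_box K (x p)) -> 2 ^+ tM <= Y ->
    ((2 * tM) ^ l * cw)%:R * Y <= N%:R ->
    A0 * (n.+1%:R * Y ^+ (Dn.+2 + 2)) <= A ->
    exists2 phi : 'I_n -> R,
      net x (l.+1 * (tM * rM + 2 + Dn.+2)) N ((2 * A) ^+ (l.+1 * (Dn.+2 + tM * rM + 5)))
        (fun _ : unit => phi) &
      forall p, `|phi p - f (x p)| <= Cst * Y `^ (- (2 * gam))].
Proof.
move=> C0 gam0 PPb DnE tM0 cw.
have DnE' t : (t <= tM)%N -> 2 * gam * t%:R <= Dn%:R.
  by move=> tt; apply: le_trans DnE; rewrite ler_wpM2l ?mulr_ge0// ler_nat.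
elim: l => [|l IH] f K.
  move=> [J [beta [g [PPg hg fE]]]] K0.
  have [beta1 t0 betaM ttM gamt] := PPb _ PPg; rewrite /= in beta1 t0 betaM ttM gamt.
  have [M gM] := holder_smooth_bounded beta1 (ltW C0) hg K0.
  have [Cst [A0 [Cst0 A01 H]]] := smooth_net (rM := rM) (Dn := Dn) t0 ttM beta1 betaM (ltW C0) hg K0 gam0 gamt
    (DnE' _ ttM).
  exists Cst, A0, M; split=> //.
    by move=> y yK; rewrite fE; apply: gM => i; rewrite mxE; exact: yK.
  move=> n x Y A N xK YtM NY AE.
  pose V (i : 'I_#|J|) (p : 'I_n) := x p (enum_val i) 0.
  have [||||phi [netphi phiE]] := H n d x V Y A 1 N 0%N _ YtM _ AE.
  - by move=> i p; rewrite ler_norml; exact: xK.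
  - by move: NY; rewrite expn0 mul1n.
  - by [].
  - move=> i; exists (fun j => (j == enum_val i)%:R), 0; split.
    + by move=> j; case: eqP => _; rewrite ?normr1 ?normr0.
    + by rewrite normr0.
    + move=> p; rewrite addr0 (bigD1 (enum_val i))//= eqxx mul1r big1 ?addr0//.
      by move=> j /negbTE ->; rewrite mul0r.
  exists phi; first by rewrite mulr1 addn0 in netphi; rewrite !mul1n.
  by move=> p; rewrite fE; exact: phiE.
move=> [t [beta [g [ff [PPg hg hff fE]]]]] K0.
have [beta1 t0 betaM ttM gamt] := PPb _ PPg; rewrite /= in beta1 t0 betaM ttM gamt.
have /choice[cj cjP] : forall j, exists c : R * R * R,
    [/\ 0 <= c.1.1, 1 <= c.1.2, forall y, in_box K y -> `|ff j y| <= c.2 &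
  forall (n : nat) (x : 'I_n -> 'cV[R]_d) (Y A : R) (N : nat),
    (forall p, in_box K (x p)) -> 2 ^+ tM <= Y ->
    ((2 * tM) ^ l * cw)%:R * Y <= N%:R ->
    c.1.2 * (n.+1%:R * Y ^+ (Dn.+2 + 2)) <= A ->
    exists2 phi : 'I_n -> R,
      net x (l.+1 * (tM * rM + 2 + Dn.+2)) N ((2 * A) ^+ (l.+1 * (Dn.+2 + tM * rM + 5)))
        (fun _ : unit => phi) &
      forall p, `|phi p - ff j (x p)| <= c.1.1 * Y `^ (- (2 * gam))].
  move=> j; have [Cst [A0 [M H]]] := IH _ _ (hff j) K0.
  by exists (Cst, A0, M).
pose Cs := \sum_j (cj j).1.1; pose As := \sum_j (cj j).1.2; pose Ms := \sum_j `|(cj j).2|.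
have Cs0 : 0 <= Cs by apply: sumr_ge0 => j _; have [] := cjP j.
have Ms0 : 0 <= Ms by exact: sumr_ge0.
have le_sum (F : 'I_t -> R) j : (forall i, 0 <= F i) -> F j <= \sum_i F i.
  by move=> F0; rewrite (bigD1 j)//= lerDl; exact: sumr_ge0.
have CsE j : (cj j).1.1 <= Cs by apply: le_sum => i; have [] := cjP i.
have As0 : 0 <= As by apply: sumr_ge0 => j _; have [_ h _ _] := cjP j; exact: le_trans h.
have AsE j : (cj j).1.2 <= As by apply: le_sum => i; have [_ h _ _] := cjP i; exact: le_trans h.
have MsE j : (cj j).2 <= Ms.
  by apply: le_trans (ler_norm _) _; apply: (le_sum (fun j => `|(cj j).2|)).
(* A box for the inner values and for their approximations alike: the inner errors are at most [Cs],
   because [Y^(- 2 gam) <= 1]. *)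
pose K' := Ms + Cs + 1.
have K'0 : 0 < K' by rewrite ltr_wpDl// addr_ge0.
have [M gM] := holder_smooth_bounded beta1 (ltW C0) hg K'0.
have [Lam [Lam0 gLam]] := holder_smooth_lip beta1 (ltW C0) hg K'0.
have [Cst [A0 [Cst0 A01 H]]] := smooth_net (rM := rM) (Dn := Dn) t0 ttM beta1 betaM (ltW C0) hg K'0 gam0 gamt
  (DnE' _ ttM).
have boxff y : in_box K y -> in_box K' (\col_j ff j y).
  move=> yK j; rewrite mxE -ler_norml; have [_ _ h _] := cjP j.
  apply: le_trans (h y yK) _; apply: le_trans (MsE j) _.
  by rewrite /K'; move: Cs0; clear; lra.
exists (Cst + Lam * Cs), (A0 + As), M; split.
- by rewrite addr_ge0// mulr_ge0.
- by apply: le_trans A01 _; rewrite lerDl.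
- by move=> y yK; rewrite fE; exact/gM/boxff.
move=> n x Y A N xK YtM NY AE.
have Y1 : 1 <= Y by apply: le_trans YtM; rewrite exprn_ege1// ler1n.
have Z0 : 0 <= n.+1%:R * Y ^+ (Dn.+2 + 2).
  by rewrite mulr_ge0// exprn_ge0//; exact: le_trans Y1.
have AE0 : A0 * (n.+1%:R * Y ^+ (Dn.+2 + 2)) <= A.
  by apply: le_trans AE; rewrite ler_wpM2r// lerDl.
have A1 : 1 <= A.
  have YD : 1 <= Y ^+ (Dn.+2 + 2) by exact: exprn_ege1.
  apply: le_trans AE0; apply: mulr_ege1 => //; apply: mulr_ege1 => //.
  by rewrite ler1n.
(* The share of one inner network. Rounding it down is paid by the factor 2 in [(2 * tM) ^ l]. *)
pose N' := (N %/ tM)%N.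
have N'Y : ((2 * tM) ^ l * cw)%:R * Y <= N'%:R.
  set W := ((2 * tM) ^ l * cw)%N in NY *.
  have W1 : (1 <= W)%N by rewrite muln_gt0 expn_gt0 !muln_gt0 tM0 /cw addn_gt0 orbT.
  have tMR : 0 < tM%:R :> R by rewrite ltr0n.
  have NN : N%:R < tM%:R * N'.+1%:R :> R.
    by rewrite -natrM ltr_nat mulnC -ltn_divLR.
  have WY : 1 <= W%:R * Y by rewrite mulr_ege1// ler1n.
  have h1 : tM%:R * (2 * W%:R) * Y <= N%:R by move: NY; rewrite expnS -mulnA -/W !natrM; lra.
  have h2 : tM%:R * (2 * W%:R * Y) < tM%:R * N'.+1%:R.
    by rewrite mulrA; exact: le_lt_trans h1 NN.
  move: h2; rewrite ltr_pM2l// -natr1; move: WY; clear; lra.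
have eps0 : 0 <= Y `^ (- (2 * gam)) by exact: powR_ge0.
have eps1 : Y `^ (- (2 * gam)) <= 1.
  rewrite -[leRHS](powRr0 Y); apply: ler_powR => //.
  by rewrite oppr_le0 mulr_ge0.
have /choice[V VP] : forall j, exists phi : 'I_n -> R,
    net x (l.+1 * (tM * rM + 2 + Dn.+2)) N' ((2 * A) ^+ (l.+1 * (Dn.+2 + tM * rM + 5)))
        (fun _ : unit => phi) /\
      forall p, `|phi p - ff j (x p)| <= (cj j).1.1 * Y `^ (- (2 * gam)).
  move=> j; have [_ _ _ h] := cjP j; have [|phi ? ?] := h n x Y A N' xK YtM N'Y; last by exists phi.
  by apply: le_trans AE; rewrite ler_wpM2r//; apply: le_trans (AsE j) _; rewrite lerDr (le_trans _ A01).
set B := (2 * A) ^+ (l.+1 * _) in VP.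
have B1 : 1 <= B by apply: exprn_ege1; move: A1; clear; lra.
have netV : net x (l.+1 * (tM * rM + 2 + Dn.+2)) N B V.
  have tN : (#|'I_t| * N' <= N)%N.
    rewrite card_ord; apply: leq_trans (leq_divM N tM); rewrite mulnC.
    exact: leq_mul.
  have := @net_parallel R d 'I_n x _ N' N B 'I_t unit (fun j _ => V j)
    (le_trans ler01 B1) tN (fun j => (VP j).1).
  apply: net_reindex; first exact: le_trans B1.
  by move=> j; left; exists (j, tt).
have VK j p : `|V j p| <= K'.
  have [_ _ h _] := cjP j; have [_ /(_ p) e] := VP j.
  rewrite -[V j p](subrK (ff j (x p))); apply: le_trans (ler_normD _ _) _.
  have e' : (cj j).1.1 * Y `^ (- (2 * gam)) <= Cs.
    rewrite -[leRHS]mulr1; apply: ler_pM => //.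
    by have [] := cjP j.
  have := h _ (xK p); have := MsE j; rewrite /K'; move: e e'; clear; lra.
have NY' : cw%:R * Y <= N%:R.
  apply: le_trans NY; rewrite ler_wpM2r//; first exact: le_trans Y1.
  by rewrite ler_nat leq_pmull// expn_gt0 muln_gt0 tM0.
have [phi [netphi phiE]] := H n d x V Y A B N _ VK YtM NY' AE0 B1 netV.
exists phi.
  move: netphi; rewrite /B -exprD.
  by have -> : (Dn.+2 + tM * rM + 5 + l.+1 * (Dn.+2 + tM * rM + 5) =
    l.+2 * (Dn.+2 + tM * rM + 5))%N by rewrite [in RHS]mulSn.
move=> p; rewrite -[phi p - _](subrKA (g (\col_j V j p))).
apply: le_trans (ler_normD _ _) _; rewrite mulrDl; apply: lerD; first exact: phiE.
rewrite fE -mulrA; apply: gLam.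
- by move=> j; rewrite mxE -ler_norml.
- exact/boxff/xK.
- exact: mulr_ge0.
- move=> j; rewrite !mxE; have [_ /(_ p) e] := VP j; apply: le_trans e _.
  by rewrite ler_wpM2r.
Qed.

End hierarchical_net.

(** * Rates and risk bound *)

Section clipping.
Variable R : realType.

Definition clip (M z : R) : R := Num.max (trunc M z) M^-1.

Lemma clipE (M z : R) : 0 < M -> clip M z = Num.max (Num.min z M) M^-1.
Proof.
move=> M0; have Mi : 0 < M^-1 by rewrite invr_gt0.
rewrite /clip /trunc; have [z0|z0|->] := ltgtP z 0.
- rewrite ltr0_sg// ltr0_norm// mulN1r.
  rewrite !max_r//.
    by rewrite ge_min (le_trans (ltW z0) (ltW Mi)).
  rewrite (@le_trans _ _ 0) ?(ltW Mi)// oppr_le0 le_min (ltW M0) andbT.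
  by rewrite oppr_ge0 ltW.
- by rewrite gtr0_sg// gtr0_norm// mul1r.
- by rewrite sgr0 mul0r min_l// ltW.
Qed.

Lemma clip_bounds (M z : R) : 1 < M -> M^-1 <= clip M z <= M.
Proof.
move=> M1; have M0 : 0 < M by apply: lt_trans M1.
rewrite clipE// le_max lexx orbT /= ge_max ge_min lexx orbT /=.
by rewrite (@le_trans _ _ 1) ?(ltW M1)// invf_le1 ?(ltW M1).
Qed.

Lemma clip_lip (M y z : R) : 0 < M -> `|clip M y - clip M z| <= `|y - z|.
Proof.
move=> M0; rewrite !clipE//; move: (M^-1) => m.
have h1 := ler_norm (y - z); have h2 := ler_norm (z - y); rewrite distrC in h2.
rewrite ler_norml /Num.max /Num.min; apply/andP.
move: h1 h2; move: `|y - z| => a; clear.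
do 4 (case: ifPn; rewrite -?leNgt); move=> *; split; lra.
Qed.

Lemma clip_id (M z : R) : 0 < M -> M^-1 <= z <= M -> clip M z = z.
Proof. by move=> M0 /andP[z1 z2]; rewrite clipE// min_l// max_l. Qed.

End clipping.

Section rates.
Variable R : realType.

(** The point is [e <= 4], which follows from [expR (- 1/2) >= 1/2]. *)
Lemma ln_nat_ge1 (n : nat) : (4 <= n)%N -> 1 <= ln n%:R :> R.
Proof.
move=> n4; have n0 : 0 < n%:R :> R by rewrite ltr0n (leq_trans _ n4).
rewrite -ler_expR lnK ?posrE//.
apply: (@le_trans _ _ 4); last by rewrite ler_nat.
have h1 := @expR_ge1Dx R (- 2^-1).
have h2 : expR 2^-1 * expR (- 2^-1) = 1 :> R by rewrite expRxMexpNx_1.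
have h3 : 0 < expR 2^-1 :> R by rewrite expR_gt0.
have -> : 1 = 2^-1 + 2^-1 :> R by field.
rewrite expRD; move: h1 h2 h3; move: (expR 2^-1) (expR (- 2^-1)); clear => a b.
move=> h1 h2 h3; have a2 : a <= 2 by nra.
nra.
Qed.

Lemma ln_nat_le (n : nat) : (0 < n)%N -> ln n%:R <= 2 * Num.sqrt n%:R :> R.
Proof.
move=> n0; have nR : 0 < n%:R :> R by rewrite ltr0n.
have s0 : 0 < Num.sqrt n%:R :> R by rewrite sqrtr_gt0.
rewrite -[in leLHS](sqr_sqrtr (ltW nR)) lnXn// -[leLHS]mulr_natl ler_pM2l//.
exact/ltW/ln_sublinear.
Qed.

Lemma nat_div_ln_ge1 (n : nat) : (4 <= n)%N -> 1 <= n%:R / ln n%:R :> R.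
Proof.
move=> n4; have n0 : 0 < n%:R :> R by rewrite ltr0n (leq_trans _ n4).
have l1 := ln_nat_ge1 n4.
by rewrite ler_pdivlMr ?(lt_le_trans ltr01)// mul1r ltW// ln_sublinear.
Qed.

Lemma nat_div_ln_le (n : nat) : (4 <= n)%N -> n%:R / ln n%:R <= n%:R :> R.
Proof.
move=> n4; have l1 := ln_nat_ge1 n4.
by rewrite ler_pdivrMr ?(lt_le_trans ltr01)// ler_peMr// ler0n.
Qed.

Variable gamma : R.
Hypothesis gamma0 : 2^-1 < gamma.

Lemma rateE (n : nat) : (4 <= n)%N ->
  ln n%:R `^ (2 * gamma / (2 * gamma + 1))
    * n%:R `^ (- (2 * gamma / (2 * gamma + 1))) =
  (n%:R / ln n%:R) `^ (- (2 * gamma / (2 * gamma + 1))).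
Proof.
move=> n4; have l1 := ln_nat_ge1 n4.
have l0 : 0 <= ln n%:R :> R by apply: le_trans l1.
by rewrite powRM ?invr_ge0// -[(ln _)^-1]powR_inv1// -powRrM mulN1r opprK mulrC.
Qed.

Lemma width_ge1 (n : nat) : (4 <= n)%N ->
  1 <= (n%:R / ln n%:R) `^ (1 / (4 * gamma + 2)).
Proof.
move=> n4; have := nat_div_ln_ge1 n4; move: (_ / _) => th th1.
rewrite -[leLHS](powRr0 th) ler_powR// divr_ge0//; move: gamma0; clear; lra.
Qed.

Lemma width_le (n : nat) : (4 <= n)%N ->
  (n%:R / ln n%:R) `^ (1 / (4 * gamma + 2)) <= n%:R.
Proof.
move=> n4; apply: le_trans (nat_div_ln_le n4).
have := nat_div_ln_ge1 n4; move: (_ / _) => th th1.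
rewrite -[leRHS]powRr1 ?(le_trans ler01)// ler_powR// ler_pdivrMr;
  move: gamma0; clear; lra.
Qed.

(** The exponent [1 / (4 gamma + 2)] is the one that equates the squared bias [Y^(- 4 gamma)] with
    the variance [Y^2 ln n / n] of [width_variance]; both are the claimed rate. *)
Lemma width_bias (n : nat) : (4 <= n)%N ->
  ((n%:R / ln n%:R) `^ (1 / (4 * gamma + 2)) `^ (- (2 * gamma))) ^+ 2 =
  (n%:R / ln n%:R) `^ (- (2 * gamma / (2 * gamma + 1))).
Proof.
move=> n4; rewrite -powR_mulrn ?powR_ge0// -!powRrM; congr (_ `^ _).
have h1 : 4 * gamma + 2 != 0 by move: gamma0; clear; lra.
have h2 : 2 * gamma + 1 != 0 by move: gamma0; clear; lra.
by field; rewrite h1 h2.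
Qed.

Lemma width_variance (n : nat) : (4 <= n)%N ->
  ((n%:R / ln n%:R) `^ (1 / (4 * gamma + 2))) ^+ 2 * (ln n%:R / n%:R) =
  (n%:R / ln n%:R) `^ (- (2 * gamma / (2 * gamma + 1))).
Proof.
move=> n4; have th0 := lt_le_trans ltr01 (nat_div_ln_ge1 n4).
have -> : ln n%:R / n%:R = (n%:R / ln n%:R)^-1 :> R by rewrite invf_div.
move: (n%:R / ln n%:R) th0 => th th0.
rewrite -powR_mulrn ?powR_ge0// -!powRrM -[th^-1]powR_inv1 ?(ltW th0)//.
rewrite -powRD; last by rewrite (gt_eqF th0) implybT.
congr (_ `^ _).
have h1 : 4 * gamma + 2 != 0 by move: gamma0; clear; lra.
have h2 : 2 * gamma + 1 != 0 by move: gamma0; clear; lra.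
by field; rewrite h1 h2.
Qed.

Lemma rate_ge_inv (n : nat) : (4 <= n)%N ->
  n%:R^-1 <= (n%:R / ln n%:R) `^ (- (2 * gamma / (2 * gamma + 1))).
Proof.
move=> n4; have th1 := nat_div_ln_ge1 n4; have th0 := lt_le_trans ltr01 th1.
apply: (@le_trans _ _ (n%:R / ln n%:R)^-1).
  by rewrite lef_pV2 ?posrE// ?nat_div_ln_le// ltr0n (leq_trans _ n4).
rewrite -[(_ / _)^-1]powR_inv1 ?(ltW th0)// ler_powR// lerN2 ler_pdivrMr;
  move: gamma0; clear; lra.
Qed.

(** As [ln n <= 2 sqrt n], the ratio [n / ln n] is at least [sqrt n / 2], so [n >= S] suffices. *)
Lemma width_unbounded (T : R) : exists n0 : nat, forall n, (n0 <= n)%N ->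
  T <= (n%:R / ln n%:R) `^ (1 / (4 * gamma + 2)).
Proof.
have g0 : 0 < 4 * gamma + 2 by move: gamma0; clear; lra.
pose S := (2 * Num.max T 0 `^ (4 * gamma + 2)) ^+ 2.
exists (maxn 4 (Num.truncn S).+1) => n; rewrite geq_max => /andP[n4 nS].
have l1 := ln_nat_ge1 n4.
have n0 : (0 < n)%N by apply: leq_trans n4.
have SR : S <= n%:R.
  by apply: le_trans (ltW (truncnS_gt S)) _; rewrite ler_nat.
have h : Num.max T 0 `^ (4 * gamma + 2) <= n%:R / ln n%:R.
  have s2 : 2 * Num.max T 0 `^ (4 * gamma + 2) <= Num.sqrt n%:R.
    by rewrite -[leLHS]ger0_norm ?mulr_ge0 ?powR_ge0// -sqrtr_sqr; exact: ler_wsqrtr.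
  rewrite ler_pdivlMr ?(lt_le_trans ltr01 l1)//.
  have := ln_nat_le n0; move: s2 l1.
  have := sqr_sqrtr (ler0n R n); have := sqrtr_ge0 (n%:R : R).
  have := powR_ge0 (Num.max T 0) (4 * gamma + 2).
  move: (n%:R : R) (Num.sqrt (n%:R : R)) (Num.max T 0 `^ _) (ln (n%:R : R)).
  move=> m s p q; clear.
  move=> p0 s0 <- h1 h2 h3.
  apply: (@le_trans _ _ (p * (2 * s))); first by rewrite ler_wpM2l.
  by rewrite mulrCA mulrA expr2 ler_wpM2r.
apply: (@le_trans _ _ (Num.max T 0)); first by rewrite le_max lexx.
have -> : Num.max T 0 =
    (Num.max T 0 `^ (4 * gamma + 2)) `^ (1 / (4 * gamma + 2)).
  by rewrite -powRrM mulrCA divff ?gt_eqF// mul1r powRr1// le_max lexx orbT.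
rewrite ge0_ler_powR// ?nnegrE ?powR_ge0 ?divr_ge0 ?(ltW g0)//.
by rewrite (le_trans ler01).
Qed.

End rates.

(** * Covering and approximation by the class of clipped networks *)

Section network_class.
Variable R : realType.

(** For weights and widths polynomial in [n], accuracy [1 / n] takes polynomially many grid values
    per parameter, with an exponent [m] independent of [n]: each parameter contributes [m ln n] to
    the entropy. *)
Lemma cover_size (d L p : nat) (K c : R) : 1 <= K -> 1 <= c ->
  exists n0 m : nat, forall (n N : nat) (B : R), (n0 <= n)%N ->
    N%:R <= c * n%:R -> 1 <= B <= n%:R ^+ p ->
    2 * B * (n%:R * K * (4 * (d * N)%:R * B) ^+ (2 * L.+1)) + 1 <= n%:R ^+ m.
Proof.
move=> K1 c1; pose D := (2 * L.+1)%N.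
pose S := 2 * K * (4 * d%:R * c) ^+ D + 1.
exists (Num.truncn S).+1, (p + 2 + (1 + p) * D)%N => n N B nS Nc /andP[B1 Bp].
have SR : S <= n%:R by apply: le_trans (ltW (truncnS_gt S)) _; rewrite ler_nat.
have c0 : 0 <= c by apply: le_trans c1.
have K0 : 0 <= K by apply: le_trans K1.
have B0 : 0 <= B by apply: le_trans B1.
have S1 : 1 <= S.
  by rewrite lerDr mulr_ge0 ?exprn_ge0// ?mulr_ge0.
have n1 : 1 <= n%:R :> R by apply: le_trans SR.
have h : (4 * (d * N)%:R * B) ^+ D <= (4 * d%:R * c) ^+ D * n%:R ^+ ((1 + p) * D).
  rewrite exprM -exprMn; apply: lerXn2r.
  - by rewrite nnegrE ?mulr_ge0.
  - by rewrite nnegrE ?mulr_ge0 ?exprn_ge0.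
  rewrite natrM exprD expr1.
  have -> : 4 * d%:R * c * (n%:R * n%:R ^+ p) = 4 * d%:R * (c * n%:R) * n%:R ^+ p :> R.
    by ring.
  by rewrite ler_pM ?mulr_ge0// mulrA ler_wpM2l ?mulr_ge0.
have -> : n%:R ^+ (p + 2 + (1 + p) * D) =
    n%:R ^+ p * n%:R * n%:R ^+ ((1 + p) * D) * n%:R :> R.
  by rewrite !exprD; ring.
have V0 : 0 <= (4 * d%:R * c) ^+ D by rewrite exprn_ge0// ?mulr_ge0.
have X0 : 0 <= (4 * (d * N)%:R * B) ^+ D by rewrite exprn_ge0// ?mulr_ge0.
have q1 : 1 <= n%:R ^+ ((1 + p) * D) :> R by rewrite exprn_ege1.
have P1 : 1 <= n%:R ^+ p :> R by rewrite exprn_ege1.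
move: SR h q1 P1 Bp V0 X0; rewrite /S -/D.
move: ((4 * (d * N)%:R * B) ^+ D) ((4 * d%:R * c) ^+ D).
move: (n%:R : R) (n%:R ^+ ((1 + p) * D)) (n%:R ^+ p) n1 B0 K0.
clear=> m Q P m1 B0 K0 X V SR h Q1 P1 BP V0 X0.
have m0 : 0 <= m by apply: le_trans m1.
have Q0 : 0 <= Q by apply: le_trans Q1.
have P0 : 0 <= P by apply: le_trans P1.
have T1 : 1 <= P * m * Q by rewrite !mulr_ege1.
apply: (@le_trans _ _ (P * m * Q * (2 * K * V + 1))); last first.
  by rewrite ler_wpM2l// !mulr_ge0.
rewrite mulrDr mulr1 lerD//.
have -> : P * m * Q * (2 * K * V) = (2 * P) * (m * K * (V * Q)) by ring.
by apply: ler_pM; rewrite ?mulr_ge0// ler_wpM2l// mulr_ge0.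
Qed.

(** The cover is of unclipped networks, at the common width bound [d * N]; clipping is 1-Lipschitz
    and also brings the centers into [[M^-1, M]], as the oracle inequality asks. *)
Lemma relu_class1_cover (d L p : nat) (K c : R) : 1 <= K -> 1 <= c -> (0 < d)%N ->
  exists n0 m : nat, forall (n N : nat) (B M : R), (n0 <= n)%N -> (0 < N)%N ->
    N%:R <= c * n%:R -> 1 <= B <= n%:R ^+ p -> 0 < M ->
    exists (T : finType) (F : T -> 'cV[R]_d -> R),
      (#|T| <= n ^ (m * (L.+1 * (d * N * (d * N) + d * N))))%N /\
      forall f, relu_class1 R L d N M B f -> exists k, forall x : 'cV[R]_d,
        (forall j, - K <= x j 0 <= K) -> `|f x - clip M (F k x)| <= n%:R^-1.
Proof.
move=> K1 c1 d0; have [n0 [m nm]] := @cover_size d L p K c K1 c1.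
exists n0.+1, m => n N B M nn0 N0 Nc Bp M0.
have n1 : (0 < n)%N by apply: leq_trans nn0.
have nR : 0 < n%:R :> R by rewrite ltr0n.
have := nm n N B (ltnW nn0) Nc Bp; have [B1 _] := andP Bp.
have K0 : 0 < K by apply: lt_le_trans K1.
have B0 : 0 < B by apply: lt_le_trans B1.
have dN0 : (0 < d * N)%N by rewrite muln_gt0 d0.
set X := _ ^+ (2 * L.+1) => hq.
have X0 : 0 < X by rewrite exprn_gt0// !mulr_gt0// ltr0n.
pose e := (n%:R * K * X)^-1.
have e0 : 0 < e by rewrite invr_gt0 !mulr_gt0.
pose q := (Num.truncn (2 * B / e)).+1.
have qB : 2 * B / e < q%:R by exact: truncnS_gt.
have qn : (q <= n ^ m)%N.
  rewrite -(ler_nat R) natrX; apply: le_trans hq.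
  rewrite /q -addn1 natrD lerD2r.
  have -> : 2 * B * (n%:R * K * X) = 2 * B / e by rewrite /e invrK.
  by rewrite truncn_le ltW// divr_gt0// mulr_gt0.
have [T [F [Tq FP]]] := @relu_net_cover R N 1 B (d * N)%N e q L d K B1 dN0
  (leq_pmull _ d0) dN0 e0 qB (leq_pmulr _ N0) K1.
exists T, (fun k x => F k x 0 0); split.
  by rewrite (leq_trans Tq)// (expnM n) leq_exp2r// muln_gt0 addn_gt0 dN0 orbT.
move=> f [h [g gn hE] fE]; have [k kP] := FP _ gn; exists k => x xK.
rewrite -fE hE mxE; apply: le_trans (clip_lip _ _ M0) _.
have : sup_le x K by move=> i; rewrite ler_norml.
move=> /kP /(_ 0); rewrite !mxE => /le_trans; apply.
rewrite -/X /e -mulrA !invfM -!mulrA.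
have -> : n%:R^-1 * (K^-1 * (X^-1 * (K * X))) = n%:R^-1 * ((K^-1 * K) * (X^-1 * X)).
  by ring.
by rewrite !mulVf ?gt_eqF// !mulr1.
Qed.
End network_class.

Section class_approximation.
Variable R : realType.

Lemma relu_class1_approx (PP : set (R * nat)) (gam : R) (tM rM Dn : nat) (C : R)
    (d l : nat) :
  0 < C -> 0 <= gam -> bounded_class PP gam tM rM -> 2 * gam * tM%:R <= Dn%:R ->
  (0 < tM)%N ->
  let cw := (tM * (Dn.+2 + 5) + rM.+1 ^ (2 * tM) * (Dn.+2 + 1) + 2)%N in
  forall f K (M : R), hclass C PP l.+1 f -> 0 < K -> 0 < M ->
    (forall x : 'cV[R]_d, (forall j, - K <= x j 0 <= K) -> M^-1 <= f x <= M) ->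
  exists (n0 : nat) (Cst : R), 0 <= Cst /\
  forall n (x : 'I_n -> 'cV[R]_d) Y B N, (n0 <= n)%N ->
    (forall i j, - K <= x i j 0 <= K) -> 2 ^+ tM <= Y -> Y <= n%:R ->
    n%:R ^+ ((Dn + 6) * (l.+1 * (Dn.+2 + tM * rM + 5))) <= B ->
    ((2 * tM) ^ l * cw)%:R * Y <= N%:R ->
  exists2 g, relu_class1 R (l.+1 * (tM * rM + 2 + Dn.+2)) d N M B g &
    forall i, `|g (x i) - f (x i)| <= Cst * Y `^ (- (2 * gam)).
Proof.
move=> C0 gam0 bPP hDn tM0 cw f K M hf K0 M0 fM.
have [Cst [A0 [M' [Cst0 A01 _ H]]]] := hclass_net C0 gam0 bPP hDn tM0 hf K0.
exists (Num.truncn (4 * A0)).+1, Cst; split=> // n x Y B N nA xK Y2 Yn nB NY.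
have nA0 : 4 * A0 <= n%:R.
  by apply: le_trans (ltW (truncnS_gt _)) _; rewrite ler_nat.
have n1 : 1 <= n%:R :> R by rewrite ler1n (leq_trans _ nA).
have Y1 : 1 <= Y by apply: le_trans Y2; rewrite exprn_ege1// ler1n.
have Y0 : 0 <= Y by apply: le_trans Y1.
have A00 : 0 <= A0 by apply: le_trans A01.
pose A := A0 * (n.+1%:R * Y ^+ (Dn.+2 + 2)).
have [phi netphi phiE] := H n x Y A N xK Y2 NY (lexx A).
have A2 : 2 * A <= n%:R ^+ (Dn + 6).
  have -> : n%:R ^+ (Dn + 6) = n%:R * (n%:R * n%:R ^+ (Dn.+2 + 2)) :> R.
    by rewrite -!exprS !addSn !addnS.
  apply: (@le_trans _ _ (4 * A0 * (n%:R * n%:R ^+ (Dn.+2 + 2)))); last first.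
    by rewrite ler_wpM2r// mulr_ge0// exprn_ge0.
  have -> : 2 * A = 2 * A0 * (n.+1%:R * Y ^+ (Dn.+2 + 2)) by rewrite /A mulrA.
  have -> : 4 * A0 * (n%:R * n%:R ^+ (Dn.+2 + 2)) =
      2 * A0 * (2 * n%:R * n%:R ^+ (Dn.+2 + 2)) by ring.
  rewrite ler_wpM2l ?mulr_ge0// ler_pM ?exprn_ge0//.
    by rewrite -natr1; move: n1; clear; lra.
  by apply: lerXn2r; rewrite ?nnegrE.
have A20 : 0 <= 2 * A by do 3 (apply: mulr_ge0 => //); exact: exprn_ge0.
have AB : (2 * A) ^+ (l.+1 * (Dn.+2 + tM * rM + 5)) <= B.
  apply: le_trans nB; rewrite (exprM n%:R); apply: lerXn2r => //.
  by rewrite nnegrE exprn_ge0.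
have B0 : 0 <= B by apply: le_trans AB; rewrite exprn_ge0.
have net1 : net x (l.+1 * (tM * rM + 2 + Dn.+2)) N B (fun _ : 'I_1 => phi).
  apply: (net_reindex B0) (net_le AB netphi) => j; left; exists tt; reflexivity.
have [g gn gE] := net_relu_net net1.
exists (fun z => clip M (g z 0 0)).
  exists (fun z => \col_i Num.max (trunc M (g z i 0)) M^-1); first by exists g.
  by apply/funext => z; rewrite mxE.
(* Clipping fixes the values of [f] and is 1-Lipschitz, so it does not increase the error. *)
move=> i; rewrite gE -(clip_id M0 (fM _ (xK i))).
by apply: le_trans (clip_lip _ _ M0) (phiE i).
Qed.
End class_approximation.

Section large_samples.
Variable R : realType.

Lemma mean_le n (v : 'I_n -> R) (c : R) : (0 < n)%N -> (forall i, v i <= c) ->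
  n%:R^-1 * \sum_(i < n) v i <= c.
Proof.
move=> n0 vc; rewrite ler_pdivrMl ?ltr0n//.
apply: (@le_trans _ _ (\sum_(i < n) c)); first by apply: ler_sum.
by rewrite sumr_const card_ord mulr_natl.
Qed.

Lemma class_deviation (n p T : nat) : (4 <= n)%N -> (T <= n ^ p)%N ->
  T.+2%:R * expR (- ((2 + p)%:R * ln n%:R)) <= n%:R^-1 :> R.
Proof.
move=> n4 Tn; have n0 : (0 < n)%N by apply: leq_trans n4.
have nR : 0 < n%:R :> R by rewrite ltr0n.
have nnR : n%:R != 0 :> R by rewrite gt_eqF.
rewrite expRN expRM_natl lnK ?posrE// ler_pdivrMr ?exprn_gt0//.
rewrite exprD expr2 -!mulrA mulKf// -natrX -natrM ler_nat.
have : (0 < n ^ p)%N by rewrite expn_gt0 n0.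
by move: Tn n4; move: (n ^ p)%N => q; clear; nia.
Qed.

Lemma parameter_count (m L d N : nat) (c Y : R) : 1 <= Y -> 0 <= c ->
  N%:R <= c * Y ->
  (2 + m * (L.+1 * (d * N * (d * N) + d * N)))%:R <=
    (2 + (m * L.+1)%:R * 2 * (d%:R * c + 1) ^+ 2) * Y ^+ 2.
Proof.
move=> Y1 c0 NY; rewrite natrD mulnA natrM mulrDl lerD//.
  by rewrite ler_peMr// exprn_ege1.
rewrite -[leRHS]mulrA -[leRHS]mulrA ler_wpM2l// -exprMn.
rewrite natrD !natrM.
have : d%:R * N%:R <= d%:R * (c * Y) by rewrite ler_wpM2l.
have : 0 <= d%:R * N%:R :> R by rewrite mulr_ge0.
have -> : (d%:R * c + 1) * Y = d%:R * (c * Y) + Y by rewrite mulrDl mul1r mulrA.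
move: (d%:R * N%:R) (d%:R * (c * Y)) Y1; clear=> x z Y1 x0 xz.
have h : 0 <= x * (z + Y - x - 1) by rewrite mulr_ge0//; lra.
have h' : 0 <= (z + Y - x - 1) * (z + Y) by rewrite mulr_ge0//; lra.
by nra.
Qed.

(** The oracle inequality is used with mesh [1 / n] and level [t = (2 + pc) ln n], where [n^pc]
    bounds the size of the cover. The summands [Cst^2], [kap] and 1 of the constant belong to the
    bias, to the level [t / n] and to the mesh. *)
Lemma large_sample_risk (PP : set (R * nat)) (gam : R) (tM rM Dn : nat) (C : R)
    (d l : nat) :
  0 < C -> 2^-1 < gam -> bounded_class PP gam tM rM ->
  2 * gam * tM%:R <= Dn%:R -> (0 < tM)%N -> (0 < d)%N ->
  let cw := (tM * (Dn.+2 + 5) + rM.+1 ^ (2 * tM) * (Dn.+2 + 1) + 2)%N in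
  let c := ((2 * tM) ^ l * cw)%N in
  let L := (l.+1 * (tM * rM + 2 + Dn.+2))%N in
  let p := ((Dn + 6) * (l.+1 * (Dn.+2 + tM * rM + 5)))%N in
  forall f K (M smax : R), hclass C PP l.+1 f -> 0 < K -> 1 < M -> 0 <= smax ->
    (forall x : 'cV[R]_d, (forall j, - K <= x j 0 <= K) -> M^-1 <= f x <= M) ->
  exists (n0 : nat) (C' : R), 0 < C' /\
  forall n (x : 'I_n -> 'cV[R]_d) (sig : R) (N : nat) (disp : measure_display)
    (Om : measurableType disp) (Pr : probability Om R)
    (xi tau : 'I_n -> {RV Pr >-> R}) (fhat : Om -> 'cV[R]_d -> R),
    (n0 <= n)%N ->
    (forall i j, - K <= x i j 0 <= K) ->
    0 <= sig <= smax ->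
    c%:R * (n%:R / ln n%:R) `^ (1 / (4 * gam + 2)) <= N%:R
      <= (c%:R + 1) * (n%:R / ln n%:R) `^ (1 / (4 * gam + 2)) ->
    (forall i, centered_gaussian 1 (xi i)) ->
    (forall i, centered_gaussian sig (tau i)) ->
    mutually_independent xi -> mutually_independent tau ->
    independent_families xi tau ->
    (forall w, argmin (relu_class1 R L d N M (n%:R ^+ p))
       (nll x sig (fun i => f (x i) * xi i w + tau i w)) (fhat w)) ->
    exists A : set Om, [/\ measurable A,
      ((1 - n%:R^-1)%:E <= Pr A)%E &
      forall w, A w -> emp_sqnorm x (fun z => fhat w z - f z) <=
        C' * (n%:R / ln n%:R) `^ (- (2 * gam / (2 * gam + 1)))].
Proof.
move=> C0 gam0 bPP hDn tM0 d0 cw c L p f K M smax hf K0 M1 smax0 fM.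
have M0 : 0 < M by apply: lt_trans M1.
have g0 : 0 <= gam by move: gam0; clear; lra.
have [C1 [C10 oracle]] := oracle_inequality M1 smax0.
have [n1 [Cst [Cst0 approx]]] := relu_class1_approx C0 g0 bPP hDn tM0 hf K0 M0 fM.
(* Covers are stated for boxes of size at least 1, so the data box is enlarged. *)
have K1 : 1 <= K + 1 by rewrite lerDr ltW.
have c1 : 1 <= c%:R + 1 :> R by rewrite lerDr.
have [n2 [m cover]] := @relu_class1_cover R d L p _ _ K1 c1 d0.
have [n3 wide] := width_unbounded gam0 (2 ^+ tM).
have [kap [kapE kap0]] : exists kap : R,
    kap = 2 + (m * L.+1)%:R * 2 * (d%:R * (c%:R + 1) + 1) ^+ 2 /\ 0 <= kap.
  by eexists; split; [reflexivity|rewrite addr_ge0// !mulr_ge0// exprn_ge0].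
exists (maxn 4 (maxn n1 (maxn n2 n3))), (C1 * (Cst ^+ 2 + kap + 1)).
split; first by rewrite mulr_gt0// ltr_wpDl// addr_ge0// exprn_ge0.
move=> n x sig N disp Om Pr xi tau fhat; rewrite !geq_max.
move=> /and4P[n4 nn1 nn2 nn3] xK sigs NY xiG tauG xiI tauI xitau fhatP.
have n0 : (0 < n)%N by apply: leq_trans n4.
have nR : 0 < n%:R :> R by rewrite ltr0n.
have := width_bias gam0 n4; have := width_variance gam0 n4.
have := rate_ge_inv gam0 n4; have := width_ge1 gam0 n4.
have := width_le gam0 n4; have := wide n nn3; move: NY.
move: (_ `^ (1 / (4 * gam + 2))) (_ `^ (- (2 * gam / (2 * gam + 1)))) => Y rho.
move=> /andP[NY1 NY2] Y2 Yn Y1 rhon rhov rhob.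
have cpos : (0 < c)%N by rewrite /c muln_gt0 expn_gt0 muln_gt0 tM0 /cw addn2.
have N0 : (0 < N)%N.
  rewrite -(ltr0n R); apply: lt_le_trans NY1.
  by rewrite mulr_gt0 ?ltr0n// (lt_le_trans ltr01).
have n1R : 1 <= n%:R :> R by rewrite ler1n.
have B1 : 1 <= (n%:R : R) ^+ p <= n%:R ^+ p by rewrite lexx andbT exprn_ege1.
have [g gcl gE] := approx n x Y (n%:R ^+ p) N nn1 xK Y2 Yn (lexx _) NY1.
have c10 : 0 <= c%:R + 1 :> R by apply: le_trans c1.
have Nn : N%:R <= (c%:R + 1) * n%:R :> R.
  by apply: le_trans NY2 _; rewrite ler_wpM2l.
have [T [F [Tn FP]]] := cover n N (n%:R ^+ p) M nn2 N0 Nn B1 M0.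
have clipM h (z : 'cV[R]_d) : relu_class1 R L d N M (n%:R ^+ p) h -> M^-1 <= h z <= M.
  by move=> [h1 [h2 _ ->] <-]; rewrite mxE; exact: clip_bounds.
set pc := (m * _)%N in Tn.
have ln0 : 0 <= ln n%:R :> R by rewrite ln_ge0.
have t0 : 0 <= (2 + pc)%:R * ln n%:R :> R by rewrite mulr_ge0.
have eta1 : 0 <= (n%:R : R)^-1 <= 1 by rewrite invr_ge0 ler0n invf_le1.
have aM i : M^-1 <= f (x i) <= M by exact: fM.
have uM i : M^-1 <= g (x i) <= M by exact: clipM.
have FM k i : M^-1 <= clip M (F k (x i)) <= M by exact: clip_bounds.
have [A [mA PA AP]] := oracle _ Om Pr n xi tau sig (fun i => f (x i))
  (fun i => g (x i)) T (fun k i => clip M (F k (x i))) n%:R^-1 _ n0 sigs xiG tauG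
  xiI tauI xitau aM uM FM eta1 t0.
exists A; split=> //.
  by apply: le_trans PA; rewrite lee_fin lerB// class_deviation.
move=> w Aw; have [fcl fmin] := fhatP w.
have fk : exists k, forall i, `|fhat w (x i) - clip M (F k (x i))| <= n%:R^-1.
  have [k kP] := FP _ fcl; exists k => i; apply: kP => j.
  have /andP[h1 h2] := xK i j; apply/andP.
  by split; move: h1 h2; move: (x i j 0); clear => z h1 h2; lra.
have := AP w Aw (fun i => fhat w (x i)) (fun i => clipM _ _ fcl) fk (fmin _ gcl).
move=> /le_trans; apply; rewrite -[leRHS]mulrA ler_wpM2l ?(ltW C10)//.
rewrite [leRHS]mulrDl [in leRHS]mulrDl mul1r; apply: lerD => //; apply: lerD.
  apply: mean_le => // i; rewrite -rhob -exprMn -real_normK ?num_real//.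
  by rewrite lerXn2r ?nnegrE ?mulr_ge0 ?powR_ge0.
rewrite -rhov [leRHS]mulrA -[leLHS]mulrA ler_wpM2r ?divr_ge0//.
by rewrite kapE; exact: parameter_count.
Qed.

End large_samples.

Lemma admissible_bounded_class (R : realType) (PP : set (R * nat)) (gamma : R) :
  admissible PP -> is_dim_adj_smoothness PP gamma ->
  exists m : nat, (0 < m)%N /\ bounded_class PP gamma m m.
Proof.
move=> [PP1 [ub ubP]] [bt0 [PP0 amin] gE].
exists (Num.truncn ub).+1; split=> // bt PPbt; have [b1 b2] := PP1 _ PPbt.
have : Num.max bt.1 bt.2%:R <= ub by apply: ubP; exists bt.
rewrite ge_max => /andP[ub1 ub2]; have ubm := ltW (truncnS_gt ub).
split=> //; first exact: le_trans ubm.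
  by rewrite -(ler_nat R) (le_trans ub2).
by rewrite -ler_pdivlMr ?ltr0n// gE; exact: amin.
Qed.

Lemma relu_class1_sqr_dist (R : realType) (L d N : nat) (M B : R)
    (f g : 'cV[R]_d -> R) (x : 'cV[R]_d) : 1 < M ->
  relu_class1 R L d N M B f -> M^-1 <= g x <= M -> (f x - g x) ^+ 2 <= M ^+ 2.
Proof.
move=> M1 [h [h' _ ->] <-] /andP[g1 g2].
have M0 : 0 < M by apply: lt_trans M1.
have : 0 < M^-1 by rewrite invr_gt0.
have := clip_bounds (h' x 0 0) M1; rewrite mxE -/(clip M _).
move: (clip _ _) (g x) (M^-1) g1 g2 => a b m g1 g2 /andP[a1 a2] m0.
rewrite -[leLHS]real_normK ?num_real// lerXn2r ?nnegrE ?normr_ge0 ?(ltW M0)//.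
rewrite ler_norml; apply/andP.
by split; move: g1 g2 a1 a2 m0; clear; lra.
Qed.

Theorem theorem1 (R : realType) (l : nat) (PP : set (R * nat)) (gamma : R)
    (hl : (1 <= l)%N) (hPP : admissible PP)
    (hgamma : is_dim_adj_smoothness PP gamma) (hgamma2 : 2^-1 < gamma) :
  exists c1 c2 c3 c4 c5 c6 : R,
  (* the constants are positive and the hyperparameter ranges are nonempty *)
  [/\ [/\ 0 < c1, 0 < c3 & 0 < c5],
      exists L0 : nat, c1 <= L0%:R <= c2,
      c3 <= c4,
      c5 < c6 &
  forall (C : R) (d : nat) (K M fmin fmax sigma_max : R) (fstar : 'cV[R]_d -> R),
    0 < C -> (1 <= d)%N -> 0 < K -> 0 <= sigma_max ->
    [/\ 0 < M^-1, M^-1 < fmin, fmin < fmax & fmax < M] ->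
    hclass C PP l fstar ->
    (forall x : 'cV[R]_d, (forall j, - K <= x j 0 <= K) ->
       fmin <= fstar x <= fmax) ->
  exists C' c' : R, [/\ 0 < C', 0 < c' &
  forall (n : nat) (x : 'I_n -> 'cV[R]_d) (sigma_tau : R) (L N : nat) (B : R)
    (disp : measure_display) (Om : measurableType disp) (Pr : probability Om R)
    (xi tau : 'I_n -> {RV Pr >-> R}) (fhat : Om -> 'cV[R]_d -> R),
    (0 < n)%N ->
    (forall i j, - K <= x i j 0 <= K) ->
    0 <= sigma_tau <= sigma_max ->
    c1 <= L%:R <= c2 ->
    0 < B ->
    c3 * ln n%:R <= ln B <= c4 * ln n%:R ->
    c5 * (n%:R / ln n%:R) `^ (1 / (4 * gamma + 2)) <= N%:R
      <= c6 * (n%:R / ln n%:R) `^ (1 / (4 * gamma + 2)) ->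
    (forall i, centered_gaussian 1 (xi i)) ->
    (forall i, centered_gaussian sigma_tau (tau i)) ->
    mutually_independent xi ->
    mutually_independent tau ->
    independent_families xi tau ->
    let y (w : Om) (i : 'I_n) : R := fstar (x i) * xi i w + tau i w in
    (forall w, argmin (relu_class1 R L d N M B) (nll x sigma_tau (y w)) (fhat w)) ->
    exists A : set Om, [/\ measurable A,
      ((1 - n%:R `^ (- c'))%:E <= Pr A)%E &
      forall w, A w ->
        emp_sqnorm x (fun z => fhat w z - fstar z) <=
          C' * ln n%:R `^ (2 * gamma / (2 * gamma + 1))
             * n%:R `^ (- (2 * gamma / (2 * gamma + 1)))]]].
Proof.
case: l hl => // l' _.
have [m [m0 bPP]] := admissible_bounded_class hPP hgamma.
have g0 : 0 < gamma by move: hgamma2; clear; lra.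
have := truncnS_gt (2 * gamma * m%:R).
move: (Num.truncn _).+1 => Dn /ltW hDn.
have Dn0 : (0 < Dn)%N.
  by rewrite -(ltr0n R); apply: lt_le_trans hDn; rewrite !mulr_gt0// ltr0n.
pose cw := (m * (Dn.+2 + 5) + m.+1 ^ (2 * m) * (Dn.+2 + 1) + 2)%N.
pose c := ((2 * m) ^ l' * cw)%N.
pose L0 := (l'.+1 * (m * m + 2 + Dn.+2))%N.
pose p := ((Dn + 6) * (l'.+1 * (Dn.+2 + m * m + 5)))%N.
have c0 : (0 < c)%N by rewrite muln_gt0 expn_gt0 muln_gt0 m0 /cw addn2.
have L00 : (0 < L0)%N by rewrite muln_gt0 addnS.
have p0 : (0 < p)%N by rewrite !muln_gt0 !addnS.
(* The ranges of [L] and [ln B] are single points, with [B = n^p]; [N] keeps a window as long as the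
   scale [(n / ln n)^(1 / (4 gamma + 2))] itself. *)
exists L0%:R, L0%:R, p%:R, p%:R, c%:R, (c%:R + 1); split=> //.
- by rewrite !ltr0n.
- by exists L0; rewrite lexx.
- by rewrite ltrDl.
move=> C d K M fmin fmax smax f C0 d0 K0 smax0 [Mi0 Mf ff fM] hf fb.
have M0 : 0 < M by rewrite -invr_gt0.
have M1 : 1 < M.
  have : M^-1 < M by apply: lt_trans Mf (lt_trans ff fM).
  by rewrite -[X in X < _]mul1r ltr_pdivrMr// -expr2 expr_gt1// ltW.
have fM' (x : 'cV[R]_d) : (forall j, - K <= x j 0 <= K) -> M^-1 <= f x <= M.
  move=> /fb /andP[f1 f2].
  by rewrite (le_trans (ltW Mf) f1) (le_trans f2 (ltW fM)).
have [n0 [C1 [C10 large]]] :=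
  large_sample_risk C0 hgamma2 bPP hDn m0 d0 hf K0 M1 smax0 fM'.
set e := 2 * gamma / (2 * gamma + 1).
have e0 : 0 <= e by rewrite divr_ge0//; move: g0; clear; lra.
(* A lower bound for the rate when [2 <= n < maxn n0 4]; there the loss is at most [M^2], and the
   summand [M^2 / r0] of [C'] covers it. *)
pose r0 : R := ln 2 `^ e * (maxn n0 4)%:R `^ (- e).
have ln2 : 0 < ln 2 :> R by rewrite ln_gt0// ltr1n.
have r00 : 0 < r0.
  by rewrite mulr_gt0// powR_gt0// ltr0n (leq_trans _ (leq_maxr _ _)).
have C20 : 0 <= M ^+ 2 / r0 by rewrite divr_ge0 ?(ltW r00)// exprn_ge0// ltW.
exists (C1 + M ^+ 2 / r0), 1; split=> //; first exact: ltr_pwDl.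
move=> n x sig L N B disp Om Pr xi tau fhat n_gt0 xK sigs.
rewrite -eq_le eqr_nat => /eqP LE B0.
rewrite -eq_le => /eqP BE NY xiG tauG xiI tauI xitau y fhatP; rewrite -{}LE in fhatP.
have nR : 0 < n%:R :> R by rewrite ltr0n.
have BnE : B = n%:R ^+ p by rewrite -[LHS]lnK ?posrE// -BE expRM_natl lnK ?posrE.
(* For [n = 1] the rate vanishes with [ln 1], but so does the required probability, and the empty
   event will do. *)
have [n1|n1] := leqP n 1.
  have {}n1 : n = 1%N by apply/eqP; rewrite eqn_leq n1.
  by exists set0; split=> //; rewrite measure0 lee_fin n1 powR1 subrr.
have [nn0|nn0] := ltnP n (maxn n0 4).
  exists setT; split=> //.
    by rewrite probability_setT lee_fin gerBl powR_ge0.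
  move=> w _; have [fcl _] := fhatP w.
  have r0n : r0 <= ln n%:R `^ e * n%:R `^ (- e).
    rewrite ler_pM ?powR_ge0//.
      rewrite ge0_ler_powR// ?nnegrE ?ln_ge0 ?ler1n ?(ltW ln2)//.
      by rewrite ler_ln ?posrE ?ler_nat.
    rewrite !powRN lef_pV2 ?posrE ?powR_gt0 ?ltr0n//; last first.
      exact: leq_trans nn0.
    by rewrite ge0_ler_powR ?nnegrE// ler_nat ltnW.
  apply: (@le_trans _ _ (M ^+ 2)).
    apply: mean_le => // i; apply: relu_class1_sqr_dist M1 fcl _.
    exact: fM'.
  rewrite -mulrA; apply: (@le_trans _ _ ((C1 + M ^+ 2 / r0) * r0)).
    by rewrite mulrDl divfK ?gt_eqF// lerDr ltW// mulr_gt0.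
  by rewrite ler_wpM2l// addr_ge0 ?(ltW C10).
move: nn0; rewrite geq_max => /andP[nn0 n4].
have fhatP' w : argmin (relu_class1 R L0 d N M (n%:R ^+ p))
    (nll x sig (fun i => f (x i) * xi i w + tau i w)) (fhat w).
  by rewrite -BnE; exact: fhatP.
have [A [mA PA AP]] :=
  large n x sig N _ Om Pr xi tau fhat nn0 xK sigs NY xiG tauG xiI tauI xitau fhatP'.
exists A; split=> //; first by rewrite powR_inv1 ?(ltW nR).
move=> w /AP /le_trans; apply; rewrite -[leRHS]mulrA -(rateE gamma n4) -/e.
by rewrite ler_wpM2r ?mulr_ge0 ?powR_ge0// lerDl.
Qed.
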